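(* Let $\omega_0,\dots,\omega_{\ell-1}\in H_{\mathrm{dR}}(\mathcal{R},k)\subset H_{\mathrm{dR}}(\mathcal{R},k_v)$ be the elements defined in the context. For every integer $s$ with $0\leq s<\ell$, write $s+d=s_0+n_s'\ell$ with integers $0\leq s_0<\ell$ and $n_s'\geq 0$. Then \[ \varrho_v\cdot\omega_s=(-1)^{n_s'}\cdot C_s\cdot\frac{\Gamma_{\mathrm{ari},v}\Big(1-\Big\langle\frac{q^{s+d}}{q^{\ell}-1}\Big\rangle\Big)}{\Gamma_{\mathrm{ari},v}\Big(1-\Big\langle\frac{q^{s+d-1}}{q^{\ell}-1}\Big\rangle\Big)^q}\cdot\omega_{s_0},\qquad C_s:=\begin{cases}-v,& s=0,\\ 1,& s>0,\end{cases} \] where $\langle z\rangle$ denotes the fractional part of $z\in\mathbb{Q}$ (so $0\leq\langle z\rangle<1$ and $z-\langle z\rangle\in\mathbb{Z}$).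
   Context: Let $p$ be a prime, $q$ a power of $p$, $A=\mathbb{F}_q[\theta]$, $k=\mathbb{F}_q(\theta)$. Let $v\in A$ be monic irreducible of degree $d$, written $v=\theta^d+\epsilon_1\theta^{d-1}+\dots+\epsilon_d$ ($\epsilon_j\in\mathbb{F}_q$), $k_v$ the completion of $k$ at $v$, and $\varepsilon=\lim_{i\to\infty}\theta^{q^{id}}\in k_v$ the Teichmüller lift of $\theta\bmod v$, so $k_v=\mathbb{F}_{q^d}(\!(\theta-\varepsilon)\!)$ with valuation ring $A_v=\mathbb{F}_{q^d}[\![\theta-\varepsilon]\!]$ and maximal ideal $\mathfrak m_v$. For $i\geq0$ let $D_{i,v}$ be the product of all monic polynomials of degree $i$ in $A$ not divisible by $v$; for $z\in\mathbb{Z}_p$ with $q$-adic digits $z=\sum_{i\ge0}z_iq^i$ ($0\le z_i<q$) put $\Gamma_{\mathrm{ari},v}(z+1)=\prod_{i\geq0}(-D_{i,v})^{z_i}\in k_v^\times$ (convergent), defining $\Gamma_{\mathrm{ari},v}:\mathbb{Z}_p\to k_v^\times$. Let $t$ be a new variable; for a polynomial $f=\sum a_it^i$ put $f^{(n)}=\sum a_i^{q^n}t^i$. Fix $\ell\geq1$. Let $\mathcal{R}=\prod_{i=0}^{\ell-1}A[t]$ with the Frobenius-semilinear operator $\tau(m_0,\dots,m_{\ell-1})=((t-\theta)m_{\ell-1}^{(1)},m_0^{(1)},\dots,m_{\ell-2}^{(1)})$. For $j\ge1$ let $\langle\tau^j\mathcal R\rangle_k$ be the $k$-linear span of $\tau^j(\mathcal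 R)$ inside $\prod_{i=0}^{\ell-1}k[t]$; concretely $\langle\tau\mathcal R\rangle_k=(t-\theta)k[t]\times k[t]^{\ell-1}$. Put $H_{\mathrm{dR}}(\mathcal R,k)=\langle\tau\mathcal R\rangle_k/(t-\theta)\langle\tau\mathcal R\rangle_k$ and $H_{\mathrm{dR}}(\mathcal R,k_v)=k_v\otimes_kH_{\mathrm{dR}}(\mathcal R,k)$; the inclusion $\langle\tau^d\mathcal R\rangle_k\subset\langle\tau\mathcal R\rangle_k$ induces an isomorphism $\langle\tau^d\mathcal R\rangle_k/(t-\theta)\langle\tau^d\mathcal R\rangle_k\cong H_{\mathrm{dR}}(\mathcal R,k)$. Let $\omega_0$ be the class of $((t-\theta),0,\dots,0)$ and, for $0<s<\ell$, $\omega_s$ the class of the $s$-th standard basis vector $e_s$. Let $\overline{\mathcal R}=\prod_{i=0}^{\ell-1}\mathbb{F}_{q^d}[t]$ with $\tau(\bar m_0,\dots,\bar m_{\ell-1})=((t-\varepsilon)\bar m_{\ell-1}^{(1)},\bar m_0^{(1)},\dots,\bar m_{\ell-2}^{(1)})$ (the reduction of $\mathcal R$ modulo $v$), let $\tau^d\overline{\mathcal R}$ denote the $\mathbb{F}_{q^d}[t]$-span of $\tau^d(\overline{\mathcal R})$, and $H_{\mathrm{cris}}(\mathcal R,k_v)=k_v\otimes_{\mathbb{F}_{q^d}[t],\,t\mapsto\theta}\tau^d\overline{\mathcal R}$. Let $\tau_v$ be the $k_v$-linear endomorphism $c\otimes m\mapsto c\otimes\tau^dm$ of $H_{\mathrm{cris}}(\mathcal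 R,k_v)$. Comparison isomorphism: let $T_v=t^d+\epsilon_1t^{d-1}+\dots+\epsilon_d\in\mathbb{F}_q[t]$ and embed $\mathbb{F}_q[t]\hookrightarrow\mathbb{F}_{q^d}[\![T_v]\!]$ so that $t\equiv\varepsilon\bmod T_v$; under $T_v\mapsto v$ the series $t(T_v)$ evaluates to $\theta$. Let $A_v[\![T_v,T_v^{-1}\}\!\}$ be the ring of series $\sum_{i\in\mathbb{Z}}b_iT_v^i$, $b_i\in A_v$, with $b_iv^{ni}\to0$ as $i\to-\infty$ for every $n>0$; Frobenius twists act on the coefficients $b_i$. Let $\varpi(T_v)=\prod_{i\ge0}(1-v^{q^{di}}/T_v)$ and $B=A_v[\![T_v,T_v^{-1}\}\!\}[\varpi^{-1}]$. Equip $B\otimes_{\mathbb{F}_{q^d}[t]}\overline{\mathcal R}$ and $B\otimes_{A[t]}\mathcal R$ with $\tau^d(f\otimes m)=f^{(d)}\otimes\tau^dm$. There is a unique $B$-linear isomorphism between them commuting with $\tau^d$ and reducing to the identity modulo $\mathfrak m_v$ (Hartl–Kim). Via the inclusion $A_v[\![T_v,T_v^{-1}\}\!\}[\varpi^{(d)}(T_v)^{-1}]\subset k_v[\![T_v-v]\!]$ it induces the Hartl–Kim crystalline–de Rham isomorphism $\Phi_v:k_v[\![T_v-v]\!]\otimes_{\mathbb{F}_{q^d}[t]}\tau^d\overline{\mathcal R}\cong k_v[\![T_v-v]\!]\otimes_{k[t]}\langle\tau^d\mathcal R\rangle_k$; reducing modulo $T_v-v$ and using the isomorphism above gives a $k_v$-linear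 isomorphism $\phi_v:H_{\mathrm{cris}}(\mathcal R,k_v)\to H_{\mathrm{dR}}(\mathcal R,k_v)$. Define $\varrho_v=\phi_v\circ\tau_v\circ\phi_v^{-1}$. *)

(* Defs.v *)
From HB Require Import structures.
From mathcomp Require Import all_boot all_order all_algebra all_field.
From mathcomp Require Import mathcomp_extra boolp classical_sets.
From mathcomp Require Import zify ring lra.

Set Implicit Arguments.
Unset Strict Implicit.
Unset Printing Implicit Defensive.

Import Order.TTheory GRing.Theory Num.Theory.
Local Open Scope ring_scope.
Local Open Scope quotient_scope.

Record place (F : finFieldType) := Place {
  place_poly :> {poly F};
  place_monic : place_poly \is monic;
  place_irr : irreducible_poly place_poly
}.

(* The value of [ord] at 0 is irrelevant: [vge ord n x] reads "v(x) >= n" with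
   the convention v(0) = +oo. *)
Definition vge (K : fieldType) (ord : K -> int) (n : int) (x : K) : bool :=
  (x == 0) || (n <= ord x).

Definition vcvg (K : fieldType) (ord : K -> int) (u : nat -> K) (l : K) : Prop :=
  forall N : nat, exists n0 : nat, forall n : nat, (n0 <= n)%N ->
    vge ord N%:Z (u n - l).

Definition vcauchy (K : fieldType) (ord : K -> int) (u : nat -> K) : Prop :=
  forall N : nat, exists n0 : nat, forall m n : nat, (n0 <= m)%N -> (n0 <= n)%N ->
    vge ord N%:Z (u m - u n).

(* A completion of F(theta) = {fraction {poly F}} at v: a complete valued field
   containing F(theta) as a dense subfield, whose (normalised) valuation extends
   the v-adic one.  It is unique up to a unique isomorphism. *)
Record completion (F : finFieldType) (v : place F) := Completion {
  cfield :> fieldType;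
  cinj : {rmorphism {fraction {poly F}} -> cfield};
  cord : cfield -> int;
  cordM : forall x y : cfield, x != 0 -> y != 0 -> cord (x * y) = cord x + cord y;
  cordD : forall (n : int) (x y : cfield),
    vge cord n x -> vge cord n y -> vge cord n (x + y);
  cord_vadic : forall (a : {poly F}) (n : nat), a != 0 ->
    (n%:Z <= cord (cinj (tofrac a))) = ((v : {poly F}) ^+ n %| a);
  cdense : forall (x : cfield) (N : nat),
    exists y : {fraction {poly F}}, vge cord N%:Z (x - cinj y);
  ccomplete : forall u : nat -> cfield, vcauchy cord u -> exists l, vcvg cord u l
}.

Section Completion.
Variables (F : finFieldType) (v : place F).
Variable (C : completion v).

Local Notation ord := (@cord F v C).
Local Notation vge := (vge ord).
Local Notation vcvg := (vcvg ord).

Definition ofA (a : {poly F}) : C := cinj C (tofrac a).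
Definition theta : C := ofA 'X.
Definition vK : C := ofA v.

Definition qd : nat := (#|F| ^ (size v).-1)%N.

Definition vlim (u : nat -> C) : C := xget 0 [set l | vcvg u l]%classic.

(* the Teichmueller lift epsilon of theta mod v *)
Definition teich : C := vlim (fun i => theta ^+ (qd ^ i)).

(* F_{q^d} consists of the roots of X^(q^d) - X in C. *)
Definition Fqd : {pred C} := [pred x : C | x ^+ qd == x].

Definition psum (a : int -> C) (M : nat) : C :=
  \sum_(i < M.*2) a (i%:Z - M%:Z).
Definition zsum (a : int -> C) : C := vlim (psum a).

Lemma vK_neq0 : vK != 0.
Proof. by rewrite /vK /ofA fmorph_eq0 tofrac_eq0; exact: monic_neq0 (place_monic v). Qed.

Lemma ord1 : ord 1 = 0.
Proof.
have := @cordM _ _ C 1 1 (oner_neq0 _) (oner_neq0 _); rewrite mulr1.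
by move/(congr1 (fun z => z - ord 1)); rewrite subrr addrK => <-.
Qed.

Lemma vge0 n : vge n 0.
Proof. by rewrite /Defs.vge eqxx. Qed.

Lemma vge_le m n x : n <= m -> vge m x -> vge n x.
Proof.
by move=> nm /orP[/eqP->|h]; rewrite ?vge0 // /Defs.vge (le_trans nm h) orbT.
Qed.

Lemma vgeM m n x y : vge m x -> vge n y -> vge (m + n) (x * y).
Proof.
have [->|x0] := eqVneq x 0; first by rewrite mul0r !vge0.
have [->|y0] := eqVneq y 0; first by rewrite mulr0 !vge0.
rewrite /Defs.vge (negPf x0) (negPf y0) /= cordM // => h1 h2.
by rewrite lerD ?orbT.
Qed.

Lemma vge1 : vge 0 1.
Proof. by rewrite /Defs.vge ord1 lexx orbT. Qed.

Lemma vgeN n x : vge n (- x) = vge n x.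
Proof.
have ordN1 : ord (-1) = 0.
  have N10 : (-1 : C) != 0 by rewrite oppr_eq0 oner_neq0.
  have := @cordM _ _ C (-1) (-1) N10 N10; rewrite mulrNN mulr1 ord1.
  by move=> h; lia.
have vN1 : vge 0 (-1) by rewrite /Defs.vge ordN1 lexx orbT.
have H y : vge n y -> vge n (- y).
  by move=> h; rewrite -mulN1r -[n]add0r; apply: vgeM.
by apply/idP/idP => /H; rewrite ?opprK.
Qed.

Lemma vgeD n x y : vge n x -> vge n y -> vge n (x + y).
Proof. exact: cordD. Qed.

Lemma vgeB n x y : vge n x -> vge n y -> vge n (x - y).
Proof. by move=> h1 h2; apply: vgeD; rewrite ?vgeN. Qed.

Lemma vge_subC n x y : vge n (x - y) -> vge n (y - x).
Proof. by rewrite -vgeN opprB. Qed.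

Lemma vge_subT n x y z : vge n (x - y) -> vge n (y - z) -> vge n (x - z).
Proof.
by move=> h1 h2; rewrite -[x](subrK y) -addrA; apply: vgeD.
Qed.

Lemma vgeX n m x : vge n x -> vge (n * m%:Z) (x ^+ m).
Proof.
move=> h; elim: m => [|m IH]; first by rewrite expr0 mulr0 vge1.
by rewrite exprS intS mulrDr mulr1; apply: vgeM.
Qed.

Lemma vge_sum (I : Type) (r : seq I) (P : pred I) (a : I -> C) n :
  (forall i, P i -> vge n (a i)) -> vge n (\sum_(i <- r | P i) a i).
Proof.
move=> h; elim/big_rec: _ => [|i x Pi hx]; first exact: vge0.
by apply: vgeD => //; apply: h.
Qed.

Lemma vge_eq0 x : (forall N : nat, vge N%:Z x) -> x = 0.
Proof.
move=> h; apply/eqP; case/orP: (h `|ord x|.+1%N) => // h'.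
by exfalso; lia.
Qed.

Lemma vge_eq x y : (forall N : nat, vge N%:Z (x - y)) -> x = y.
Proof. by move=> h; apply/eqP; rewrite -subr_eq0; apply/eqP/vge_eq0. Qed.

Lemma ord_vK : ord vK = 1.
Proof.
have v0 : (v : {poly F}) != 0 by exact: monic_neq0 (place_monic v).
have h1 := @cord_vadic _ _ C v 1 v0; have h2 := @cord_vadic _ _ C v 2 v0.
move: h1 h2; rewrite -/(ofA v) -/vK expr1 dvdpp expr2 => h1.
suff -> : (v : {poly F}) * v %| v = false by move=> h2; lia.
apply/negP => /dvdp_leq; rewrite v0 => /(_ isT).
rewrite size_mul //; case: (place_irr v) => h _ {h1}.
by move: h; case: (size (v : {poly F})) => [//|[//|n]] _; rewrite addnS /= => h; lia.
Qed.

Lemma vge_vK : vge 1 vK.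
Proof. by rewrite /Defs.vge ord_vK lexx orbT. Qed.

Lemma ord_vKX n : ord (vK ^+ n) = n%:Z.
Proof.
elim: n => [|n IH]; first by rewrite expr0 ord1.
by rewrite exprS cordM ?expf_neq0 ?vK_neq0 // IH ord_vK; lia.
Qed.

Lemma vge_div n k x : vge n (x / vK ^+ k) = vge (n + k%:Z) x.
Proof.
have vk0 : vK ^+ k != 0 by rewrite expf_neq0 ?vK_neq0.
have [->|x0] := eqVneq x 0; first by rewrite mul0r !vge0.
have y0 : x / vK ^+ k != 0 by rewrite mulf_neq0 ?invr_eq0.
have : ord (x / vK ^+ k) + k%:Z = ord x.
  by have := cordM y0 vk0; rewrite divfK // ord_vKX.
by rewrite /Defs.vge (negPf x0) (negPf y0) /= => h; apply/idP/idP; lia.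
Qed.

Lemma vcvg_unique u l l' : vcvg u l -> vcvg u l' -> l = l'.
Proof.
move=> h h'; apply: vge_eq => N.
have [n0 h0] := h N; have [n1 h1] := h' N.
have := h0 (n0 + n1)%N (leq_addr _ _); have := h1 (n0 + n1)%N (leq_addl _ _).
by move=> a b; apply: vge_subT (vge_subC b) a.
Qed.

Lemma vlimP u l : vcvg u l -> vlim u = l.
Proof. by move=> h; apply: xget_unique => // y h'; apply: vcvg_unique h' h. Qed.

Lemma vlim_cvg u : vcauchy ord u -> vcvg u (vlim u).
Proof. by move/ccomplete => [l h]; rewrite (vlimP h). Qed.

Lemma vcvg_ge u l n : vcvg u l -> (exists n0, forall m, (n0 <= m)%N -> vge n (u m)) ->
  vge n l.
Proof.
move=> h [n0 h0]; have [n1 h1] := h `|n|%N.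
have -> : l = u (n0 + n1)%N - (u (n0 + n1)%N - l) by ring.
apply: vgeB; first by apply: h0; lia.
by apply: vge_le (h1 _ _); lia.
Qed.

Lemma vcvgD u w l l' : vcvg u l -> vcvg w l' -> vcvg (fun n => u n + w n) (l + l').
Proof.
move=> h h' N; have [n0 h0] := h N; have [n1 h1] := h' N.
exists (n0 + n1)%N => n hn; rewrite opprD addrACA.
by apply: vgeD; [apply: h0|apply: h1]; lia.
Qed.

Definition summable (a : int -> C) := forall N : nat, exists M : nat,
  forall i : int, (M <= `|i|)%N -> vge N%:Z (a i).

Lemma psumS a M : psum a M.+1 = a (- M.+1%:Z) + psum a M + a M%:Z.
Proof.
rewrite /psum doubleS big_ord_recr big_ord_recl /=; congr (a _ + _ + a _).
- by lia.
- by apply: eq_bigr => i _; congr a; rewrite /bump /=; lia.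
- by lia.
Qed.

Lemma psum_tail a (N : int) M k :
  (forall i : int, (M <= `|i|)%N -> vge N (a i)) -> vge N (psum a (M + k) - psum a M).
Proof.
move=> h; elim: k => [|k IH]; first by rewrite addn0 subrr vge0.
rewrite addnS psumS.
have -> : a (- (M + k).+1%:Z) + psum a (M + k) + a (M + k)%N%:Z - psum a M =
  a (- (M + k).+1%:Z) + a (M + k)%N%:Z + (psum a (M + k) - psum a M) by ring.
by apply: vgeD => //; apply: vgeD; apply: h; lia.
Qed.

Lemma zsum_cvg a : summable a -> vcvg (psum a) (zsum a).
Proof.
move=> h; apply: vlim_cvg => N; have [M hM] := h N; exists M => m n hm hn.
apply: vge_subT (_ : vge _ (psum a M - _)).
  by rewrite -(subnKC hm); apply: psum_tail.
by apply: vge_subC; rewrite -(subnKC hn); apply: psum_tail.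
Qed.

Lemma zsum_approx a (N : int) M : summable a ->
  (forall i : int, (M <= `|i|)%N -> vge N (a i)) -> vge N (zsum a - psum a M).
Proof.
move=> sa h; have [n0 h0] := zsum_cvg sa `|N|%N.
apply: vge_subT (_ : vge _ (psum a (M + n0) - _)); last exact: psum_tail.
by apply: vge_subC; apply: vge_le (h0 _ _); lia.
Qed.

Lemma zsum_window a (N : int) (lo : int) (len : nat) : summable a ->
  (forall i : int, (i < lo) || (lo + len%:Z <= i) -> vge N (a i)) ->
  vge N (zsum a - \sum_(i < len) a (lo + i%:Z)).
Proof.
move=> sa h; pose M := (`|lo| + len)%N.
apply: vge_subT (zsum_approx (M := M) sa _) _.
  by move=> i hi; apply: h; lia.
rewrite /psum -[X in X - _](big_mkord xpredT (fun i : nat => a (i%:Z - M%:Z))).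
pose k := absz (lo + M%:Z).
have hk : k%:Z = lo + M%:Z by lia.
have kM : (k + len <= M.*2)%N by lia.
rewrite (big_cat_nat (n := k)) /=; [|by lia|by lia].
rewrite [X in _ + X - _](big_cat_nat (n := k + len)%N) /=; [|by lia|by lia].
have -> : \sum_(k <= i < k + len) a (i%:Z - M%:Z) = \sum_(i < len) a (lo + i%:Z).
  rewrite -{1}[k]add0n big_addn addKn big_mkord.
  by apply: eq_bigr => i _; congr a; lia.
set x := \sum_(0 <= i < k) _; set y := \sum_(_ <= i < M.*2) _; set z := \sum_(i < _) _.
have -> : x + (z + y) - z = x + y by ring.
by apply: vgeD; rewrite /x /y big_seq; apply: vge_sum => i;
   rewrite mem_index_iota => hi; apply: h; lia.
Qed.

End Completion.

Arguments Fqd {F v} C.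

(* A_v[[T_v, T_v^-1}}: [f i] is the coefficient b_i of T_v^i.  The last field is the
   condition b_i v^(n i) -> 0 as i -> -oo. *)
Record annser (F : finFieldType) (v : place F) (C : completion v) := Annser {
  acoef :> int -> C;
  acoef_int : forall i, vge (@cord F v C) 0 (acoef i);
  acoef_decay : forall n : nat, (0 < n)%N ->
    vcvg (@cord F v C) (fun m : nat => acoef (- m%:Z) / vK C ^+ (n * m)) 0
}.

HB.instance Definition _ (F : finFieldType) (v : place F) (C : completion v) :=
  gen_eqMixin (annser C).
HB.instance Definition _ (F : finFieldType) (v : place F) (C : completion v) :=
  gen_choiceMixin (annser C).

Section Annser.
Variables (F : finFieldType) (v : place F) (C : completion v).
Local Notation vge := (vge (@cord F v C)).
Local Notation vcvg := (vcvg (@cord F v C)).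
Implicit Types f g h : annser C.

Lemma annserP f g : (forall i, f i = g i) -> f = g.
Proof.
case: f g => [f fi fd] [g gi gd] /= fg.
have {}fg : f = g by apply/funext.
by subst g; congr Annser; apply: Prop_irrelevance.
Qed.

Definition superlin (f : int -> C) := forall n : nat, exists m0 : nat,
  forall m : nat, (m0 <= m)%N -> vge (n * m)%N%:Z (f (- m%:Z)).

Lemma decayP (f : int -> C) : superlin f <-> forall n : nat, (0 < n)%N ->
  vcvg (fun m : nat => f (- m%:Z) / vK C ^+ (n * m)) 0.
Proof.
split=> [h n n0 N|h n].
  have [m0 hm] := h (n + 1)%N; exists (m0 + N)%N => m hmm.
  rewrite subr0 vge_div; apply: vge_le (hm m _); last by lia.
  by rewrite mulnDl; lia.
have [m0 hm] := h n.+1 isT 0%N; exists m0 => m /hm.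
by rewrite subr0 vge_div; apply: vge_le; lia.
Qed.

Lemma a_super f : superlin f. Proof. by apply/decayP/acoef_decay. Qed.

Lemma a_tail f (N : nat) : exists a0 : nat, forall i : int, i <= - a0%:Z -> vge N%:Z (f i).
Proof.
have [m0 hm] := a_super f 1; exists (m0 + N)%N => i hi.
have -> : i = - (absz i)%:Z by lia.
by apply: vge_le (hm _ _); lia.
Qed.

Lemma super_cst0 (f : int -> C) (n0 : nat) : (forall i : int, i < - n0%:Z -> f i = 0) -> superlin f.
Proof.
by move=> h n; exists n0.+1 => m hm; rewrite h ?vge0 //; lia.
Qed.

(* The constant series a, for a in A_v; other values of a are never used. *)
Definition acst_fun (a : C) (i : int) : C := if (i == 0) && vge 0 a then a else 0.
Fact acst_int a i : vge 0 (acst_fun a i).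
Proof. by rewrite /acst_fun; case: ifP => [/andP[]//|_]; rewrite vge0. Qed.
Fact acst_super a : superlin (acst_fun a).
Proof. by apply: (@super_cst0 _ 0%N) => i hi; rewrite /acst_fun lt_eqF. Qed.
Definition acst (a : C) : annser C := Annser (acst_int a) ((decayP _).1 (acst_super a)).

Definition amon_fun (k i : int) : C := (i == k)%:R.
Fact amon_int k i : vge 0 (amon_fun k i).
Proof. by rewrite /amon_fun; case: eqP => _; rewrite ?vge1 ?vge0. Qed.
Fact amon_super k : superlin (amon_fun k).
Proof.
apply: (@super_cst0 _ (absz k)) => i hi.
by rewrite /amon_fun; have -> : (i == k) = false by lia.
Qed.
Definition amon (k : int) : annser C := Annser (amon_int k) ((decayP _).1 (amon_super k)).

Fact azero_int (i : int) : vge 0 (0 : C). Proof. exact: vge0. Qed.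
Fact azero_super : superlin (fun _ => 0).
Proof. by apply: (@super_cst0 _ 0%N). Qed.
Definition azero : annser C := Annser azero_int ((decayP _).1 azero_super).

Fact aadd_int f g i : vge 0 (f i + g i).
Proof. by apply: vgeD; apply: acoef_int. Qed.
Fact aadd_super f g : superlin (fun i => f i + g i).
Proof.
move=> n; have [m0 h0] := a_super f n; have [m1 h1] := a_super g n.
by exists (m0 + m1)%N => m hm; apply: vgeD; [apply: h0|apply: h1]; lia.
Qed.
Definition aadd f g : annser C := Annser (aadd_int f g) ((decayP _).1 (aadd_super f g)).

Fact aopp_int f i : vge 0 (- f i).
Proof. by rewrite vgeN; apply: acoef_int. Qed.
Fact aopp_super f : superlin (fun i => - f i).
Proof.
by move=> n; have [m0 h0] := a_super f n; exists m0 => m hm; rewrite vgeN h0.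
Qed.
Definition aopp f : annser C := Annser (aopp_int f) ((decayP _).1 (aopp_super f)).

Definition aconv f g (n : int) : C := zsum (fun i => f i * g (n - i)).

Lemma aconv_summable f g n : summable (fun i => f i * g (n - i)).
Proof.
move=> N; have [a ha] := a_tail f N; have [b hb] := a_tail g N.
exists (a + b + absz n)%N => i hi.
have [i0|i0] := leP i 0.
  by rewrite -[N%:Z]addr0; apply: vgeM (acoef_int _ _); apply: ha; lia.
by rewrite -[N%:Z]add0r; apply: vgeM (acoef_int _ _) _; apply: hb; lia.
Qed.

Lemma zsum_ge (a : int -> C) N : summable a -> (forall i, vge N (a i)) -> vge N (zsum a).
Proof.
move=> sa h; apply: vcvg_ge (zsum_cvg sa) _; exists 0%N => m _.
by apply: vge_sum.
Qed.

Fact amul_int f g i : vge 0 (aconv f g i).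
Proof.
apply: zsum_ge => [|j]; first exact: aconv_summable.
by rewrite -[0]addr0; apply: vgeM; apply: acoef_int.
Qed.
Fact amul_super f g : superlin (aconv f g).
Proof.
move=> n; have [m0 h0] := a_super f (2 * n)%N; have [m1 h1] := a_super g (2 * n)%N.
exists (2 * (m0 + m1))%N => m hm; apply: zsum_ge => [|i]; first exact: aconv_summable.
have [hi|hi] := leP (i *+ 2) (- m%:Z).
  rewrite -[_%:Z]addr0; apply: vgeM (acoef_int _ _).
  have -> : i = - (absz i)%:Z by lia.
  apply: vge_le (h0 _ _); last by lia.
  by rewrite lez_nat -mulnA mulnCA leq_mul2l; apply/orP; right; lia.
rewrite -[_%:Z]add0r; apply: vgeM (acoef_int _ _) _.
set j := - m%:Z - i.
have -> : j = - (absz j)%:Z by lia.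
apply: vge_le (h1 _ _); last by lia.
by rewrite lez_nat -mulnA mulnCA leq_mul2l; apply/orP; right; lia.
Qed.
Definition amul f g : annser C := Annser (amul_int f g) ((decayP _).1 (amul_super f g)).

(* P approximates f modulo m_v^N, up to the shift T_v^a and in degrees <= B *)
Definition appr (N B a : nat) f (P : {poly C}) :=
  [/\ forall i : int, i < - a%:Z -> vge N%:Z (f i),
      forall j, vge 0 P`_j &
      forall j : nat, (j <= B)%N -> vge N%:Z (f (j%:Z - a%:Z) - P`_j)].

Lemma appr_eq f g : (forall N, exists a, forall B, exists P,
  appr N B a f P /\ appr N B a g P) -> f = g.
Proof.
move=> h; apply: annserP => i; apply: vge_eq => N.
have [a ha] := h N; have [P [[f0 _ f1] [g0 _ g1]]] := ha (absz i + a)%N.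
have [hi|hi] := ltP i (- a%:Z).
  by apply: vgeB; [apply: f0|apply: g0].
have -> : i = (absz (i + a%:Z))%:Z - a%:Z by lia.
apply: vge_subT (f1 _ _) (vge_subC (g1 _ _)); lia.
Qed.

Lemma appr_add N B a f g P Q : appr N B a f P -> appr N B a g Q ->
  appr N B a (aadd f g) (P + Q).
Proof.
move=> [f0 p0 f1] [g0 q0 g1]; split=> [i hi|j|j hj] /=.
- by apply: vgeD; [apply: f0|apply: g0].
- by rewrite coefD; apply: vgeD.
- by rewrite coefD opprD addrACA; apply: vgeD; [apply: f1|apply: g1].
Qed.

Lemma appr_mul N B a b f g P Q : appr N B a f P -> appr N B b g Q ->
  appr N B (a + b) (amul f g) (P * Q).
Proof.
move=> [f0 p0 f1] [g0 q0 g1]; split=> [i hi|j|j hj] /=.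
- apply: zsum_ge => [|k]; first exact: aconv_summable.
  have [hk|hk] := ltP k (- a%:Z).
    by rewrite -[N%:Z]addr0; apply: vgeM (acoef_int _ _); apply: f0.
  by rewrite -[N%:Z]add0r; apply: vgeM (acoef_int _ _) _; apply: g0; lia.
- rewrite coefM; apply: vge_sum => i _; rewrite -[0]addr0; exact: vgeM.
- rewrite /aconv; set m := j%:Z - _.
  apply: vge_subT (zsum_window (lo := - a%:Z) (len := j.+1) (aconv_summable f g m) _) _.
    move=> i /orP[hi|hi].
      by rewrite -[N%:Z]addr0; apply: vgeM (acoef_int _ _); apply: f0.
    by rewrite -[N%:Z]add0r; apply: vgeM (acoef_int _ _) _; apply: g0; lia.
  rewrite coefM -sumrB; apply: vge_sum => i _.
  have -> : - a%:Z + i%:Z = i%:Z - a%:Z by ring.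
  have -> : m - (i%:Z - a%:Z) = (j - i)%N%:Z - b%:Z by have := ltn_ord i; lia.
  set x := f _; set y := g _.
  have -> : x * y - P`_i * Q`_(j - i) = (x - P`_i) * y + P`_i * (y - Q`_(j - i)) by ring.
  have hi := ltn_ord i.
  apply: vgeD; first by rewrite -[N%:Z]addr0; apply: vgeM (acoef_int _ _); apply: f1; lia.
  by rewrite -[N%:Z]add0r; apply: vgeM => //; apply: g1; lia.
Qed.

Lemma appr_ex1 N f : exists a0 : nat, forall a, (a0 <= a)%N ->
  forall B, exists P, appr N B a f P.
Proof.
have [a0 h] := a_tail f N; exists a0 => a ha B.
exists (\poly_(j < B.+1) f (j%:Z - a%:Z)); split=> [i hi|j|j hj].
- by apply: h; lia.
- by rewrite coef_poly; case: ifP => _; rewrite ?vge0 ?acoef_int.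
- by rewrite coef_poly ltnS hj subrr vge0.
Qed.

Lemma appr_ex3 N f g h : exists a, forall B, exists P Q S,
  [/\ appr N B a f P, appr N B a g Q & appr N B a h S].
Proof.
have [a1 h1] := appr_ex1 N f; have [a2 h2] := appr_ex1 N g; have [a3 h3] := appr_ex1 N h.
exists (a1 + a2 + a3)%N => B.
have [P hP] := h1 (a1 + a2 + a3)%N ltac:(lia) B.
have [Q hQ] := h2 (a1 + a2 + a3)%N ltac:(lia) B.
have [S hS] := h3 (a1 + a2 + a3)%N ltac:(lia) B.
by exists P, Q, S.
Qed.

Fact aaddA : associative aadd.
Proof. by move=> f g h; apply: annserP => i /=; rewrite addrA. Qed.
Fact aaddC : commutative aadd.
Proof. by move=> f g; apply: annserP => i /=; rewrite addrC. Qed.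
Fact aadd0 : left_id azero aadd.
Proof. by move=> f; apply: annserP => i /=; rewrite add0r. Qed.
Fact aaddN : left_inverse azero aopp aadd.
Proof. by move=> f; apply: annserP => i /=; rewrite addNr. Qed.

Fact amulA : associative amul.
Proof.
move=> f g h; apply: appr_eq => N; have [a ha] := appr_ex3 N f g h.
exists (a + a + a)%N => B; have [P [Q [S [hP hQ hS]]]] := ha B.
exists (P * Q * S); split; last by do 2?apply: appr_mul.
by rewrite -mulrA -addnA; do 2?apply: appr_mul.
Qed.
Fact amulC : commutative amul.
Proof.
move=> f g; apply: appr_eq => N; have [a ha] := appr_ex3 N f g g.
exists (a + a)%N => B; have [P [Q [_ [hP hQ _]]]] := ha B.
by exists (P * Q); split; [|rewrite mulrC]; apply: appr_mul.
Qed.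
Fact amulDl : left_distributive amul aadd.
Proof.
move=> f g h; apply: appr_eq => N; have [a ha] := appr_ex3 N f g h.
exists (a + a)%N => B; have [P [Q [S [hP hQ hS]]]] := ha B.
exists ((P + Q) * S); split; first by apply: appr_mul => //; apply: appr_add.
by rewrite mulrDl; apply: appr_add; apply: appr_mul.
Qed.

Lemma amonE k f i : amul (amon k) f i = f (i - k).
Proof.
rewrite /= /aconv; apply: vge_eq => N.
have := @zsum_window _ _ C _ N%:Z k 1 (aconv_summable (amon k) f i).
rewrite big_ord_recl big_ord0 /= /amon_fun !addr0 eqxx mul1r; apply=> j hj.
have -> : (j == k) = false by lia.
by rewrite mul0r vge0.
Qed.

Fact amul1 : left_id (amon 0) amul.
Proof. by move=> f; apply: annserP => i; rewrite amonE subr0. Qed.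
Fact aone_neq0 : amon 0 != azero.
Proof.
apply/eqP => /(congr1 (fun f : annser C => f 0)) /= /eqP.
by rewrite /amon_fun eqxx oner_eq0.
Qed.

HB.instance Definition _ := GRing.isZmodule.Build (annser C) aaddA aaddC aadd0 aaddN.
HB.instance Definition _ :=
  GRing.Zmodule_isComNzRing.Build (annser C) amulA amulC amul1 amulDl aone_neq0.

Lemma acoefD f g i : (f + g) i = f i + g i. Proof. by []. Qed.
Lemma acoefN f i : (- f) i = - f i. Proof. by []. Qed.
Lemma acoef0 i : (0 : annser C) i = 0. Proof. by []. Qed.
Lemma acoefM f g i : (f * g) i = zsum (fun j => f j * g (i - j)). Proof. by []. Qed.
Lemma acoef_monM k f i : (amon k * f) i = f (i - k). Proof. exact: amonE. Qed.

Lemma acoef_cstM c f i : vge 0 c -> (acst c * f) i = c * f i.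
Proof.
move=> hc; rewrite acoefM; apply: vge_eq => N.
have := @zsum_window _ _ C _ N%:Z 0 1 (aconv_summable (acst c) f i).
rewrite big_ord_recl big_ord0 /= /acst_fun eqxx hc addr0 /=.
have -> : i - (0 + 0%Z) = i by lia.
apply=> j hj; have -> : (j == 0) = false by lia.
by rewrite mul0r vge0.
Qed.

Lemma vge_ex (x : C) : x != 0 -> vge (cord x) x && ~~ vge (cord x + 1) x.
Proof.
by move=> x0; rewrite /Defs.vge (negPf x0) lexx /= -ltNge ltzD1.
Qed.

Lemma gauss f : f != 0 -> exists (a : nat) (i0 : int),
  [/\ forall i, vge a%:Z (f i), ~~ vge a.+1%:Z (f i0) &
      forall i, i < i0 -> vge a.+1%:Z (f i)].
Proof.
move=> f0.
have [i fi] : exists i, f i != 0.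
  apply: contrapT => /forallNP h; move/eqP: f0; apply; apply: annserP => i.
  by have := h i; move/negP; rewrite negbK => /eqP.
have ex1 : exists a : nat, `[< exists i, ~~ vge a.+1%:Z (f i) >].
  have /andP[h1 h2] := vge_ex fi.
  exists (absz (cord (f i))); apply/asboolP; exists i; apply: contra h2.
  by apply: vge_le; lia.
case: (ex_minnP ex1) => a /asboolP[j hj] hmin.
have ha k : vge a%:Z (f k).
  case: a hj hmin => [|a] _ hmin; first exact: acoef_int.
  apply/negP => /negP h.
  have : (a.+1 <= a)%N by apply: hmin; apply/asboolP; exists k.
  by rewrite ltnn.
have [m hm] := a_tail f a.+1.
have ex2 : exists n : nat, ~~ vge a.+1%:Z (f (n%:Z - m%:Z)).
  exists (absz (j + m%:Z)); have [h|h] := leP j (- m%:Z).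
    by rewrite hm in hj.
  by have -> : (absz (j + m%:Z))%:Z - m%:Z = j by lia.
case: (ex_minnP ex2) => n hn nmin.
exists a, (n%:Z - m%:Z); split=> // k hk.
have [h|h] := leP k (- m%:Z); first exact: hm.
apply/negP => /negP hk'.
have : (n <= absz (k + m%:Z)%R)%N.
  by apply: nmin; have -> : (absz (k + m%:Z))%:Z - m%:Z = k by lia.
by lia.
Qed.

Lemma vge_mulN (a b : nat) (x y : C) : ~~ vge a.+1%:Z x -> ~~ vge b.+1%:Z y ->
  ~~ vge (a + b).+1%:Z (x * y).
Proof.
rewrite /Defs.vge !negb_or -!ltNge => /andP[x0 hx] /andP[y0 hy].
by rewrite mulf_neq0 // cordM //=; lia.
Qed.

Fact amul_eq0 f g : f * g = 0 -> (f == 0) || (g == 0).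
Proof.
move=> fg; apply/negPn/negP; rewrite negb_or => /andP[/gauss[a [i0 [a1 a2 a3]]]].
move=> /gauss[b [j0 [b1 b2 b3]]].
have := vge_mulN a2 b2; move/negP; apply.
have /(congr1 (fun h : annser C => h (i0 + j0))) := fg; rewrite acoefM acoef0 => s0.
have /= := @zsum_window _ _ C _ (a + b).+1%:Z i0 1 (aconv_summable f g (i0 + j0)).
rewrite big_ord_recl big_ord0 /= !addr0 s0 sub0r vgeN.
have -> : i0 + j0 - i0 = j0 by ring.
apply=> i hi; have [h|h] := ltP i i0.
  have -> : (a + b).+1%:Z = a.+1%:Z + b%:Z by lia.
  by apply: vgeM => //; apply: a3.
have -> : (a + b).+1%:Z = a%:Z + b.+1%:Z by lia.
by apply: vgeM => //; apply: b3; lia.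
Qed.

Definition aunit : {pred annser C} := [pred f | `[< exists g, g * f = 1 >]].
Definition ainv f : annser C := xget f [set g | g * f = 1]%classic.

Fact amulV : {in aunit, left_inverse 1 ainv *%R}.
Proof. by move=> f /asboolP h; rewrite /ainv; case: xgetP => [g _ //|/forallNP]. Qed.
Fact aunitP f g : g * f = 1 -> f \in aunit.
Proof. by move=> h; apply/asboolP; exists g. Qed.
Fact ainv_out : {in [predC aunit], ainv =1 id}.
Proof. by move=> f /asboolP h; rewrite /ainv xgetPN // => g; apply: contra_not h; exists g. Qed.

HB.instance Definition _ := GRing.ComNzRing_hasMulInverse.Build (annser C) amulV aunitP ainv_out.
HB.instance Definition _ := GRing.ComUnitRing_isIntegral.Build (annser C) amul_eq0.

End Annser.

Section Twist.
Variables (F : finFieldType) (v : place F) (C : completion v).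
Local Notation vge := (vge (@cord F v C)).
Local Notation vcvg := (vcvg (@cord F v C)).
Local Notation S := (annser C).
Local Notation qd := (qd v).
Implicit Types f g h : S.

Lemma v_size : (1 < size (v : {poly F}))%N.
Proof. by case: (place_irr v). Qed.

Lemma qd_gt1 : (1 < qd)%N.
Proof.
rewrite /Defs.qd; have := v_size; case: (size _) => [//|[//|n]] _ /=.
rewrite -(exp1n n.+1) ltn_exp2r //; exact: finNzRing_gt1.
Qed.

Lemma frobD (x y : C) : (x + y) ^+ qd = x ^+ qd + y ^+ qd.
Proof.
have [p p_pr pF] := finPcharP F.
have pC : p \in [pchar C].
  by rewrite (fmorph_pchar (cinj C \o @FracField.tofrac _ \o polyC)).
apply: exprDn_pchar; rewrite (eq_pnat _ (pcharf_eq pC)) /Defs.qd.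
have /= -> := card_pprimeChar pF.
by rewrite !pnatX pnat_id.
Qed.

Definition frob (x : C) : C := x ^+ qd.
Fact frob_zmod : zmod_morphism frob.
Proof.
move=> x y; rewrite /frob; apply/eqP; rewrite eq_sym subr_eq -frobD subrK //.
Qed.
Fact frob_monoid : monoid_morphism frob.
Proof. by split=> [|x y]; rewrite /frob ?expr1n ?exprMn. Qed.
HB.instance Definition _ := GRing.isZmodMorphism.Build _ _ frob frob_zmod.
HB.instance Definition _ := GRing.isMonoidMorphism.Build _ _ frob frob_monoid.

Lemma vge_frob (N : nat) x : vge N%:Z x -> vge N%:Z (frob x).
Proof.
move=> h; apply: vge_le (vgeX qd h).
by rewrite -PoszM lez_nat leq_pmulr // ltnW ?qd_gt1.
Qed.

Fact tw_int f i : vge 0 (frob (f i)).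
Proof. exact/vge_frob/acoef_int. Qed.
Fact tw_super f : superlin (fun i => frob (f i)).
Proof.
by move=> n; have [m0 h0] := a_super f n; exists m0 => m hm; apply/vge_frob/h0.
Qed.
(* The d-fold twist f^(d) raises coefficients to the power q^d. *)
Definition atwist f : S := Annser (tw_int f) ((decayP _).1 (tw_super f)).

Lemma appr_tw N B a f P : appr N B a f P -> appr N B a (atwist f) (map_poly frob P).
Proof.
move=> [f0 p0 f1]; split=> [i hi|j|j hj] /=.
- exact/vge_frob/f0.
- by rewrite coef_map; apply/vge_frob.
- by rewrite coef_map -rmorphB; apply/vge_frob/f1.
Qed.

Fact tw_zmod : zmod_morphism atwist.
Proof. by move=> f g; apply: annserP => i; rewrite /= rmorphB. Qed.
Fact tw_monoid : monoid_morphism atwist.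
Proof.
split=> [|f g].
  by apply: annserP => i; rewrite /= /amon_fun; case: eqP => _; rewrite ?rmorph0 ?rmorph1.
apply: appr_eq => N; have [a ha] := appr_ex3 N f g g.
exists (a + a)%N => B; have [P [Q [_ [hP hQ _]]]] := ha B.
exists (map_poly frob (P * Q)); split; first exact/appr_tw/appr_mul.
by rewrite rmorphM; apply: appr_mul; apply: appr_tw.
Qed.
HB.instance Definition _ := GRing.isZmodMorphism.Build _ _ atwist tw_zmod.
HB.instance Definition _ := GRing.isMonoidMorphism.Build _ _ atwist tw_monoid.

Lemma atwist_eq0 f : (atwist f == 0) = (f == 0).
Proof.
apply/eqP/eqP => [|->]; last exact: rmorph0.
move=> h; apply: annserP => i; have := congr1 (fun g : S => g i) h.
by move=> /= /eqP; rewrite fmorph_eq0 => /eqP.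
Qed.

(* prod_(i < N) (1 - v^(q^(d i)) / T_v) *)
Definition varpi_part (N : nat) : S :=
  \prod_(i < N) (1 - acst (vK C ^+ (qd ^ i)) * amon C (-1)).

Definition varpi : S :=
  xget 1 [set s : S | forall j : int, vcvg (fun N => varpi_part N j) (s j)]%classic.

Lemma vK_int n : vge 0 (vK C ^+ n).
Proof. by rewrite -[0](mul0r n%:Z); apply: vgeX; apply: vge_le (vge_vK C). Qed.

Lemma acst_tw c : vge 0 c -> atwist (acst c) = acst (frob c).
Proof.
move=> hc; apply: annserP => i /=.
by rewrite /acst_fun hc (@vge_frob 0) //; case: eqP => _ //; rewrite rmorph0.
Qed.

Lemma linE c f i : vge 0 c -> ((1 - acst c * amon C (-1)) * f) i = f i - c * f (i + 1).
Proof.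
move=> hc; rewrite mulrBl mul1r -mulrA acoefD acoefN acoef_cstM // acoef_monM.
by rewrite opprK.
Qed.

Lemma varpi_partS N :
  varpi_part N.+1 = (1 - acst (vK C) * amon C (-1)) * atwist (varpi_part N).
Proof.
rewrite /varpi_part big_ord_recl expn0 expr1 rmorph_prod; congr (_ * _).
apply: eq_bigr => i _; rewrite rmorphB rmorph1 rmorphM /= acst_tw ?vK_int //.
rewrite /frob -exprM -expnSr; congr (1 - _ * _).
apply: annserP => j /=; rewrite /amon_fun.
by case: eqP => _; rewrite ?rmorph0 ?rmorph1.
Qed.

Definition hsum (m : nat) : nat := \sum_(i < m) qd ^ i.

Lemma hsumS m : hsum m.+1 = (1 + qd * hsum m)%N.
Proof.
rewrite /hsum big_ord_recl expn0 big_distrr; congr (_ + _)%N.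
by apply: eq_bigr => i _; rewrite expnS.
Qed.

Lemma varpi_partE N : [/\ forall m : nat, varpi_part N m.+1%:Z = 0,
  varpi_part N 0 = 1 & forall m : nat, vge (hsum m)%:Z (varpi_part N (- m%:Z))].
Proof.
have vK1 := vK_int 1; rewrite expr1 in vK1.
elim: N => [|N [IH1 IH2 IH3]].
  rewrite /varpi_part big_ord0; split=> [m||m].
  - by rewrite /= /amon_fun.
  - by rewrite /= /amon_fun eqxx.
  - by case: m => [|m]; rewrite /= /amon_fun ?vge0 // /hsum big_ord0 vge1.
rewrite varpi_partS; split=> [m||[|m]]; rewrite linE //.
- have -> : m.+1%:Z + 1 = m.+2%:Z by lia.
  by rewrite /= !IH1 rmorph0 mulr0 subr0.
- have -> : 0 + 1 = 1%N%:Z :> int by [].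
  by rewrite /= IH1 IH2 rmorph0 rmorph1 mulr0 subr0.
- have -> : - 0%N%:Z = 0 :> int by [].
  have -> : 0 + 1 = 1%N%:Z :> int by [].
  by rewrite /= IH1 IH2 rmorph0 rmorph1 mulr0 subr0 /hsum big_ord0 vge1.
- have -> : - m.+1%:Z + 1 = - m%:Z by lia.
  apply: vgeB; first exact: vge_frob.
  rewrite hsumS PoszD; apply: vgeM; first exact: vge_vK.
  by have := vgeX qd (IH3 m); rewrite -PoszM mulnC.
Qed.

Lemma varpi_ex : exists s : S, forall j : int, vcvg (fun N => varpi_part N j) (s j).
Proof.
have cau j : vcauchy (@cord F v C) (fun N => varpi_part N j).
  move=> N; exists N => m n hm hn.
  have H k : vge N%:Z (varpi_part (N + k) j - varpi_part N j).
    elim: k => [|k IH]; first by rewrite addn0 subrr vge0.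
    rewrite addnS.
    have -> : varpi_part (N + k).+1 =
        (1 - acst (vK C ^+ (qd ^ (N + k))) * amon C (-1)) * varpi_part (N + k).
      by rewrite mulrC /varpi_part big_ord_recr.
    rewrite linE ?vK_int // addrAC; apply: vgeB => //.
    rewrite -[N%:Z]addr0; apply: vgeM (acoef_int _ _).
    have h := vgeX (qd ^ (N + k)) (vge_vK C).
    apply: vge_le h; rewrite mul1r lez_nat.
    have := ltn_expl (N + k) qd_gt1; lia.
  apply: vge_subT (_ : vge _ (varpi_part N j - _)).
    by rewrite -(subnKC hm); apply: H.
  by apply: vge_subC; rewrite -(subnKC hn); apply: H.
pose s j := vlim (fun N => varpi_part N j).
have hs j : vcvg (fun N => varpi_part N j) (s j) by apply: vlim_cvg; apply: cau.
have s_int j : vge 0 (s j).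
  by apply: vcvg_ge (hs j) _; exists 0%N => m _; apply: acoef_int.
have s_sup : superlin s.
  move=> n; exists (n.*2.+2)%N => m hm; apply: vcvg_ge (hs _) _; exists 0%N => N _.
  have [_ _ h] := varpi_partE N; apply: vge_le (h m); rewrite lez_nat.
  apply: (@leq_trans 'C(m, 2)).
    rewrite bin2 -[X in (X <= _)%N]doubleK; apply: half_leq.
    by rewrite -muln2 mulnAC [leqLHS]mulnC leq_mul2l; apply/orP; right; lia.
  rewrite -bin2_sum /hsum big_mkord; apply: leq_sum => i _.
  by apply: ltnW; apply: ltn_expl; apply: qd_gt1.
by exists (Annser s_int ((decayP _).1 s_sup)).
Qed.

Lemma varpi_cvg j : vcvg (fun N => varpi_part N j) (varpi j).
Proof.
by move: j; exact: (@xgetPex _ 1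
  [set s : S | forall j, vcvg (fun N => varpi_part N j) (s j)]%classic varpi_ex).
Qed.

Lemma varpi_neq0 : varpi != 0.
Proof.
apply/eqP => h; have := varpi_cvg 0; rewrite h => h1.
have h2 : vcvg (fun N => varpi_part N 0) 1.
  by move=> N; exists 0%N => n _; have [_ -> _] := varpi_partE n; rewrite subrr vge0.
by have /eqP := vcvg_unique h2 h1; rewrite oner_eq0.
Qed.

Lemma varpi_twist : varpi = (1 - acst (vK C) * amon C (-1)) * atwist varpi.
Proof.
have vK1 := vK_int 1; rewrite expr1 in vK1.
apply: annserP => j; rewrite linE //.
apply: (@vcvg_unique _ _ _ (fun N => varpi_part N.+1 j)).
  by move=> N; have [n0 h] := varpi_cvg j N; exists n0 => n hn; apply: h; lia.
move=> N; have [n0 h0] := varpi_cvg j N; have [n1 h1] := varpi_cvg (j + 1) N.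
exists (n0 + n1)%N => n hn; rewrite varpi_partS linE //=.
set a := varpi_part n _; set b := varpi_part n _; set a' := varpi _; set b' := varpi _.
have -> : frob a - vK C * frob b - (frob a' - vK C * frob b') =
  frob (a - a') - vK C * frob (b - b') by rewrite !rmorphB; ring.
apply: vgeB; first by apply/vge_frob/h0; lia.
by rewrite -[N%:Z]add0r; apply: vgeM => //; apply/vge_frob/h1; lia.
Qed.

(* B = A_v[[T_v, T_v^-1}}[1/varpi] is taken inside the fraction field of
   A_v[[T_v, T_v^-1}}, which is a domain. *)
Definition inB : {pred {fraction S}} :=
  [pred x | `[< exists n (g : S), x * tofrac varpi ^+ n = tofrac g >]].

Fact inB_subring : subring_closed inB.
Proof.
split=> [|x y /asboolP[n [g hg]] /asboolP[m [h hh]]|x y /asboolP[n [g hg]] /asboolP[m [h hh]]].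
- by apply/asboolP; exists 0%N, 1; rewrite expr0 mulr1 rmorph1.
- apply/asboolP; exists (n + m)%N, (g * varpi ^+ m - h * varpi ^+ n).
  by rewrite rmorphB !rmorphM !rmorphXn /= -hg -hh exprD mulrBl !mulrA [y * _ * _]mulrAC.
- apply/asboolP; exists (n + m)%N, (g * h).
  by rewrite rmorphM /= -hg -hh exprD mulrACA.
Qed.
HB.instance Definition _ := GRing.isSubringClosed.Build _ inB inB_subring.

Record ringB := RingB { Bval : {fraction S}; _ : Bval \in inB }.
HB.instance Definition _ := [isSub for Bval].
HB.instance Definition _ := [Choice of ringB by <:].
HB.instance Definition _ := [SubChoice_isSubComNzRing of ringB by <:].

Fact inB_S g : tofrac g \in inB.
Proof. by apply/asboolP; exists 0%N, g; rewrite expr0 mulr1. Qed.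
Definition StoB g : ringB := RingB (inB_S g).

(* the twist of g/h is g^(d)/h^(d) *)
Definition ftwist (x : {fraction S}) : {fraction S} :=
  xget 0 [set y | exists g h, [/\ h != 0, x = tofrac g / tofrac h &
                               y = tofrac (atwist g) / tofrac (atwist h)]]%classic.

Lemma ftwistE g h : h != 0 ->
  ftwist (tofrac g / tofrac h) = tofrac (atwist g) / tofrac (atwist h).
Proof.
move=> h0; apply: xget_unique; first by exists g, h.
move=> _ [g' [h' [h'0 /eqP e ->]]].
apply/eqP; rewrite eqr_div ?tofrac_eq0 ?atwist_eq0 //.
rewrite eqr_div ?tofrac_eq0 // -!rmorphM /= tofrac_eq in e.
by rewrite -!rmorphM /= (eqP e).
Qed.

Fact inB_twist (b : ringB) : ftwist (Bval b) \in inB.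
Proof.
case: b => x /= /asboolP[n [g hg]].
have w0 : tofrac varpi != 0 by rewrite tofrac_eq0 varpi_neq0.
have w1 : tofrac (atwist varpi) != 0 by rewrite tofrac_eq0 atwist_eq0 varpi_neq0.
have -> : x = tofrac g / tofrac (varpi ^+ n) by rewrite -hg rmorphXn mulfK ?expf_neq0.
rewrite ftwistE ?expf_neq0 ?varpi_neq0 //; apply/asboolP.
exists n, (atwist g * (1 - acst (vK C) * amon C (-1)) ^+ n).
set l := 1 - _ * _.
have e : tofrac varpi = tofrac l * tofrac (atwist varpi) by rewrite {1}varpi_twist rmorphM.
rewrite e exprMn rmorphXn /= rmorphXn /= rmorphM rmorphXn /=.
by rewrite mulrCA divfK ?expf_neq0 // mulrC.
Qed.
Definition Btwist (b : ringB) : ringB := RingB (inB_twist b).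

End Twist.

(* R[[X]]; below X stands for T_v - v. *)
Record powser (R : comNzRingType) := Powser { pcoef :> nat -> R }.

HB.instance Definition _ (R : comNzRingType) := gen_eqMixin (powser R).
HB.instance Definition _ (R : comNzRingType) := gen_choiceMixin (powser R).

Section PowerSeries.
Variable R : comNzRingType.
Implicit Types f g h : powser R.

Lemma powserP f g : (forall i, f i = g i) -> f = g.
Proof. by case: f g => [f] [g] /= fg; congr Powser; apply/funext. Qed.

Definition psC (c : R) : powser R := Powser (fun i => if i == 0%N then c else 0).
Definition psX : powser R := Powser (fun i => (i == 1%N)%:R).
Definition psadd f g : powser R := Powser (fun i => f i + g i).
Definition psopp f : powser R := Powser (fun i => - f i).
Definition psmul f g : powser R := Powser (fun n => \sum_(i < n.+1) f i * g (n - i)%N).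

Let tr (N : nat) f : {poly R} := \poly_(i < N) f i.

Lemma psmul_tr f g N n : (n < N)%N -> psmul f g n = (tr N f * tr N g)`_n.
Proof.
move=> hn; rewrite coefM /=; apply: eq_bigr => i _; have hi := ltn_ord i.
by rewrite !coef_poly !ifT //; lia.
Qed.

Lemma psmul_tr3 f g h N n : (n < N)%N ->
  psmul (psmul f g) h n = (tr N f * tr N g * tr N h)`_n.
Proof.
move=> hn; rewrite (psmul_tr _ _ hn) !coefM; apply: eq_bigr => i _; congr (_ * _).
have hi : (i < N)%N by have := ltn_ord i; lia.
by rewrite coef_poly hi (psmul_tr _ _ hi).
Qed.

Fact psaddA : associative psadd.
Proof. by move=> f g h; apply: powserP => i /=; rewrite addrA. Qed.
Fact psaddC : commutative psadd.
Proof. by move=> f g; apply: powserP => i /=; rewrite addrC. Qed.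
Fact psadd0 : left_id (psC 0) psadd.
Proof. by move=> f; apply: powserP => i /=; rewrite if_same add0r. Qed.
Fact psaddN : left_inverse (psC 0) psopp psadd.
Proof. by move=> f; apply: powserP => i /=; rewrite if_same addNr. Qed.
Fact psmulC : commutative psmul.
Proof.
by move=> f g; apply: powserP => i; rewrite !(psmul_tr _ _ (ltnSn i)) mulrC.
Qed.
Fact psmulA : associative psmul.
Proof.
move=> f g h; apply: powserP => i.
by rewrite psmulC !(psmul_tr3 _ _ _ (ltnSn i)) mulrC mulrA.
Qed.
Fact psmul1 : left_id (psC 1) psmul.
Proof.
move=> f; apply: powserP => i /=; rewrite big_ord_recl /= mul1r subn0.
by rewrite big1 ?addr0 // => j _; rewrite mul0r.
Qed.
Fact psmulDl : left_distributive psmul psadd.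
Proof.
move=> f g h; apply: powserP => i /=; rewrite -big_split.
by apply: eq_bigr => j _; rewrite mulrDl.
Qed.
Fact psone_neq0 : psC 1 != psC 0.
Proof. by apply/eqP => /(congr1 (fun f : powser R => f 0%N)) /eqP; rewrite /= oner_eq0. Qed.

HB.instance Definition _ := GRing.isZmodule.Build (powser R) psaddA psaddC psadd0 psaddN.
HB.instance Definition _ :=
  GRing.Zmodule_isComNzRing.Build (powser R) psmulA psmulC psmul1 psmulDl psone_neq0.

End PowerSeries.

(* the coefficient of x^n in (1 + x)^i, i in Z *)
Definition binz (i : int) (n : nat) : int :=
  match i with
  | Posz m => 'C(m, n)%:Z
  | Negz m => (-1) ^+ n * 'C(m + n, n)%:Z
  end.

Section Comparison.
Variables (F : finFieldType) (v : place F) (C : completion v).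
Local Notation vge := (vge (@cord F v C)).
Local Notation vcvg := (vcvg (@cord F v C)).
Local Notation S := (annser C).
Local Notation B := (ringB C).
Local Notation O := (powser C).
Local Notation q := #|F|.
Local Notation d := (size (v : {poly F})).-1.

(* A_v[[T_v, T_v^-1}} -> k_v[[X]], T_v |-> v + X *)
Definition taylor (f : S) : O :=
  Powser (fun n => zsum (fun i => (binz i n)%:~R * f i * vK C ^ (i - n%:Z))).

(* The extension of [taylor] to A_v[[T_v, T_v^-1}}[1/varpi^(d)]; it does not
   extend to B, since varpi has a zero at T_v = v. *)
Definition BtoO (b : B) : O :=
  xget 0 [set y : O | exists n (f : S),
     Bval b * tofrac (atwist (varpi C)) ^+ n = tofrac f /\
     y * taylor (atwist (varpi C)) ^+ n = taylor f]%classic.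

(* t as an element of F_{q^d}[[T_v]]: the root of v(t) = T_v that is congruent to
   epsilon modulo T_v. *)
Definition tT : S :=
  xget 0 [set f : S | [/\ forall i : int, i < 0 -> f i = 0,
     forall i : int, f i \in Fqd C, f 0 = teich C &
     (map_poly (fun a : F => acst (ofA C a%:P)) v).[f] = amon C 1]]%classic.

(* The images of p(t) in B (for p with coefficients in A_v) and in k_v[[T_v - v]]. *)
Definition polyB (p : {poly C}) : B := StoB (map_poly (@acst F v C) p).[tT].
Definition polyO (p : {poly C}) : O := (map_poly (@psC C) p).[taylor tT].

Definition Dv (i : nat) : {poly F} :=
  \prod_(a : 'rV[F]_i | ~~ ((v : {poly F}) %| 'X^i + rVpoly a)) ('X^i + rVpoly a).

(* The value Gamma_{ari,v}(z + 1), for z in Z_p given by its q-adic digits c. *)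
Definition gamma_digits (c : nat -> nat) : C :=
  vlim (fun n => \prod_(i < n) (- ofA C (Dv i)) ^+ c i).

(* c is the sequence of q-adic digits of z, for z in the intersection of Q and Z_p:
   z - sum_(j < i) c_j q^j is in q^i Z_p. *)
Definition qadic_digits (z : rat) (c : nat -> nat) : Prop :=
  forall i : nat, (c i < q)%N /\
    exists y : rat, coprime q (absz (denq y)) /\
      z = \sum_(j < i) (c j * q ^ j)%:R + (q ^ i)%:R * y.

Definition gamma_ari (x : rat) : C :=
  gamma_digits (xget (fun _ => 0%N) (qadic_digits (x - 1))).

Definition ratfrac (x : rat) : rat := x - (Num.floor x)%:~R.

End Comparison.

(* c is theta for the module R and epsilon for its reduction; ord_pred is the cyclic
   predecessor i - 1 mod l. *)
Definition tau (R : comNzRingType) (q l : nat) (c : R) (m : 'rV[{poly R}]_l) :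
    'rV[{poly R}]_l :=
  \row_i ((if i == 0%N :> nat then 'X - c%:P else 1) *
          map_poly (fun a => a ^+ q) (m 0 (ord_pred i))).

Definition lincomb (R : pzRingType) (V : lmodType R) (A : set R) (N : set V) : set V :=
  [set x | exists n (a : 'I_n -> R) (y : 'I_n -> V),
     (forall i, A (a i) /\ N (y i)) /\ x = \sum_i a i *: y i]%classic.

Section Fiber.
Variables (K : fieldType) (M : lmodType {poly K}) (a : K).

Definition tideal : {pred M} := [pred x | `[< exists y : M, x = ('X - a%:P) *: y >]].
Fact tideal_zmod : zmod_closed tideal.
Proof.
split=> [|x y /asboolP[x' ->] /asboolP[y' ->]]; apply/asboolP.
  by exists 0; rewrite scaler0.
by exists (x' - y'); rewrite scalerBr.
Qed.
HB.instance Definition _ := GRing.isZmodClosed.Build M tideal tideal_zmod.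

Definition fiber := Quotient.quot tideal.
HB.instance Definition _ := GRing.Zmodule.on fiber.
HB.instance Definition _ := EqQuotient.on fiber.

Definition fiber_scale (c : K) := lift_op1 fiber (fun x : M => c%:P *: x).

Fact pi_fiber_scale c : {morph \pi_fiber : x / c%:P *: x >-> fiber_scale c x}.
Proof.
move=> x; unlock fiber_scale; apply/eqP; rewrite piE /= /Quotient.equiv.
have : (x == repr (\pi_fiber x) %[mod fiber]) by rewrite reprK.
rewrite piE /= /Quotient.equiv => /asboolP[y hy]; apply/asboolP.
by exists (c%:P *: y); rewrite -scalerBr hy !scalerA mulrC.
Qed.
Canonical pi_fiber_scale_morph c := PiMorph1 (pi_fiber_scale c).

Fact fiber_scaleA c e x : fiber_scale c (fiber_scale e x) = fiber_scale (c * e) x.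
Proof. by elim/quotW: x => x; rewrite !piE scalerA -polyCM. Qed.
Fact fiber_scale1 : left_id 1 fiber_scale.
Proof. by elim/quotW => x; rewrite !piE scale1r. Qed.
Fact fiber_scaleDr : right_distributive fiber_scale +%R.
Proof. by move=> c; elim/quotW => x; elim/quotW => y; rewrite !piE scalerDr. Qed.
Fact fiber_scaleDl x : {morph fiber_scale^~ x : c e / c + e}.
Proof. by move=> c e; elim/quotW: x => x; rewrite !piE polyCD scalerDl. Qed.

HB.instance Definition _ := GRing.Zmodule_isLmodule.Build K fiber
  fiber_scaleA fiber_scale1 fiber_scaleDr fiber_scaleDl.

End Fiber.

Section Span.
Variables (K : fieldType) (l : nat).
Local Notation V := 'rV[{poly K}]_l.

Definition kspan (N : set V) : set V := lincomb [set p | exists c, p = c%:P]%classic N.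

Record tset := Tset {
  tset_set :> set V;
  tset_stable : forall x, tset_set x -> tset_set ('X *: x)
}.
Variable N : tset.

Definition in_kspan : {pred V} := [pred x | `[< kspan N x >]].

Lemma kspan0 : kspan N 0.
Proof.
exists 0%N, (fun _ => 0), (fun _ => 0); split; last by rewrite big_ord0.
by case.
Qed.

Lemma kspanD x y : kspan N x -> kspan N y -> kspan N (x + y).
Proof.
move=> [n [a [u [h ->]]]] [m [b [w [h' ->]]]].
exists (n + m)%N, (fun i => match split i with inl j => a j | inr j => b j end),
  (fun i => match split i with inl j => u j | inr j => w j end); split.
  by move=> i; case: (split i).
rewrite big_split_ord /=; congr (_ + _); apply: eq_bigr => i _.
  by rewrite (unsplitK (inl i)).
by rewrite (unsplitK (inr i)).
Qed.

Lemma kspanC c x : kspan N x -> kspan N (c%:P *: x).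
Proof.
move=> [n [a [u [h ->]]]]; exists n, (fun i => c%:P * a i), u; split=> [i|].
  have [[e ->] hu] := h i; split=> //; exists (c * e); by rewrite polyCM.
by rewrite scaler_sumr; apply: eq_bigr => i _; rewrite scalerA.
Qed.

Lemma kspanX x : kspan N x -> kspan N ('X *: x).
Proof.
move=> [n [a [u [h ->]]]]; exists n, a, (fun i => 'X *: u i); split=> [i|].
  by have [ha hu] := h i; split=> //; apply: tset_stable.
by rewrite scaler_sumr; apply: eq_bigr => i _; rewrite !scalerA mulrC.
Qed.

Lemma kspanZ p x : kspan N x -> kspan N (p *: x).
Proof.
move=> hx; elim/poly_ind: p => [|p c IH]; first by rewrite scale0r; apply: kspan0.
rewrite scalerDl; apply: kspanD; last exact: kspanC.
by rewrite mulrC -scalerA; apply: kspanX.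
Qed.

Fact in_kspan_submod : submod_closed in_kspan.
Proof.
split=> [|p x y /asboolP hx /asboolP hy]; apply/asboolP; first exact: kspan0.
by apply: kspanD => //; apply: kspanZ.
Qed.
HB.instance Definition _ := GRing.isSubmodClosed.Build {poly K} V in_kspan in_kspan_submod.

Record kspan_mod := KspanMod { kval : V; _ : kval \in in_kspan }.
HB.instance Definition _ := [isSub for kval].
HB.instance Definition _ := [Choice of kspan_mod by <:].
HB.instance Definition _ := [SubChoice_isSubLmodule of kspan_mod by <:].

End Span.

Section Cohomology.
Variables (F : finFieldType) (v : place F) (C : completion v) (l : nat).
Local Notation q := #|F|.
Local Notation d := (size (v : {poly F})).-1.
Local Notation V := 'rV[{poly C}]_l.
Local Notation R := 'rV[{poly {poly F}}]_l.
Local Notation S := (annser C).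
Local Notation B := (ringB C).
Local Notation O := (powser C).

Definition tauA : R -> R := tau q 'X.
Definition RtoV (m : R) : V := map_mx (map_poly (@ofA F v C)) m.
Definition tauR (j : nat) : set V := [set x | exists m, x = RtoV (iter j tauA m)]%classic.

Definition FqdX : set {poly C} := [set p | forall i, p`_i \in Fqd C]%classic.
Definition Rbar : set V := [set m | forall i, FqdX (m 0 i)]%classic.
Definition taubar : V -> V := tau q (teich C).
Definition tauRbar : set V := lincomb FqdX [set iter d taubar m | m in Rbar]%classic.

Lemma tauZX (T : comNzRingType) (c : T) (m : 'rV[{poly T}]_l) :
  tau q c ('X *: m) = 'X *: tau q c m.
Proof.
apply/rowP => i; rewrite !mxE mulrCA; congr (_ * _).
have h0 : (0 : T) ^+ q = 0 by rewrite expr0n; have := finNzRing_gt1 F; case: q.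
by apply/polyP => [[|j]]; rewrite coef_map_id0 // !coefXM //= coef_map_id0.
Qed.

Fact tauR_stable j x : tauR j x -> tauR j ('X *: x).
Proof.
move=> [m ->]; exists ('X *: m).
have -> : iter j tauA ('X *: m) = 'X *: iter j tauA m.
  by elim: j => [//|j IH]; rewrite !iterS IH; exact: tauZX.
apply/rowP => i; rewrite !mxE; apply/polyP => k.
have h0 : ofA C 0 = 0 by rewrite /ofA !rmorph0.
by case: k => [|k]; rewrite coef_map_id0 // !coefXM //= coef_map_id0.
Qed.

Fact tauRbar_stable x : tauRbar x -> tauRbar ('X *: x).
Proof.
move=> [n [a [y [h ->]]]]; exists n, (fun i => 'X * a i), y; split=> [i|].
  have [ha hy] := h i; split=> // [[|j]]; rewrite coefXM //=.
  by rewrite inE /= expr0n -(ltn_predK (qd_gt1 v)).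
by rewrite scaler_sumr; apply: eq_bigr => i _; rewrite scalerA.
Qed.

Definition tauR_t (j : nat) : tset C l := Tset (@tauR_stable j).
Definition tauRbar_t : tset C l := Tset tauRbar_stable.

(* H_dR(R, k_v) = k_v (x)_k H_dR(R, k), where k_v (x)_k <tau R>_k is the k_v-span of
   tau(R) in k_v[t]^l *)
Definition HdR := fiber (kspan_mod (tauR_t 1)) (theta C).

(* H_cris(R, k_v): since k_v (x)_{F_{q^d}} tau^d Rbar is the k_v-span of tau^d Rbar
   in k_v[t]^l, the tensor product over F_{q^d}[t] along t |-> theta is a fibre *)
Definition Hcris := fiber (kspan_mod tauRbar_t) (theta C).

HB.instance Definition _ := GRing.Lmodule.on HdR.
HB.instance Definition _ := EqQuotient.on HdR.
HB.instance Definition _ := GRing.Lmodule.on Hcris.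
HB.instance Definition _ := EqQuotient.on Hcris.

Definition omega_vec (s : 'I_l) : V :=
  (if s == 0%N :> nat then 'X - (theta C)%:P else 1) *: delta_mx 0 s.

Fact omega_in (s : 'I_l) : omega_vec s \in in_kspan (tauR_t 1).
Proof.
apply/asboolP; exists 1%N, (fun _ => 1%:P), (fun _ => omega_vec s); split; last first.
  by rewrite big_ord1 scale1r.
move=> _; split; first by exists 1.
have h0 : ofA C 0 = 0 by rewrite /ofA !rmorph0.
exists (delta_mx 0 (ord_pred s)); apply/rowP => i; rewrite !mxE /= (inj_eq (@ord_pred_inj _)).
have ofAr : @ofA F v C =1 (cinj C \o @FracField.tofrac _) by [].
rewrite (eq_map_poly ofAr) rmorphM.
have -> : map_poly (fun a : {poly F} => a ^+ q) (i == s)%:R = (i == s)%:R.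
  have q0 : (0 < q)%N by apply: ltnW; apply: finNzRing_gt1.
  have q0' : (0 : {poly F}) ^+ q = 0 by rewrite expr0n; case: q q0.
  case: eqP => _; last exact: map_poly0.
  apply/polyP => j; rewrite coef_map_id0 // coef1.
  by case: eqP => _; rewrite ?expr1n.
rewrite rmorph_nat; case: (eqVneq i s) => [->|_]; last by rewrite !mulr0.
rewrite !mulr1; case: eqP => _; last by rewrite rmorph1.
by rewrite rmorphB /= map_polyX map_polyC.
Qed.

Definition omega (s : 'I_l) : HdR := \pi_HdR (KspanMod (omega_in s)).

Definition taud_e (i : 'I_l) : V := RtoV (iter d tauA (delta_mx 0 i)).
Definition taud_ebar (i : 'I_l) : V := iter d taubar (delta_mx 0 i).

(* B (x)_{A[t]} R and B (x)_{F_{q^d}[t]} Rbar are free with bases 1 (x) e_i, and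
   are both identified with B^l.  The operator f (x) m |-> f^(d) (x) tau^d m is
   [taudB w] with w i = tau^d e_i *)
Definition taudB (w : 'I_l -> V) (x : 'rV[B]_l) : 'rV[B]_l :=
  \sum_i Btwist (x 0 i) *: map_mx (@polyB F v C) (w i).

(* the ideal m_v B; recall that m_v is principal *)
Definition mvB (b : B) : Prop :=
  exists (a : C) (c : B), vge (@cord F v C) 1 a /\ b = StoB (acst a) * c.

Definition hartl_kim (Phi : {linear 'rV[B]_l -> 'rV[B]_l}) : Prop :=
  [/\ bijective Phi,
      forall x, Phi (taudB taud_ebar x) = taudB taud_e (Phi x)
    & forall x i, mvB ((Phi x - x) 0 i)].

Section Induced.
Variable Phi : {linear 'rV[B]_l -> 'rV[B]_l}.

Definition vecO (x : V) : 'rV[O]_l := map_mx (@polyO F v C) x.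

(* k_v[[T_v - v]] (x) <tau^d R>_k, as a submodule of k_v[[T_v - v]]^l *)
Definition OtaudR : set 'rV[O]_l := lincomb setT [set vecO x | x in tauR d]%classic.

(* tau^d (Phi (1 (x) ebar_i)) = sum_j Phi_ij^(d) (x) tau^d e_j, where Phi_ij^(d)
   lies in A_v[[T_v, T_v^-1}}[1/varpi^(d)] *)
Definition taud_Phi (i : 'I_l) : 'rV[O]_l :=
  \sum_j BtoO (Btwist (Phi (delta_mx 0 i) 0 j)) *: vecO (taud_e j).

(* Phi_v, on k_v[[T_v - v]] (x) tau^d Rbar, which is free with basis 1 (x) tau^d ebar_i *)
Definition Phi_v (x : 'rV[O]_l) : 'rV[O]_l :=
  xget 0 [set y | exists h : 'I_l -> O,
    x = \sum_i h i *: vecO (taud_ebar i) /\ y = \sum_i h i *: taud_Phi i]%classic.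

(* the reduction of Phi_v modulo T_v - v, followed by
   <tau^d R> / (t - theta) <tau^d R> ~ H_dR *)
Definition phi_v (c : Hcris) : HdR :=
  xget 0 [set z | exists (x : kspan_mod tauRbar_t) (y : kspan_mod (tauR_t 1)),
    [/\ c = \pi_Hcris x, z = \pi_HdR y, kspan (tauR d) (kval y) &
        exists u : 'rV[O]_l,
          OtaudR u /\ Phi_v (vecO (kval x)) - vecO (kval y) = psX C *: u]]%classic.

Definition phi_v_inv (z : HdR) : Hcris := xget 0 [set c | phi_v c = z]%classic.

Definition tau_v (c : Hcris) : Hcris :=
  xget 0 [set c' | exists (x x' : kspan_mod tauRbar_t),
    [/\ c = \pi_Hcris x, c' = \pi_Hcris x' &
        exists n (a : 'I_n -> C) (m : 'I_n -> V),
          [/\ forall i, tauRbar (m i), kval x = \sum_i (a i)%:P *: m i &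
              kval x' = \sum_i (a i)%:P *: iter d taubar (m i)]]]%classic.

Definition rho_v (z : HdR) : HdR := phi_v (tau_v (phi_v_inv z)).

End Induced.

End Cohomology.

(* Main.v *)
(* Indices are taken modulo l, and b_s is the product of the t - theta^(q^k) over k < d
   congruent to s, with reduction bbar_s; thus tau^d e_{s-d} = b_s e_s.  A comparison of
   Gauss valuations forces the Hartl-Kim isomorphism to be diagonal, with entries satisfying
   Phi_s bbar_s = (Phi_{s-d})^(d) b_s.  Iterating this and evaluating at t = theta, where
   the N-th twist of Phi_s tends to 1, shows that the factor of rho_v omega_s is the limit of
     prod_{1 <= k < (N+1)d, k = s+d} (theta - theta^(q^k)) /
     prod_{1 <= k < N d, k = s} (theta - theta^(q^k)).
   On the other side, D_i = - (theta - theta^(q^i)) D_{i-1}^q, and D_{i,v} is the quotient of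
   D_i by v^(q^(i-d)) D_{i-d}, so the quotient of gamma values, whose digits are 1 at the
   indices congruent to s+d and s+d-1, is the same limit up to the sign and the factor v. *)
From HB Require Import structures.
Require Import Defs.
From mathcomp Require Import all_boot all_order all_algebra all_field.
From mathcomp Require Import boolp classical_sets.
From mathcomp Require Import zify ring.
Set Implicit Arguments.
Unset Strict Implicit.
Unset Printing Implicit Defensive.
Import Order.TTheory GRing.Theory Num.Theory.
Local Open Scope ring_scope.

(** * Frobenius twists and the residue field *)

(** An element of B may have a pole at T_v = v, because [varpi] contains the factor 1 - v/T_v; one
    twist removes it. So the entries of [Phi] are never evaluated themselves, only their twists, and
    the iteration starts at N = 1. Evaluating at T_v = v means t = theta, since the series t(T_v)
    takes the value theta there. The twist fixes t and epsilon but raises the constant theta to the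
    power q^d: the value of bbar_s stays the same along the iteration, while the values of the
    twists of b_s are consecutive blocks of the factors theta - theta^(q^k). The vanishing factor k
    = 0 of b_s is carried by the generator (t - theta, 0, ..., 0), whence products starting at k =
    1. These products are kept cross-multiplied, and limits are taken only after rewriting them with
    the - D_{i,v}, whose convergence to 1 comes from a Wilson-type congruence at i = d propagated by
    the recursion. Many objects are defined by choice with a default value, so an object with the
    required properties has to be exhibited first. *)

Lemma finField_gt1 (F : finFieldType) : (1 < #|F|)%N.
Proof. exact: finNzRing_gt1. Qed.

Section Frobenius.
Variables (F : finFieldType) (R : comNzRingType) (f : {rmorphism F -> R}).
Local Notation q := #|F|.

Lemma expq_gt0 k : (0 < q ^ k)%N.
Proof. by rewrite expn_gt0 (ltnW (finNzRing_gt1 F)). Qed.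

Lemma exprDq k (x y : R) : (x + y) ^+ (q ^ k) = x ^+ (q ^ k) + y ^+ (q ^ k).
Proof.
have [p p_pr pF] := finPcharP F.
have pR : p \in [pchar R] by rewrite (fmorph_pchar f).
apply: exprDn_pchar; rewrite (eq_pnat _ (pcharf_eq pR)).
by have /= -> := card_pprimeChar pF; rewrite !pnatX pnat_id.
Qed.

Lemma exprNq k (x : R) : (- x) ^+ (q ^ k) = - x ^+ (q ^ k).
Proof.
apply/eqP; rewrite -addr_eq0 -exprDq addNr expr0n.
by rewrite -(prednK (expq_gt0 k)).
Qed.

Lemma exprBq k (x y : R) : (x - y) ^+ (q ^ k) = x ^+ (q ^ k) - y ^+ (q ^ k).
Proof. by rewrite exprDq exprNq. Qed.

Lemma exprq_sum k (I : Type) (r : seq I) (P : pred I) (E : I -> R) :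
  (\sum_(i <- r | P i) E i) ^+ (q ^ k) = \sum_(i <- r | P i) E i ^+ (q ^ k).
Proof.
elim/big_rec2: _ => [|i x y _ <-]; last exact: exprDq.
by rewrite expr0n -(prednK (expq_gt0 k)).
Qed.

Lemma expf_cardX k (a : F) : a ^+ (q ^ k) = a.
Proof. by elim: k => [|k IH]; rewrite ?expr1 // expnS exprM expf_card. Qed.

Lemma expr_horner k (p : {poly F}) x :
  (map_poly f p).[x] ^+ (q ^ k) = (map_poly f p).[x ^+ (q ^ k)].
Proof.
rewrite !horner_coef exprq_sum; apply: eq_bigr => i _.
by rewrite exprMn exprAC coef_map -rmorphXn /= expf_cardX.
Qed.

End Frobenius.

(** * The residue field of v *)

Section ResidueField.
Variables (F : finFieldType) (v : place F).
Local Notation q := #|F|.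
Local Notation d := (size (v : {poly F})).-1.

Let v_mi : monic_irreducible_poly (v : {poly F}) :=
  (place_irr v, place_monic v).
Let K := {poly %/ (v : {poly F}) with v_mi}.
Let res (p : {poly F}) : K := in_qpoly (v : {poly F}) p.

Let resM : {morph res : p r / p * r}.
Proof. by move=> p r; exact: in_qpolyM. Qed.
Let resB : {morph res : p r / p - r}.
Proof. by move=> p r; exact: (raddfB (in_qpoly (v : {poly F}))). Qed.
Let resX n : {morph res : p / p ^+ n}.
Proof. by move=> p; exact: (rmorphXn (in_qpoly (v : {poly F}))). Qed.

Let res_eq0 p : (res p == 0) = (v %| p).
Proof.
rewrite -val_eqE /= [mk_monic _]mk_monicE //; apply/eqP/idP => h.
  by rewrite -Pdiv.IdomainMonic.modpE ?place_monic // in h; apply/modp_eq0P.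
by apply/eqP; rewrite -Pdiv.IdomainMonic.modpE ?place_monic //; apply/modp_eq0P.
Qed.

Lemma dvdp_frob (p : {poly F}) : (v : {poly F}) %| p ^+ (q ^ d) - p.
Proof. by rewrite -res_eq0 resB resX -(card_qfpoly v_mi) expf_card subrr. Qed.

(** The class of X generates the residue field, so once the q^e-power map fixes it every class is
    fixed; these q^d classes are roots of a polynomial of degree q^e. This makes the d conjugates of
    the Teichmueller lift distinct. *)
Lemma dvdp_XqX (e : nat) :
  (v : {poly F}) %| 'X^(q ^ e) - 'X -> (0 < e)%N -> (d <= e)%N.
Proof.
move=> ve e0.
have hp (x : K) : x ^+ (q ^ e) = x.
  have -> : x = res (val x).
    by apply: val_inj; rewrite /= Pdiv.CommonRing.rmodp_small // size_mk_monic.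
  rewrite -resX; apply/eqP; rewrite -subr_eq0 -resB res_eq0.
  move: (val x : {poly F}) => p.
  (* Frobenius fixes the coefficients and acts on p through its argument; p(X^(q^e)) - p(X) is then
     a multiple of X^(q^e) - X. *)
  have -> : p ^+ (q ^ e) = p \Po 'X^(q ^ e).
    by rewrite /comp_poly -expr_horner -/(comp_poly 'X p) comp_polyXr.
  apply: dvdp_trans ve _; rewrite -{2}[p]comp_polyXr /comp_poly.
  elim/poly_ind: p => [|p c IH]; first by rewrite rmorph0 !horner0 subrr dvdp0.
  rewrite rmorphD rmorphM /= map_polyX map_polyC !hornerMXaddC.
  rewrite opprD addrACA subrr addr0.
  set a := _.['X^_] in IH *; set b := _.['X] in IH *.
  have -> : a * 'X^(q ^ e) - b * 'X = a * ('X^(q ^ e) - 'X) + (a - b) * 'X.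
    by rewrite mulrBr mulrBl addrA subrK.
  by apply: dvdp_add; [exact: dvdp_mull|exact: dvdp_mulr].
have q1 : (1 < q ^ e)%N.
  by rewrite (leq_trans (_ : 1 < q ^ 1)%N) ?leq_exp2l // ?expn1; apply: finNzRing_gt1.
have sP : size ('X^(q ^ e) - 'X : {poly K}) = (q ^ e).+1.
  by rewrite size_polyDl ?size_polyXn ?size_polyN ?size_polyX.
have P0 : 'X^(q ^ e) - 'X != 0 :> {poly K} by rewrite -size_poly_eq0 sP.
have rP : all (root ('X^(q ^ e) - 'X)) (enum K).
  by apply/allP => x _; rewrite rootE !hornerE hp subrr.
have := max_poly_roots P0 rP (enum_uniq _).
by rewrite -cardE card_qfpoly sP ltnS leq_exp2l ?finNzRing_gt1.
Qed.

End ResidueField.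

(** * The completed field and the Teichmueller lift *)

Section Valuation.
Variables (F : finFieldType) (v : place F) (C : completion v).
Local Notation ord := (@cord F v C).
Local Notation vge := (vge ord).
Local Notation vcvg := (vcvg ord).

Lemma vge_ord (x : C) : vge (ord x) x.
Proof. by rewrite /Defs.vge lexx orbT. Qed.

Lemma vge_nord (x : C) : vge (- `|ord x|%:Z) x.
Proof. by apply: vge_le (vge_ord x); lia. Qed.

Lemma vgeX0 n (x : C) : vge 0 x -> vge 0 (x ^+ n).
Proof. by move=> h; have := vgeX n h; rewrite mul0r. Qed.

Lemma vgeX1 (n N : nat) (x : C) : (N <= n)%N -> vge 1 x -> vge N%:Z (x ^+ n).
Proof. by move=> Nn h; apply: vge_le (vgeX n h); rewrite mul1r lez_nat. Qed.

Lemma vgeM0 n (x y : C) : vge n x -> vge 0 y -> vge n (x * y).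
Proof. by move=> hx hy; rewrite -[n]addr0; apply: vgeM. Qed.

Lemma vge0M n (x y : C) : vge 0 x -> vge n y -> vge n (x * y).
Proof. by move=> hx hy; rewrite mulrC; apply: vgeM0. Qed.

Lemma vge_prod0 (I : Type) (r : seq I) (P : pred I) (a : I -> C) :
  (forall i, P i -> vge 0 (a i)) -> vge 0 (\prod_(i <- r | P i) a i).
Proof.
move=> h; elim/big_rec: _ => [|i x Pi hx]; first exact: vge1.
by apply: vgeM0 => //; apply: h.
Qed.

Lemma cordV (x : C) : x != 0 -> ord x^-1 = - ord x.
Proof.
move=> x0; have := cordM x0 (x := x) (y := x^-1); rewrite invr_eq0 => /(_ x0).
by rewrite mulfV // Defs.ord1; lia.
Qed.

Lemma vge1N1 : ~~ vge 1 (1 : C).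
Proof. by rewrite /Defs.vge oner_eq0 Defs.ord1. Qed.

Lemma vge1_neq0 (x : C) : vge 1 (x - 1) -> x != 0.
Proof.
by apply: contraTneq => ->; rewrite sub0r vgeN vge1N1.
Qed.

Lemma cord_unit (x : C) : vge 1 (x - 1) -> ord x = 0.
Proof.
move=> h; have x0 := vge1_neq0 h.
have : vge 0 x by rewrite -[x](subrK 1); apply: vgeD (vge1 C); apply: vge_le h.
have : ~~ vge 1 x.
  apply: contra (vge1N1) => h'; have -> : 1 = x - (x - 1) by ring.
  exact: vgeB.
by rewrite /Defs.vge (negPf x0) /=; lia.
Qed.

Lemma vge_unitV (x : C) : vge 1 (x - 1) -> vge 0 x^-1.
Proof.
by move=> h; rewrite /Defs.vge cordV ?vge1_neq0 // cord_unit // orbT.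
Qed.

Lemma vcvg_cst (x : C) : vcvg (fun=> x) x.
Proof. by move=> N; exists 0%N => n _; rewrite subrr vge0. Qed.

Lemma vcvg_shift m (u : nat -> C) l : vcvg u l -> vcvg (fun n => u (n + m)%N) l.
Proof. by move=> h N; have [n0 hn] := h N; exists n0 => n hh; apply: hn; lia. Qed.

Lemma vcvg_sub (f : nat -> nat) (u : nat -> C) l :
  (forall n, n <= f n)%N -> vcvg u l -> vcvg (u \o f) l.
Proof.
by move=> hf h N; have [n0 hn] := h N; exists n0 => n hh; apply: hn; have := hf n; lia.
Qed.

Lemma vcvg_ext (u w : nat -> C) l : u =1 w -> vcvg u l -> vcvg w l.
Proof. by move=> e h N; have [n0 hn] := h N; exists n0 => n /hn; rewrite e. Qed.

Lemma vcvgM u w (l l' : C) : vcvg u l -> vcvg w l' -> vcvg (fun n => u n * w n) (l * l').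
Proof.
move=> h h' N; set k := `|ord l|%N; set k' := `|ord l'|%N.
have [n0 h0] := h (N + k')%N; have [n1 h1] := h' (N + k)%N.
exists (n0 + n1)%N => n hn.
have {}h0 := h0 n ltac:(lia); have {}h1 := h1 n ltac:(lia).
have -> : u n * w n - l * l' =
  (u n - l) * (w n - l') + (l * (w n - l') + (u n - l) * l') by ring.
have kl := vge_nord l; have kl' := vge_nord l'.
apply: vgeD; first by apply: vge_le (vgeM h0 h1); lia.
by apply: vgeD; [apply: vge_le (vgeM kl h1)|apply: vge_le (vgeM h0 kl')]; lia.
Qed.

Lemma vcvgX m u (l : C) : vcvg u l -> vcvg (fun n => u n ^+ m) (l ^+ m).
Proof.
move=> h; elim: m => [|m IH].
  by rewrite expr0; apply: vcvg_ext (vcvg_cst 1) => n; rewrite expr0.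
by rewrite exprS; apply: vcvg_ext (vcvgM h IH) => n; rewrite exprS.
Qed.

Lemma vcvgB u w (l l' : C) : vcvg u l -> vcvg w l' -> vcvg (fun n => u n - w n) (l - l').
Proof.
move=> h h'; rewrite -[- l']mulN1r.
by apply: vcvg_ext (vcvgD h (vcvgM (vcvg_cst (-1)) h')) => n; rewrite mulN1r.
Qed.

Lemma vcvg_sum (I : Type) (r : seq I) (P : pred I) (u : I -> nat -> C) (l : I -> C) :
  (forall i, P i -> vcvg (u i) (l i)) ->
  vcvg (fun n => \sum_(i <- r | P i) u i n) (\sum_(i <- r | P i) l i).
Proof.
move=> h; elim: r => [|i r IH].
  by rewrite big_nil; apply: vcvg_ext (vcvg_cst 0) => n; rewrite big_nil.
rewrite big_cons; case: ifP => Pi.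
  by apply: vcvg_ext (vcvgD (h i Pi) IH) => n; rewrite big_cons Pi.
by apply: vcvg_ext IH => n; rewrite big_cons Pi.
Qed.

Lemma vcvg_prod (I : Type) (r : seq I) (P : pred I) (u : I -> nat -> C) (l : I -> C) :
  (forall i, P i -> vcvg (u i) (l i)) ->
  vcvg (fun n => \prod_(i <- r | P i) u i n) (\prod_(i <- r | P i) l i).
Proof.
move=> h; elim: r => [|i r IH].
  by rewrite big_nil; apply: vcvg_ext (vcvg_cst 1) => n; rewrite big_nil.
rewrite big_cons; case: ifP => Pi.
  by apply: vcvg_ext (vcvgM (h i Pi) IH) => n; rewrite big_cons Pi.
by apply: vcvg_ext IH => n; rewrite big_cons Pi.
Qed.

Lemma vcvg_horner (p : {poly C}) u (l : C) :
  vcvg u l -> vcvg (fun n => p.[u n]) p.[l].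
Proof.
move=> h; rewrite horner_coef.
suff H : vcvg (fun n => \sum_(i < size p) p`_i * u n ^+ i) (\sum_(i < size p) p`_i * l ^+ i).
  by apply: vcvg_ext H => n; rewrite horner_coef.
by apply: vcvg_sum => i _; apply: vcvgM (vcvg_cst _) _; apply: vcvgX.
Qed.

(** From some index on the factors are 1-units; the tail products stay 1-units and so does their
    limit, which therefore cannot vanish. This is what allows division by gamma values. *)
Lemma vcvg_prod_neq0 (u : nat -> C) : (forall i, u i != 0) -> vcvg u 1 ->
  exists2 l, l != 0 & vcvg (fun n => \prod_(i < n) u i) l.
Proof.
move=> u0 hu; have [n0 h0] := hu 1%N.
pose w n := \prod_(n0 <= i < n0 + n) u i.
have wS n : w n.+1 = w n * u (n0 + n)%N.
  by rewrite /w addnS big_nat_recr //= leq_addr.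
have w1 n : vge 1 (w n - 1).
  elim: n => [|n IH]; first by rewrite /w addn0 big_geq // subrr vge0.
  have hn : vge 1 (u (n0 + n)%N - 1) by apply: h0; lia.
  have -> : w n.+1 - 1 = (w n - 1) * (u (n0 + n)%N - 1) + (w n - 1) + (u (n0 + n)%N - 1).
    by rewrite wS; ring.
  by do 2?apply: vgeD => //; apply: vgeM0 => //; apply: vge_le hn.
have w0 n : vge 0 (w n).
  by rewrite -[w n](subrK 1); apply: vgeD (vge1 C); apply: vge_le (w1 n).
have cau : vcauchy ord w.
  move=> N; have [n1 h1] := hu N.
  have H m k : (n1 <= m)%N -> vge N%:Z (w (m + k)%N - w m).
    move=> hm; elim: k => [|k IH]; first by rewrite addn0 subrr vge0.
    rewrite addnS wS.
    have -> : w (m + k)%N * u (n0 + (m + k))%N - w m =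
      w (m + k)%N * (u (n0 + (m + k))%N - 1) + (w (m + k)%N - w m) by ring.
    by apply: vgeD => //; apply: vge0M => //; apply: h1; lia.
  exists n1 => m n hm hn; apply: vge_subT (_ : vge _ (w n1 - _)).
    by rewrite -(subnKC hm); apply: H.
  by apply: vge_subC; rewrite -(subnKC hn); apply: H.
have [l hl] := ccomplete cau.
have l1 : vge 1 (l - 1).
  apply: vcvg_ge (vcvgB hl (vcvg_cst 1)) _; exists 0%N => m _; exact: w1.
exists (\prod_(i < n0) u i * l).
  by apply: mulf_neq0 (vge1_neq0 l1); apply/prodf_neq0 => i _.
move=> N; have [n1 h1] := vcvgM (vcvg_cst (\prod_(i < n0) u i)) hl N.
exists (n0 + n1)%N => n hn; have := h1 (n - n0)%N ltac:(lia).
by rewrite -!(big_mkord xpredT) /w (subnKC (_ : n0 <= n)%N) -?big_cat_nat //=; lia.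
Qed.

End Valuation.

(** * The Teichmueller lift and the factorisation of v *)

Definition cstC (F : finFieldType) (v : place F) (C : completion v) (a : F) : C :=
  ofA C a%:P.

Section Theta.
Variables (F : finFieldType) (v : place F) (C : completion v).
Local Notation q := #|F|.
Local Notation d := (size (v : {poly F})).-1.
Local Notation ord := (@cord F v C).
Local Notation vge := (vge ord).
Local Notation vcvg := (vcvg ord).
Local Notation ofA := (ofA C).
Local Notation theta := (theta C).
Local Notation eps := (teich C).
Local Notation cst := (@cstC F v C).

Fact ofA_zmod : zmod_morphism ofA.
Proof. by move=> x y; rewrite /Defs.ofA !rmorphB. Qed.
Fact ofA_monoid : monoid_morphism ofA.
Proof. by split=> [|x y]; rewrite /Defs.ofA ?rmorph1 ?rmorphM. Qed.
HB.instance Definition _ := GRing.isZmodMorphism.Build _ _ ofA ofA_zmod.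
HB.instance Definition _ := GRing.isMonoidMorphism.Build _ _ ofA ofA_monoid.

Fact cst_zmod : zmod_morphism cst.
Proof. by move=> x y; rewrite /cstC polyCB rmorphB. Qed.
Fact cst_monoid : monoid_morphism cst.
Proof. by split=> [|x y]; rewrite /cstC ?polyC1 ?rmorph1 // polyCM rmorphM. Qed.
HB.instance Definition _ := GRing.isZmodMorphism.Build _ _ cst cst_zmod.
HB.instance Definition _ := GRing.isMonoidMorphism.Build _ _ cst cst_monoid.

Lemma ofA_eq0 p : (ofA p == 0) = (p == 0).
Proof. by rewrite /Defs.ofA fmorph_eq0 tofrac_eq0. Qed.

Lemma ofA_inj : injective ofA.
Proof.
by move=> p r /eqP; rewrite -subr_eq0 -rmorphB ofA_eq0 subr_eq0 => /eqP.
Qed.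

Lemma vge_ofA (n : nat) p : vge n%:Z (ofA p) = ((v : {poly F}) ^+ n %| p).
Proof.
have [->|p0] := eqVneq p 0; first by rewrite rmorph0 vge0 dvdp0.
by rewrite /Defs.vge ofA_eq0 (negPf p0) /= /Defs.ofA cord_vadic.
Qed.

Lemma vge0_ofA p : vge 0 (ofA p).
Proof. by rewrite (vge_ofA 0) expr0 dvd1p. Qed.

Lemma vge0_theta : vge 0 theta. Proof. exact: vge0_ofA. Qed.
Lemma vge0_cst a : vge 0 (cst a). Proof. exact: vge0_ofA. Qed.

Lemma ofA_horner p : ofA p = (map_poly cst p).[theta].
Proof.
rewrite -{1}[p]comp_polyXr /comp_poly.
have -> : map_poly cst p = map_poly ofA (map_poly polyC p) by rewrite -map_poly_comp.
by rewrite horner_map.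
Qed.

Lemma ofA_exprq k p : ofA p ^+ (q ^ k) = (map_poly cst p).[theta ^+ (q ^ k)].
Proof. by rewrite ofA_horner expr_horner. Qed.

Lemma frobB k (x y : C) : (x - y) ^+ (q ^ k) = x ^+ (q ^ k) - y ^+ (q ^ k).
Proof. exact: exprBq cst k x y. Qed.

Lemma frobN k (x : C) : (- x) ^+ (q ^ k) = - x ^+ (q ^ k).
Proof. exact: exprNq cst k x. Qed.

Lemma theta_expr_inj m n : theta ^+ m = theta ^+ n -> m = n.
Proof.
rewrite /Defs.theta -!rmorphXn => /ofA_inj /(congr1 (fun p : {poly F} => size p)).
by rewrite !size_polyXn => -[].
Qed.

Lemma qd_expn k : (qd v ^ k = q ^ (d * k))%N.
Proof. by rewrite /qd -expnM. Qed.

Lemma d_gt0 : (0 < d)%N. Proof. by have := v_size v; case: (size _) => [|[]]. Qed.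

Lemma expq_lt k : (k < q ^ k)%N.
Proof. by apply: ltn_expl; apply: finNzRing_gt1. Qed.

Lemma vge1_frob p : vge 1 (ofA p ^+ qd v - ofA p).
Proof. by rewrite -rmorphXn -rmorphB (vge_ofA 1) expr1 dvdp_frob. Qed.

(** Consecutive terms differ by the q^(d i)-th power of theta^(q^d) - theta, which v divides. *)
Lemma teich_cvg : vcvg (fun i => theta ^+ (qd v ^ i)) eps.
Proof.
apply: vlim_cvg => N.
have step i : vge i%:Z (theta ^+ (qd v ^ i.+1) - theta ^+ (qd v ^ i)).
  rewrite expnS exprM qd_expn -frobB -qd_expn; apply: vgeX1 (vge1_frob _).
  by apply: ltnW; apply: ltn_expl; apply: qd_gt1.
have H m k : vge m%:Z (theta ^+ (qd v ^ (m + k)) - theta ^+ (qd v ^ m)).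
  elim: k => [|k IH]; first by rewrite addn0 subrr vge0.
  rewrite addnS; apply: vge_subT IH; apply: vge_le (step _); lia.
exists N => m n hm hn; apply: vge_subT (_ : vge _ (theta ^+ (qd v ^ N) - _)).
  by rewrite -(subnKC hm); apply: H.
by apply: vge_subC; rewrite -(subnKC hn); apply: H.
Qed.

Lemma teich_qd : eps ^+ qd v = eps.
Proof.
apply: vcvg_unique (vcvgX (qd v) teich_cvg) _.
by apply: vcvg_ext (vcvg_shift 1 teich_cvg) => n /=; rewrite addn1 expnSr exprM.
Qed.

Lemma teich_qdX n : eps ^+ (qd v ^ n) = eps.
Proof. by elim: n => [|n IH]; rewrite ?expr1 // expnS exprM teich_qd. Qed.

Lemma teich_qM n k : eps ^+ (q ^ (k + n * d)) = eps ^+ (q ^ k).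
Proof. by rewrite expnD mulnC exprM mulnC -qd_expn teich_qdX. Qed.

Lemma vge1_theta_qd n : vge 1 (theta ^+ (qd v ^ n) - theta).
Proof.
elim: n => [|n IH]; first by rewrite expr1 subrr vge0.
apply: vge_subT IH; rewrite expnS exprM qd_expn -frobB -qd_expn.
by apply: vgeX1 (vge1_frob _); rewrite expn_gt0 ltnW ?qd_gt1.
Qed.

Lemma vge1_theta_teich : vge 1 (theta - eps).
Proof.
apply: vge_subC; apply: vcvg_ge (vcvgB teich_cvg (vcvg_cst theta)) _.
by exists 0%N => m _; apply: vge1_theta_qd.
Qed.

Lemma vge0_teich : vge 0 eps.
Proof.
have -> : eps = theta - (theta - eps) by ring.
by apply: vgeB vge0_theta _; apply: vge_le vge1_theta_teich.
Qed.

Lemma root_teich : (map_poly cst v).[eps] = 0.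
Proof.
apply: vge_eq0 => N; apply: vcvg_ge (vcvg_horner _ teich_cvg) _.
exists N => m hm; rewrite qd_expn -ofA_exprq; apply: vgeX1; last exact: vge_vK.
by rewrite (leq_trans hm) // -qd_expn ltnW // ltn_expl // qd_gt1.
Qed.

Lemma root_teichq k : (map_poly cst v).[eps ^+ (q ^ k)] = 0.
Proof. by rewrite -expr_horner root_teich expr0n -(prednK (expq_gt0 F k)). Qed.

(** Two equal conjugates would make epsilon, hence theta modulo v, fixed by the q^e-power map for
    some 0 < e < d, against [dvdp_XqX]. *)
Lemma teich_inj i j : (i < d)%N -> (j < d)%N -> eps ^+ (q ^ i) = eps ^+ (q ^ j) -> i = j.
Proof.
wlog ij : i j / (i <= j)%N => [H|] hi hj e.
  by case/orP: (leq_total i j) => /H h; [|symmetry]; apply: h.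
apply/eqP; apply: contraTT isT => nij.
have {}ij : (i < j)%N by rewrite ltn_neqAle nij.
have e0 : eps ^+ (q ^ (j - i)) = eps.
  have /(congr1 (fun x => x ^+ (q ^ (d - i)))) := e.
  rewrite -!exprM -!expnD subnKC; last by lia.
  have -> : (j + (d - i) = j - i + 1 * d)%N by lia.
  by rewrite teich_qM => <-; rewrite -[d in (q ^ d)%N]mul1n -[(1 * d)%N]add0n teich_qM.
have : (v : {poly F}) %| 'X^(q ^ (j - i)) - 'X.
  rewrite -[X in X %| _]expr1 -vge_ofA rmorphB rmorphXn -/theta.
  (* As epsilon is fixed it drops out of the difference, and what remains is built from theta -
     epsilon, of valuation at least 1. *)
  have -> : theta ^+ (q ^ (j - i)) - theta = (theta - eps) ^+ (q ^ (j - i)) - (theta - eps).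
    by rewrite frobB e0; ring.
  by apply: vgeB vge1_theta_teich; apply: vgeX1 vge1_theta_teich; rewrite expq_gt0.
by move/dvdp_XqX => /(_ _)/wrap[]; lia.
Qed.

Lemma map_place : map_poly cst v = \prod_(i < d) ('X - (eps ^+ (q ^ i))%:P).
Proof.
have := @all_roots_prod_XsubC _ (map_poly cst v) [seq eps ^+ (q ^ i) | i <- iota 0 d].
rewrite -(big_mkord xpredT (fun i => 'X - (eps ^+ (q ^ i))%:P)) /index_iota subn0.
rewrite size_map size_iota big_map.
rewrite size_map_poly lead_coef_map (monicP (place_monic v)) rmorph1 scale1r; apply.
- by rewrite prednK // ltnW // v_size.
- by apply/allP => _ /mapP[i _ ->]; rewrite /root root_teichq.
rewrite uniq_rootsE map_inj_in_uniq ?iota_uniq // => i j.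
by rewrite !mem_iota !add0n; apply: teich_inj.
Qed.

Lemma vK_prod : vK C = \prod_(i < d) (theta - eps ^+ (q ^ i)).
Proof.
rewrite /vK ofA_horner map_place horner_prod.
by apply: eq_bigr => i _; rewrite !hornerE.
Qed.

(** The cofactor w in X^(q^d) - X = v w. It turns the equation v(y) = T_v into a fixed point problem
    for y^(q^d) - T_v w(y). *)
Definition cofv : {poly F} := ('X^(qd v) - 'X) %/ v.

Lemma cofvE : 'X^(qd v) - 'X = (v : {poly F}) * cofv.
Proof. by rewrite mulrC divpK // dvdp_frob. Qed.

Lemma deriv_Xqd : ('X^(qd v) - 'X : {poly F})^`() = -1.
Proof.
have [p p_pr pF] := finPcharP F.
rewrite derivB derivX derivXn -mulr_natr.
suff -> : (qd v)%:R = 0 :> {poly F} by rewrite mulr0 sub0r.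
have pP : p \in [pchar {poly F}] by rewrite pchar_poly.
apply/eqP; rewrite -(dvdn_pcharf pP) /qd; have /= -> := card_pprimeChar pF.
rewrite -expnM Euclid_dvdX // dvdnn /= muln_gt0 d_gt0 andbT.
by rewrite lt0n; apply: contraTneq (finNzRing_gt1 F) => e; rewrite (card_pprimeChar pF) e.
Qed.

(** Differentiate X^(q^d) - X = v w at the root epsilon of v; in characteristic p the left side has
    derivative -1. *)
Lemma cofv_teich : (map_poly cst v)^`().[eps] * (map_poly cst cofv).[eps] = -1.
Proof.
have := congr1 (fun p : {poly F} => (map_poly cst p).[eps]) deriv_Xqd.
rewrite /= cofvE derivM rmorphD !rmorphM /= !hornerE deriv_map root_teich mul0r addr0.
by rewrite rmorphN rmorph1 hornerN hornerC.
Qed.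

End Theta.

(** * Carlitz factorials and the arithmetic gamma function *)

Section CarlitzFactorial.
Variables (F : finFieldType) (v : place F) (C : completion v).
Local Notation q := #|F|.
Local Notation d := (size (v : {poly F})).-1.
Local Notation ofA := (ofA C).
Local Notation theta := (theta C).
Local Notation cst := (@cstC F v C).

Lemma thetaq_inj : injective (fun k => theta ^+ (q ^ k)).
Proof. by move=> i j /theta_expr_inj; apply: expnI; apply: finNzRing_gt1. Qed.

Definition carlitz_D (i : nat) : {poly F} := \prod_(a : 'rV[F]_i) ('X^i + rVpoly a).

Lemma size_XnDrV i (a : 'rV[F]_i) : size ('X^i + rVpoly a) = i.+1.
Proof. by rewrite size_polyDl ?size_polyXn // ltnS size_poly. Qed.

(* The F-linear polynomial sum_i c_i X^(q^i), where c_i is the leading coefficient of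
   the i-th Lagrange polynomial at theta, theta^q, ..., theta^(q^n), sends a polynomial
   in theta of degree at most n to its coefficient of theta^n. *)
Lemma ofA_carlitz_D n : ofA (carlitz_D n) = \prod_(k < n) (theta ^+ (q ^ n) - theta ^+ (q ^ k)).
Proof.
pose x k := theta ^+ (q ^ k).
pose c (i : 'I_n.+1) := (tnth (lagrange n.+1 x) i : {poly C})`_n.
pose P : {poly C} := \sum_i c i *: 'X^(q ^ i).
have PE (a : {poly F}) : (size a <= n.+1)%N -> P.[ofA a] = cst a`_n.
  move=> sa; rewrite horner_sum -coef_map /=.
  rewrite [map_poly _ a](lagrange_gen (x := x) (n := n.+1)) //; last by rewrite size_map_poly.
    rewrite coef_sum; apply: eq_bigr => i _.
    by rewrite hornerZ hornerXn ofA_exprq mulrC coefCM.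
  exact: thetaq_inj.
have cE : (c ord_max)^-1 = \prod_(k < n) (x n - x k).
  rewrite /c lagrangeE //; last exact: thetaq_inj.
  rewrite /=; set p : {poly C} := \prod_(j < _ | j != _) _.
  have pE : p = \prod_(j < n) ('X - (x j)%:P).
    rewrite /p big_mkcond big_ord_recr /= eqxx mulr1; apply: eq_bigr => i _.
    by rewrite -(inj_eq val_inj) /= ltn_eqF.
  have p1 : p`_n = 1.
    have m1 : p \is monic by rewrite pE monic_prod // => i _; apply: monicXsubC.
    move/monicP: m1; rewrite lead_coefE pE size_prod => [|i _]; last by rewrite polyXsubC_eq0.
    rewrite (eq_bigr (fun=> 2%N)) => [|i _]; last by rewrite size_XsubC.
    by rewrite sum_nat_const card_ord; have -> : ((n * 2).+1 - n).-1 = n by lia.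
  rewrite coefCM p1 mulr1 invrK pE horner_prod.
  by apply: eq_bigr => i _; rewrite !hornerE.
have c0 : c ord_max != 0.
  rewrite -invr_eq0 cE; apply/prodf_neq0 => i _.
  by rewrite subr_eq0 (inj_eq thetaq_inj) gtn_eqF.
have PS : P = \sum_(i < n) c (widen_ord (leqnSn n) i) *: 'X^(q ^ i) + c ord_max *: 'X^(q ^ n).
  by rewrite /P big_ord_recr.
set P1 := \sum_(i < n) _ in PS.
have sP1 : (size P1 <= q ^ n)%N.
  apply: (leq_trans (size_sum _ _ _)); apply/bigmax_leqP => i _.
  by rewrite (leq_trans (size_scale_leq _ _)) // size_polyXn ltn_exp2l // finNzRing_gt1.
have sP2 : size (c ord_max *: 'X^(q ^ n)) = (q ^ n).+1 by rewrite size_scale ?size_polyXn.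
have sP : size P = (q ^ n).+1 by rewrite PS addrC size_polyDl sP2.
have lP : lead_coef P = c ord_max.
  by rewrite PS lead_coefDr ?sP2 // lead_coefZ lead_coefXn mulr1.
(* Polynomials in theta of degree below n have no coefficient at theta^n, so P kills all q^n of
   them; by its degree it has no other root. The minus sign makes theta^n - z run over the theta^n +
   a. *)
pose rs := [seq - ofA (rVpoly a) | a : 'rV[F]_n].
have P_prod : P = c ord_max *: \prod_(z <- rs) ('X - z%:P).
  rewrite -lP; apply: all_roots_prod_XsubC.
  - by rewrite sP size_map -cardE card_mx mul1n.
  - apply/allP => _ /mapP[a _ ->]; rewrite /root -rmorphN PE ?size_polyN.
      by rewrite coefN [_`_n]nth_default ?oppr0 ?rmorph0 // size_poly.
    by rewrite ltnW // ltnS size_poly.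
  rewrite uniq_rootsE map_inj_uniq ?enum_uniq // => a b /oppr_inj /ofA_inj.
  exact: (can_inj rVpolyK).
(* P takes the value 1 at theta^n, which determines the product over the roots. *)
have := PE 'X^n; rewrite size_polyXn leqnn coefXn eqxx rmorph1 => /(_ isT).
rewrite P_prod hornerZ horner_prod big_map => e.
rewrite /x -cE /carlitz_D rmorph_prod; apply: (mulfI c0); rewrite mulfV // -[RHS]e.
congr (_ * _); rewrite [RHS]big_enum; apply: eq_bigr => a _.
by rewrite rmorphD !hornerE opprK.
Qed.

Lemma Dv_small i : (i < d)%N -> Dv v i = carlitz_D i.
Proof.
move=> id; apply: eq_bigl => a; apply/negP => /dvdp_leq.
rewrite -size_poly_eq0 size_XnDrV => /(_ isT) h.
by move: id; rewrite -ltnS prednK ?(ltnW (v_size v)) // ltnNge h.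
Qed.

(** The factors of D_i left out of [Dv] are the products of v with the q^(i-d) monic polynomials of
    degree i - d. *)
Lemma Dv_big i : (d <= i)%N ->
  carlitz_D i = Dv v i * ((v : {poly F}) ^+ (q ^ (i - d)) * carlitz_D (i - d)).
Proof.
move=> di; have v0 : (v : {poly F}) != 0 by apply: monic_neq0 (place_monic v).
have sv : size (v : {poly F}) = d.+1 by rewrite prednK // ltnW // v_size.
rewrite /carlitz_D (bigID (fun a => v %| 'X^i + rVpoly a)) /= mulrC; congr (_ * _).
(* Multiplication by v and, in h', division by v, transported to the vectors of non-leading
   coefficients. *)
pose h (b : 'rV[F]_(i - d)) : 'rV[F]_i := poly_rV ((v : {poly F}) * ('X^(i - d) + rVpoly b) - 'X^i).
pose h' (a : 'rV[F]_i) : 'rV[F]_(i - d) := poly_rV (('X^i + rVpoly a) %/ v - 'X^(i - d)).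
have size_sub (p : {poly F}) m : p \is monic -> size p = m.+1 -> (size (p - 'X^m)%R <= m)%N.
  move=> pm sp; apply/leq_sizeP => j; rewrite coefB coefXn leq_eqVlt => /orP[/eqP<-|mj].
    by have := monicP pm; rewrite lead_coefE sp eqxx /= => ->; rewrite subrr.
  by rewrite nth_default ?sp // gtn_eqF // subr0.
have mX m (b : 'rV[F]_m) : 'X^m + rVpoly b \is monic.
  by rewrite monicE lead_coefDl ?lead_coefXn // size_polyXn ltnS size_poly.
have hE b : 'X^i + rVpoly (h b) = (v : {poly F}) * ('X^(i - d) + rVpoly b).
  rewrite /h poly_rV_K; first by rewrite addrC subrK.
  apply: size_sub; first by rewrite monicMl ?place_monic // mX.
  by rewrite size_mul ?v0 ?(monic_neq0 (mX _ b)) // size_XnDrV sv; lia.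
have h'E a : v %| 'X^i + rVpoly a -> 'X^(i - d) + rVpoly (h' a) = ('X^i + rVpoly a) %/ v.
  move=> va; rewrite /h' poly_rV_K; first by rewrite addrC subrK.
  have e := divpK va.
  apply: size_sub.
    by move: (mX i a); rewrite -{1}e monicMr ?place_monic.
  by rewrite size_divp // size_XnDrV subSn.
rewrite (reindex_onto h h') => [|a va]; last first.
  apply: (can_inj rVpolyK); apply: (@addrI _ 'X^i).
  by rewrite hE h'E // mulrC divpK.
rewrite (eq_bigl xpredT) => [|b]; last first.
  have vb : v %| 'X^i + rVpoly (h b) by rewrite hE dvdp_mulr.
  rewrite vb /=; apply/eqP; apply: (can_inj rVpolyK); apply: (@addrI _ 'X^(i - d)).
  by rewrite h'E // hE mulKp.
under eq_bigr do rewrite hE.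
rewrite big_split /= prodr_const card_mx mul1n; congr (_ * _).
Qed.

(** The negative of Carlitz's bracket [k]; with this sign it is the value of t - theta^(q^k) at t =
    theta. *)
Definition dif (k : nat) : C := theta - theta ^+ (q ^ k).

Lemma dif_neq0 k : (0 < k)%N -> dif k != 0.
Proof.
move=> k0; rewrite subr_eq0 -{1}[theta]expr1 -(expn0 q) (inj_eq thetaq_inj).
by rewrite ltn_eqF.
Qed.

(** In the product formula the factors with k > 0 are q-th powers of those for n, and k = 0 gives
    the bracket. *)
Lemma carlitz_DS n : ofA (carlitz_D n.+1) = - dif n.+1 * ofA (carlitz_D n) ^+ q.
Proof.
rewrite !ofA_carlitz_D big_ord_recl expn0 expr1 /dif opprB; congr (_ * _).
rewrite -prodrXl; apply: eq_bigr => i _.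
have := frobB 1 (theta ^+ (q ^ n)) (theta ^+ (q ^ i)).
by rewrite expn1 => ->; rewrite -!exprM -!expnSr.
Qed.

Lemma carlitz_D_neq0 n : ofA (carlitz_D n) != 0.
Proof.
rewrite ofA_carlitz_D; apply/prodf_neq0 => i _.
by rewrite subr_eq0 (inj_eq thetaq_inj) gtn_eqF.
Qed.

Definition mDv i : C := - ofA (Dv v i).

Lemma mDv_neq0 i : mDv i != 0.
Proof.
rewrite oppr_eq0; case: (ltnP i d) => id; first by rewrite Dv_small // carlitz_D_neq0.
by have := carlitz_D_neq0 i; rewrite Dv_big // rmorphM mulf_eq0 => /norP[].
Qed.

Lemma mDv0 : mDv 0 = -1.
Proof. by rewrite /mDv Dv_small ?d_gt0 // ofA_carlitz_D big_ord0. Qed.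

(** The ratio of [mDv] at k to the q-th power of [mDv] at k - 1. Beyond d, dividing the recursion
    for D_k by the one for D_{k-d} cancels the sign and the power of v; at k = d the first monic
    multiple of v leaves an isolated v. *)
Definition mDv_step (k : nat) : C :=
  (if (k <= d)%N then - dif k else dif k) /
  (if (d < k)%N then dif (k - d) else if k == d then vK C else 1).

Lemma mDvS n : mDv n.+1 = mDv_step n.+1 * mDv n ^+ q.
Proof.
have Nq (y : C) : (- y) ^+ q = - y ^+ q by have := frobN 1 y; rewrite expn1.
rewrite /mDv Nq /mDv_step; case: (ltngtP n.+1 d) => h.
- by rewrite !Dv_small ?(ltnW h) // carlitz_DS divr1 mulrN mulNr.
- have h' : (d <= n)%N by rewrite -ltnS.
  have := carlitz_DS n; rewrite (Dv_big (ltnW h)) (Dv_big h') !rmorphM !rmorphXn /= -/(vK C).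
  rewrite subSn // carlitz_DS expnSr exprM exprMn exprMn.
  have a0 := expf_neq0 q (carlitz_D_neq0 (n - d)).
  have w0 := expf_neq0 q (expf_neq0 (q ^ (n - d)) (vK_neq0 C)).
  have b0 := @dif_neq0 (n - d).+1 isT.
  move: a0 w0 b0; move: (ofA (carlitz_D (n - d)) ^+ q) ((vK C ^+ (q ^ (n - d))) ^+ q) => a w.
  move: (dif (n - d).+1) (dif n.+1) (ofA (Dv v n.+1)) (ofA (Dv v n) ^+ q) => b c y z.
  move=> a0 w0 b0 e.
  apply: (mulIf (mulf_neq0 b0 (mulf_neq0 w0 a0))).
  transitivity (y * (w * (- b * a))); first by ring.
  by rewrite e; field.
have sn : carlitz_D n = Dv v n by rewrite Dv_small // -h.
have := carlitz_DS n; rewrite h (Dv_big (leqnn d)) sn.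
rewrite subnn expn0 expr1 !rmorphM /= -/(vK C) [ofA (carlitz_D 0)]ofA_carlitz_D big_ord0 mulr1.
move: (vK_neq0 C); move: (vK C) => w w0.
move: (dif d) (ofA (Dv v d)) (ofA (Dv v n) ^+ q) => b y z e.
by apply: (mulIf w0); rewrite mulNr e; field.
Qed.

End CarlitzFactorial.

(** * Convergence of - D_{i,v} to 1 *)

Section GammaFactors.
Variables (F : finFieldType) (v : place F) (C : completion v).
Local Notation q := #|F|.
Local Notation d := (size (v : {poly F})).-1.
Local Notation ord := (@cord F v C).
Local Notation vge := (vge ord).
Local Notation vcvg := (vcvg ord).
Local Notation ofA := (ofA C).
Local Notation theta := (theta C).
Local Notation eps := (teich C).
Local Notation cst := (@cstC F v C).

Lemma vge_horner_cst (P : {poly F}) x : vge 0 x -> vge 0 (map_poly cst P).[x].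
Proof.
move=> x0; rewrite horner_coef; apply: vge_sum => i _; rewrite coef_map.
by apply: vgeM0 (vge0_cst _ _) (vgeX0 _ x0).
Qed.

Lemma vge_hornerB (P : {poly F}) n x y : vge 0 x -> vge 0 y -> vge n (x - y) ->
  vge n ((map_poly cst P).[x] - (map_poly cst P).[y]).
Proof.
move=> x0 y0 xy; elim/poly_ind: P => [|P c IH].
  by rewrite rmorph0 !horner0 subrr vge0.
rewrite rmorphD rmorphM /= map_polyX map_polyC !hornerMXaddC.
set a := _.[x] in IH *; set b := _.[y] in IH *.
have -> : a * x + cst c - (b * y + cst c) = (a - b) * x + b * (x - y) by ring.
by apply: vgeD; [exact: vgeM0|apply: vge0M => //; exact: vge_horner_cst].
Qed.

Lemma vge_prodB (I : Type) (r : seq I) (a b : I -> C) n :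
  (forall i, vge 0 (a i)) -> (forall i, vge 0 (b i)) ->
  (forall i, vge n (a i - b i)) ->
  vge n (\prod_(i <- r) a i - \prod_(i <- r) b i).
Proof.
move=> a0 b0 ab; elim: r => [|i r IH]; first by rewrite !big_nil subrr vge0.
rewrite !big_cons; set x := \prod_(j <- r) _ in IH *; set y := \prod_(j <- r) _ in IH *.
have -> : a i * x - b i * y = (a i - b i) * x + b i * (x - y) by ring.
by apply: vgeD; [apply: vgeM0 => //; apply: vge_prod0|apply: vge0M].
Qed.

Lemma vge1_thetaq k : vge (q ^ k)%:Z (theta ^+ (q ^ k) - eps ^+ (q ^ k)).
Proof. by rewrite -frobB; apply: vgeX1 (vge1_theta_teich _). Qed.

Lemma vge0_teichq k : vge 0 (eps ^+ k). Proof. exact/vgeX0/vge0_teich. Qed.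
Lemma vge0_thetaq k : vge 0 (theta ^+ k). Proof. exact/vgeX0/vge0_theta. Qed.

(** The integral elements theta - epsilon^(q^i), i < d, have product v, whose valuation is 1. *)
Lemma theta_teich_vge2 k : ~~ vge 2 (theta - eps ^+ (q ^ k)).
Proof.
rewrite (divn_eq k d) addnC teich_qM; set i := (k %% d)%N.
have id : (i < d)%N by rewrite ltn_mod d_gt0.
apply/negP => h; suff : vge 2 (vK C) by rewrite /Defs.vge (negPf (vK_neq0 C)) ord_vK.
rewrite vK_prod (bigD1 (Ordinal id)) //=; apply: vgeM0 => //.
by apply: vge_prod0 => j _; apply: vgeB (vge0_theta _) (vge0_teichq _).
Qed.

Lemma dif_vge2 k : (0 < k)%N -> ~~ vge 2 (dif C k).
Proof.
move=> k0; apply: contra (theta_teich_vge2 k) => h.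
have -> : theta - eps ^+ (q ^ k) = dif C k + (theta ^+ (q ^ k) - eps ^+ (q ^ k)).
  by rewrite /Defs.theta /dif; ring.
apply: vgeD h _; apply: vge_le (vge1_thetaq k).
rewrite lez_nat (leq_trans (finNzRing_gt1 F)) // -[X in (X <= _)%N]expn1.
by rewrite leq_exp2l // finNzRing_gt1.
Qed.

(** Up to sign, dif k - dif (k - d) is the q^(k-d)-th power of theta^(q^d) - theta, which v
    divides. *)
Lemma mDv_step_cvg k : (d < k)%N -> vge (q ^ (k - d))%:Z (mDv_step C k * dif C (k - d) - dif C (k - d)).
Proof.
move=> dk; rewrite /mDv_step dk leqNgt dk /= divfK ?dif_neq0 ?subn_gt0 //.
rewrite /dif.
have -> : theta - theta ^+ (q ^ k) - (theta - theta ^+ (q ^ (k - d))) =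
   - (theta ^+ qd v - theta) ^+ (q ^ (k - d)).
  by rewrite frobB -exprM /qd -expnD subnKC 1?ltnW //; ring.
by rewrite vgeN; apply: vgeX1 (vge1_frob _ _).
Qed.

(** Dividing the previous estimate by [dif C (k - d)] costs at most one order, by [dif_vge2]. *)
Lemma mDv_step_vge k : (d < k)%N -> vge (q ^ (k - d) - 1)%N%:Z (mDv_step C k - 1).
Proof.
move=> dk; have h := mDv_step_cvg dk; have kd : (0 < k - d)%N by rewrite subn_gt0.
have := dif_neq0 C kd; have := dif_vge2 kd.
rewrite -{2}[dif C _]mul1r -mulrBl in h.
have [->|x0] := eqVneq (mDv_step C k - 1) 0; first by rewrite vge0.
move: h x0; set x := _ - 1; set y := dif C _; set N := (q ^ _)%N => h x0.
rewrite /Defs.vge => /[swap] y0; rewrite (negPf y0) (negPf x0) /=.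
move: h; rewrite /Defs.vge mulf_eq0 (negPf x0) (negPf y0) /= cordM //.
by have := expq_gt0 F (k - d); rewrite -/N -ltNge; lia.
Qed.

Lemma prod_ord_recl (R : comNzRingType) n (f : nat -> R) : (0 < n)%N ->
  \prod_(k < n) f k = f 0%N * \prod_(k < n.-1) f k.+1.
Proof. by case: n => // n _; rewrite big_ord_recl. Qed.

(** A Wilson-type congruence. The factor k = 0 of D_d is v w(theta), so D_{d,v} is w(theta) times
    the product of theta^(q^d) - theta^(q^k) over 0 < k < d; modulo v this becomes w(epsilon)
    v'(epsilon) = -1. *)
Lemma mDv_d : vge 1 (mDv C d - 1).
Proof.
have V1 : (map_poly cst v)^`().[eps] = \prod_(k < d.-1) (eps - eps ^+ (q ^ k.+1)).
  rewrite map_place (prod_ord_recl (fun k => 'X - (eps ^+ (q ^ k))%:P) (d_gt0 v)) expn0 expr1 derivM derivXsubC mul1r.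
  by rewrite !hornerE subrr mul0r addr0 horner_prod; apply: eq_bigr => i _; rewrite !hornerE.
have e1 : ofA (Dv v d) = ofA (cofv v) * \prod_(k < d.-1) (theta ^+ (q ^ d) - theta ^+ (q ^ k.+1)).
  apply: (mulIf (vK_neq0 C)); have := congr1 ofA (Dv_big (leqnn d)).
  rewrite subnn expn0 expr1 !rmorphM /= ofA_carlitz_D [ofA (carlitz_D F 0)]ofA_carlitz_D big_ord0 mulr1 => <-.
  rewrite (prod_ord_recl (fun k => theta ^+ (q ^ d) - theta ^+ (q ^ k)) (d_gt0 v)).
  rewrite expn0 expr1 mulrAC; congr (_ * _).
    by rewrite mulrC /vK -rmorphM -cofvE rmorphB rmorphXn.
have -> : mDv C d - 1 = (map_poly cst v)^`().[eps] * (map_poly cst (cofv v)).[eps] - ofA (Dv v d).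
  by rewrite cofv_teich addrC.
apply: vge_subC; rewrite e1 V1 ofA_horner.
set a := _.[_]; set b := \prod_(k < _) _; set c := \prod_(k < _) _; set a' := _.[_].
have -> : a * b - c * a' = (a - a') * b + a' * (b - c) by ring.
have t1 : vge 1 (theta ^+ (q ^ d) - eps).
  by apply: vge_subT (vge1_theta_teich _); apply: vge1_frob.
have ha : vge 1 (a - a').
  by apply: vge_hornerB; [exact: vge0_theta|exact: vge0_teich|exact: vge1_theta_teich].
have ha' : vge 0 a' by apply/vge_horner_cst/vge0_teich.
apply: vgeD.
  by apply: vgeM0 => //; apply: vge_prod0 => i _; apply: vgeB; apply: vge0_thetaq.
apply: vge0M => //; apply: vge_prodB => i.
- by apply: vgeB; apply: vge0_thetaq.
- by apply: vgeB (vge0_teich _) (vge0_teichq _).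
have R (x y z w : C) : x - y - (z - w) = (x - z) - (y - w) by ring.
rewrite R; apply: vgeB t1 _.
by apply: vge_le (vge1_thetaq _); rewrite lez_nat expq_gt0.
Qed.

(** By [mDvS] the distance of [mDv] to 1 is raised to the q-th power at each step, up to the error
    of [mDv_step], which tends to 0; [mDv_d] starts the induction. *)
Lemma mDv_cvg : vcvg (mDv C) 1.
Proof.
have step n (N M : nat) : (d <= n)%N -> vge 1 (mDv C n - 1) -> vge N%:Z (mDv C n - 1) ->
    (M <= q * N)%N -> (M <= n.+1 - d)%N -> vge M%:Z (mDv C n.+1 - 1).
  move=> dn h1 hN MN Mn; rewrite mDvS.
  have -> : mDv_step C n.+1 * mDv C n ^+ q - 1 =
      (mDv_step C n.+1 - 1) * mDv C n ^+ q + (mDv C n ^+ q - 1) by ring.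
  have n0 : vge 0 (mDv C n) by rewrite -[mDv C n](subrK 1); apply: vgeD (vge1 C); apply: vge_le h1.
  apply: vgeD.
    apply: vgeM0 (vgeX0 _ n0); apply: vge_le (mDv_step_vge _); last by rewrite ltnS.
    by have := expq_lt F (n.+1 - d); lia.
  have -> : mDv C n ^+ q - 1 = (mDv C n - 1) ^+ (q ^ 1) by rewrite frobB expr1n expn1.
  by rewrite expn1; apply: vge_le (vgeX q hN); lia.
have h1 n : (d <= n)%N -> vge 1 (mDv C n - 1).
  elim: n => [|n IH] dn; first by have := d_gt0 v; rewrite ltnNge dn.
  have [dn'|dn'] := leqP d n.
    apply: (step n 1%N 1%N); [exact: dn'|exact: IH|exact: IH| |].
      by rewrite muln1 ltnW // finNzRing_gt1.
    by rewrite subn_gt0 ltnS.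
  have -> : n.+1 = d by apply/eqP; rewrite eqn_leq dn' dn.
  exact: mDv_d.
elim=> [|N [n0 hN]].
  by exists d => n dn; apply: vge_le (h1 n dn).
exists (maxn n0 d + N.+2)%N => [[|n]] hn; first by lia.
have dn : (d <= n)%N by lia.
(* Multiplying the precision by q gains nothing from precision 0, so precision 1 is taken from
   [h1]. *)
have [N0|N0] := posnP N.
  by rewrite N0; apply: h1; lia.
apply: (step n N N.+1) => //; [exact: h1|by apply: hN; lia| |by lia].
by have := finField_gt1 F; nia.
Qed.

End GammaFactors.

(** * Telescoping the products of gamma factors *)

Section GammaRatio.
Variables (F : finFieldType) (v : place F) (C : completion v) (l : nat).
Hypothesis l_gt0 : (0 < l)%N.
Local Notation q := #|F|.
Local Notation d := (size (v : {poly F})).-1.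
Local Notation vcvg := (vcvg (@cord F v C)).

Local Notation cg k n := (k%N == n%N %[mod l])%N.

(** Partial product of a gamma value whose digits are 1 at the indices congruent to n modulo l and 0
    elsewhere. *)
Definition gprod (n M : nat) : C := \prod_(0 <= i < M | cg i (n)) mDv C i.
(** The index 0 is left out because [dif C 0] vanishes. *)
Definition difprod (n M : nat) : C := \prod_(1 <= k < M | cg k (n)) dif C k.

Lemma gprod_cvg n : exists2 L, L != 0 & vcvg (gprod n) L.
Proof.
pose u i := if cg i (n) then mDv C i else 1.
have u0 i : u i != 0 by rewrite /u; case: ifP => _; rewrite ?mDv_neq0 ?oner_neq0.
have u1 : vcvg u 1.
  move=> N; have [n0 h] := mDv_cvg C N; exists n0 => m /h; rewrite /u.
  by case: ifP => // _ _; rewrite subrr vge0.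
have [L L0 hL] := vcvg_prod_neq0 u0 u1; exists L => //.
by apply: vcvg_ext hL => M; rewrite /gprod [RHS]big_mkcond big_mkord.
Qed.

Lemma difprod_neq0 n M : difprod n M != 0.
Proof.
rewrite /difprod big_nat_cond; elim/big_rec: _ => [|k x /andP[/andP[k0 _] _] x0].
  exact: oner_neq0.
by rewrite mulf_neq0 // dif_neq0.
Qed.

Lemma big_nat_recr_cond (R : Type) (idx : R) (op : Monoid.law idx) m n (P : pred nat) (E : nat -> R) :
  (m <= n)%N -> \big[op/idx]_(m <= i < n.+1 | P i) E i =
    op (\big[op/idx]_(m <= i < n | P i) E i) (if P n then E n else idx).
Proof. by move=> mn; rewrite big_mkcond big_nat_recr // -big_mkcond. Qed.

(** Counts the signs in the gamma quotient. The indices are k = s + e - j l with 0 <= k <= e, and j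
    = 0 is allowed only when s = 0. *)
Lemma count_modn s e : (s < l)%N ->
  (\sum_(0 <= k < e.+1 | cg k (s + e)) 1 = (s + e) %/ l + (s == 0))%N.
Proof.
move=> sl; elim: e => [|e IH].
  rewrite addn0 big_mkcond big_nat1 divn_small // mod0n modn_small //.
  by rewrite eq_sym; case: eqP.
rewrite big_mkcond big_nat_recl // -(big_mkcond xpredT) /=.
have -> : (cg 0 (s + e.+1)) = (l %| s + e.+1)%N by rewrite mod0n eq_sym.
rewrite addnS divnS // -addnA -IH; congr (_ + _)%N.
rewrite [RHS]big_mkcond; apply: eq_bigr => k _.
by rewrite -[k.+1]addn1 -[(s + e).+1]addn1 eqn_modDr.
Qed.

(** The recursion [mDvS] is applied at every index k > 0 congruent to s + d; index 0 has no
    predecessor and contributes [mDv C 0], which is -1. *)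
Lemma gprod_step s M :
  gprod (s + d) M.+1 =
  (-1) ^+ (cg 0 (s + d)) *
    (\prod_(1 <= k < M.+1 | cg k (s + d)) mDv_step C k) *
    gprod (s + d - 1) M ^+ q.
Proof.
have d0 := d_gt0 v.
elim: M => [|M IH].
  rewrite /gprod big_mkcond big_nat1 !big_geq // expr1n !mulr1 mDv0.
  by case: (cg 0 _).
rewrite [LHS]big_nat_recr_cond // -/(gprod _ _) IH.
rewrite [X in _ = _ * X * _]big_nat_recr_cond // [X in _ = _ * X ^+ _]/gprod.
rewrite [X in _ = _ * X ^+ _]big_nat_recr_cond //= -/(gprod _ M).
have -> : (cg M (s + d - 1)) = (cg M.+1 (s + d)).
  have {2}-> : (s + d = s + d - 1 + 1)%N by rewrite subnK // addn_gt0 d0 orbT.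
  by rewrite -[in RHS]addn1 eqn_modDr.
case: ifP => _; last by rewrite !mulr1.
by rewrite mDvS exprMn mulrACA !mulrA.
Qed.

(** The denominators dif (k - d) for k > d reindex to the product attached to s; the index k = d,
    which carries v, is congruent to s + d exactly when l divides s. *)
Lemma mDv_step_prod s M : (d <= M)%N ->
  (\prod_(1 <= k < M.+1 | cg k (s + d)) mDv_step C k) *
    (vK C ^+ (l %| s)%N * difprod s (M.+1 - d)) =
  (-1) ^+ (\sum_(1 <= k < d.+1 | cg k (s + d)) 1) * difprod (s + d) M.+1.
Proof.
move=> dM; have d0 := d_gt0 v; rewrite /difprod.
have cat (f : nat -> C) : \prod_(1 <= k < M.+1 | cg k (s + d)) f k =
    \prod_(1 <= k < d.+1 | cg k (s + d)) f k * \prod_(d.+1 <= k < M.+1 | cg k (s + d)) f k.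
  exact: big_cat_nat.
rewrite !cat.
have -> : \prod_(1 <= k < M.+1 - d | cg k (s)) dif C k =
    \prod_(d.+1 <= k < M.+1 | cg k (s + d)) dif C (k - d).
  rewrite -[d.+1]add1n [RHS]big_addn.
  by apply: eq_big => [k|k _]; rewrite ?eqn_modDr ?addnK.
have e1 : \prod_(1 <= k < d.+1 | cg k (s + d)) mDv_step C k * vK C ^+ (l %| s)%N =
    (-1) ^+ (\sum_(1 <= k < d.+1 | cg k (s + d)) 1) *
    \prod_(1 <= k < d.+1 | cg k (s + d)) dif C k.
  rewrite !big_nat_recr_cond //.
  have -> : (cg d (s + d)) = (l %| s)%N.
    by rewrite -{1}[d]add0n eqn_modDr eq_sym mod0n.
  have -> : \prod_(1 <= k < d | cg k (s + d)) mDv_step C k =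
      (-1) ^+ (\sum_(1 <= k < d | cg k (s + d)) 1) *
      \prod_(1 <= k < d | cg k (s + d)) dif C k.
    rewrite -prodrXr -big_split /= big_nat_cond [RHS]big_nat_cond.
    apply: eq_bigr => k /andP[/andP[_ kd] _].
    by rewrite /mDv_step ltnW // ltnNge ltnW // (ltn_eqF kd) divr1 mulN1r.
  case: (l %| s)%N; rewrite /=; last by rewrite !mulr1 addn0.
  rewrite {1}/mDv_step leqnn ltnn eqxx expr1 addn1 exprSr -!mulrA; congr (_ * _).
  by rewrite mulVf ?vK_neq0 // mulr1 mulrN mulN1r.
have e2 : \prod_(d.+1 <= k < M.+1 | cg k (s + d)) mDv_step C k *
    \prod_(d.+1 <= k < M.+1 | cg k (s + d)) dif C (k - d) =
    \prod_(d.+1 <= k < M.+1 | cg k (s + d)) dif C k.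
  rewrite -big_split /= big_nat_cond [RHS]big_nat_cond.
  apply: eq_bigr => k /andP[/andP[dk _] _].
  by rewrite /mDv_step dk leqNgt dk /= divfK // dif_neq0 // subn_gt0.
by rewrite mulrACA e1 e2 mulrA.
Qed.

Lemma gprod_ratio s s0 n' M : (s < l)%N -> (s0 < l)%N -> (s + d = s0 + n' * l)%N ->
  (d <= M)%N ->
  gprod (s + d) M.+1 * (vK C ^+ (s == 0%N) * difprod s (M.+1 - d)) =
  (-1) ^+ (n' + (s == 0%N)) * difprod (s + d) M.+1 * gprod (s + d - 1) M ^+ q.
Proof.
move=> sl s0l e dM; rewrite gprod_step.
have ls : (s == 0%N) = (l %| s)%N by rewrite /dvdn modn_small.
rewrite ls.
have := mDv_step_prod s dM; move: (\prod_(1 <= k < M.+1 | _) _) => x hx.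
rewrite mulrAC -[_ * x * _]mulrA hx mulrA -exprD; congr (_ * _ * _); congr (_ ^+ _).
(* The sign from index 0 joins those from 1 <= k <= d, so that [count_modn] applies. *)
have cE : (\sum_(0 <= k < d.+1 | cg k (s + d)) 1 =
    cg 0 (s + d) + \sum_(1 <= k < d.+1 | cg k (s + d)) 1)%N.
  by rewrite big_ltn_cond // add1n; case: (cg 0 _).
rewrite -cE count_modn // e divnDMl // divn_small // add0n; by rewrite ls.
Qed.

End GammaRatio.

(** * The q-adic digits of - q^n / (q^l - 1) *)

Section Digits.
Variables (F : finFieldType).
Local Notation q := #|F|.
Local Notation qadic := (@qadic_digits F).

Lemma qadic_cong (a b : nat) (y y' : rat) :
  coprime q (absz (denq y)) -> coprime q (absz (denq y')) ->
  a%:R + q%:R * y = b%:R + q%:R * y' -> (a = b %[mod q])%N.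
Proof.
move=> cy cy' e.
pose D := denq y * denq y'.
have D0 : D%:~R != 0 :> rat by rewrite intr_eq0 mulf_neq0 ?denq_neq0.
have e1 : (a%:Z - b%:Z) * D = q%:Z * (numq y' * denq y - numq y * denq y').
  apply: (@intr_inj rat); rewrite !(intrM, intrB) /=.
  have d0 : (denq y)%:~R != 0 :> rat by rewrite intr_eq0 denq_neq0.
  have d0' : (denq y')%:~R != 0 :> rat by rewrite intr_eq0 denq_neq0.
  rewrite !numqE -!pmulrn.
  have -> : a%:R = b%:R + q%:R * y' - q%:R * y by rewrite -e; ring.
  by ring.
have : (q%:Z %| (a%:Z - b%:Z) * D)%Z by rewrite e1 dvdz_mulr.
rewrite Gauss_dvdzl; last first.
  by rewrite coprimezE absz_nat abszM coprimeMr cy cy'.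
by rewrite -eqz_mod_dvd => /eqP; rewrite !modz_nat => -[].
Qed.

(** [gamma_ari] chooses a digit sequence; uniqueness lets any exhibited sequence compute its
    value. *)
Lemma qadic_digits_uniq (z : rat) c c' : qadic z c -> qadic z c' -> c = c'.
Proof.
move=> h h'; apply/funext => i; elim/ltn_ind: i => i IH.
have [ci [_ _]] := h i; have [c'i [_ _]] := h' i.
have [_ [y [cy ey]]] := h i.+1; have [_ [y' [cy' ey']]] := h' i.+1.
have qi0 : (q ^ i)%:R != 0 :> rat by rewrite pnatr_eq0 -lt0n expq_gt0.
suff : (c i = c' i %[mod q])%N by rewrite !modn_small.
apply: (qadic_cong cy cy'); apply: (mulfI qi0).
move: ey'; rewrite {}ey !big_ord_recr /= expnSr !natrM.
have -> : \sum_(j < i) (c' j * q ^ j)%:R = \sum_(j < i) (c j * q ^ j)%:R :> rat.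
  by apply: eq_bigr => j _; rewrite IH.
rewrite -!addrA => /addrI; rewrite !mulrDr !mulrA.
by rewrite ![(q ^ i)%:R * (_ : nat)%:R]mulrC.
Qed.

Variable l : nat.
Hypothesis l_gt0 : (0 < l)%N.
Local Notation Q := ((q ^ l)%:R - 1 : rat).

(** The denominator divides q^l - 1, which is prime to q. *)
Lemma coprime_denq (y : rat) : (exists n : int, y * Q = n%:~R) -> coprime q (absz (denq y)).
Proof.
move=> [n e].
have e1 : numq y * ((q ^ l)%:Z - 1) = n * denq y.
  apply: (@intr_inj rat); rewrite !(intrM, intrB) /= numqE -e -!pmulrn.
  by ring.
have : (denq y %| numq y * ((q ^ l)%:Z - 1))%Z by rewrite e1 dvdz_mull.
rewrite Gauss_dvdzr; last by rewrite coprimezE coprime_sym coprime_num_den.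
rewrite dvdzE => /coprime_dvdr; apply.
have -> : absz ((q ^ l)%:Z - 1) = (q ^ l).-1 by have := expq_gt0 F l; lia.
by rewrite -(coprime_pexpl _ _ l_gt0) coprimenP // expq_gt0.
Qed.

(* After i digits, the remainder of - q^n / (q^l - 1) is q^i times
   - q^(offset n i) / (q^l - 1). *)
Definition offset (n i : nat) : nat := iter i (fun m => if m == 0%N then l.-1 else m.-1) n.

Lemma offset_ltn n i : (n < l)%N -> (offset n i < l)%N.
Proof. by move=> nl; elim: i => //= i IH; case: eqP => _; lia. Qed.

Lemma offset_eq0 n i : (n < l)%N -> (offset n i == 0%N) = (i == n %[mod l])%N.
Proof.
move=> nl.
have E : (offset n i + i = n %[mod l])%N.
  elim: i => [|i IH]; first by rewrite addn0.
  rewrite -IH /= -/(offset n i); case: eqP => h; last by congr (_ %% _)%N; lia.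
  by rewrite h add0n addnS -addSn prednK // modnDl.
rewrite -E -{2}[i]add0n eqn_modDr mod0n modn_small ?offset_ltn //.
Qed.

(** The geometric series - q^n / (q^l - 1) = sum of q^(n + j l) over j >= 0, read digit by digit. *)
Lemma qadic_frac n : (n < l)%N -> ~~ ((q == 2) && (l == 1%N)) ->
  qadic (- ((q ^ n)%:R / Q)) (fun i => (i == n %[mod l])%N : nat).
Proof.
move=> nl ql i; split.
  by apply: (@leq_ltn_trans 1); [case: (_ == _)|exact: finField_gt1].
have Q0 : Q != 0.
  rewrite subr_eq0 -[1]/(1%:R) eqr_nat -(expn0 q) eqn_exp2l ?finField_gt1 //.
  by rewrite -lt0n.
exists (- ((q ^ offset n i)%:R / Q)); split.
  apply: coprime_denq; exists (- (q ^ offset n i)%:Z).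
  by rewrite mulNr divfK // rmorphN.
elim: i => [|i IH]; first by rewrite big_ord0 expn0 mul1r add0r.
rewrite big_ord_recr /= IH -addrA; congr (_ + _).
rewrite -offset_eq0 // -/(offset n i).
(* At offset 0 a digit 1 is split off: -1/(q^l - 1) = 1 - q q^(l-1)/(q^l - 1). Otherwise a factor q
   merely moves from the numerator into q^(i+1). *)
case: eqP => [->|/eqP h]; rewrite /= ?mul1n ?mul0n ?add0r.
  rewrite expn0 expnSr !natrM.
  have -> : (q ^ l)%:R = q%:R * (q ^ l.-1)%:R :> rat by rewrite -natrM -expnS prednK.
  have : q%:R * (q ^ l.-1)%:R - 1 != 0 :> rat by rewrite -natrM -expnS prednK.
  by move: (q ^ i)%:R (q ^ l.-1)%:R q%:R => x y z h; field.
rewrite expnSr !natrM !mulrN -[_ * q%:R * _]mulrA; congr (- (_ * _)).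
by rewrite mulrA -natrM -expnS prednK // lt0n.
Qed.

(** Reducing e modulo l to a subtracts the integer q^a (1 + q^l + ...). The rest q^a / (q^l - 1) is
    below 1, except that it equals 1 for q = 2 and l = 1. *)
Lemma ratfrac_geom e : ~~ ((q == 2) && (l == 1%N)) ->
  ratfrac ((q ^ e)%:R / Q) = (q ^ (e %% l))%:R / Q.
Proof.
move=> ql; set a := (e %% l)%N; have al : (a < l)%N by rewrite ltn_mod.
pose K := (q ^ a * \sum_(i < e %/ l) (q ^ l) ^ i)%N.
have Q0 : 0 < Q by rewrite subr_gt0 -[1]/(1%:R) ltr_nat -(expn0 q) ltn_exp2l ?finField_gt1.
have E : (q ^ e)%:R / Q = K%:R + (q ^ a)%:R / Q.
  apply: (mulIf (lt0r_neq0 Q0)); rewrite divfK ?lt0r_neq0 // mulrDl divfK ?lt0r_neq0 //.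
  rewrite (divn_eq e l) -/a expnD mulnC [(_ %/ _ * _)%N]mulnC expnM.
  have := subrX1 ((q ^ l)%:R : rat) (e %/ l).
  rewrite -natrX => h; rewrite !natrM natr_sum -mulrA [(\sum_(i < _) _) * _]mulrC.
  under eq_bigr do rewrite natrX.
  by rewrite -h mulrBr mulr1 subrK.
have lt1 : (q ^ a)%:R / Q < 1.
  rewrite ltr_pdivrMr // mul1r ltrBrDr natr1 ltr_nat.
  have h1 : (q ^ a <= q ^ l.-1)%N by rewrite leq_exp2l ?finField_gt1 //; lia.
  have h2 : (q ^ l = q * q ^ l.-1)%N by rewrite -expnS prednK.
  have q1 := finField_gt1 F; rewrite {}h2.
  have [q2|q2] := eqVneq q 2; last by nia.
  have l1 : (1 < l)%N by rewrite q2 in ql; lia.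
  have : (q ^ 1 <= q ^ l.-1)%N by rewrite leq_exp2l //; lia.
  by nia.
rewrite /ratfrac E; have -> : Num.floor (K%:R + (q ^ a)%:R / Q) = K%:Z; last first.
  by rewrite -pmulrn addrAC subrr add0r.
apply: floor_def; rewrite intrD -!pmulrn lerDl ltrD2l.
by rewrite divr_ge0 // ltW.
Qed.

End Digits.

(** * Gamma values as limits and their quotient *)

Section GammaValues.
Variables (F : finFieldType) (v : place F) (C : completion v) (l : nat).
Hypothesis l_gt0 : (0 < l)%N.
Local Notation q := #|F|.
Local Notation d := (size (v : {poly F})).-1.
Local Notation vcvg := (vcvg (@cord F v C)).
Local Notation gamma_val e :=
  (gamma_ari C (1 - ratfrac ((q ^ e)%:R / ((q ^ l)%:R - 1)))).

Lemma gamma_ariE x c L : qadic_digits F (x - 1) c ->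
  vcvg (fun n => \prod_(i < n) mDv C i ^+ c i) L -> gamma_ari C x = L.
Proof.
move=> hc hL; rewrite /gamma_ari.
have -> : xget (fun=> 0%N) (qadic_digits F (x - 1)) = c.
  by apply: xget_unique => // c' hc'; apply: qadic_digits_uniq hc' hc.
exact: vlimP.
Qed.

Lemma gamma_ari_cvg e : ~~ ((q == 2) && (l == 1%N)) ->
  gamma_val e != 0 /\ vcvg (gprod C l e) (gamma_val e).
Proof.
move=> ql; have [L L0 hL] := gprod_cvg C l e.
suff -> : gamma_val e = L by [].
have al : (e %% l < l)%N by rewrite ltn_mod.
apply: (gamma_ariE (c := fun i => (i == e %% l %[mod l])%N : nat)).
  rewrite ratfrac_geom // addrAC subrr add0r; exact: qadic_frac.
apply: vcvg_ext hL => n; rewrite /gprod big_mkcond big_mkord; apply: eq_bigr => i _.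
by rewrite modn_mod; case: (_ == _).
Qed.

Lemma gamma_ari_trivial e : q = 2 -> l = 1%N -> gamma_val e = 1.
Proof.
move=> q2 l1; apply: (gamma_ariE (c := fun=> 0%N)); last first.
  by apply: vcvg_ext (vcvg_cst 1) => n; rewrite big1.
have -> : ratfrac ((q ^ e)%:R / ((q ^ l)%:R - 1)) = 0.
  have -> : (q ^ l)%:R - 1 = 1 :> rat by rewrite q2 l1 expn1; ring.
  by rewrite divr1 /ratfrac -[(q ^ e)%:R]/((q ^ e)%:Z%:~R) intrKfloor subrr.
move=> i; split; first exact: ltnW (finField_gt1 F).
exists 0; split; first by rewrite /= coprimen1.
by rewrite big1 => [|j _]; rewrite ?mul0n //; ring.
Qed.

Lemma difprod_mod n m M : (n = m %[mod l])%N -> difprod C l n M = difprod C l m M.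
Proof. by move=> e; apply: eq_bigl => k; rewrite e. Qed.

(** Combining [hX] with [gprod_ratio] cancels the products of [dif], which need not converge; the
    remaining factors all have limits. *)
Lemma gamma_quotient s s0 n' (X : C) (z : nat -> C) :
  (s < l)%N -> (s0 < l)%N -> (s + d = s0 + n' * l)%N -> vcvg z 1 ->
  (forall N, (0 < N)%N ->
     X * difprod C l s (N * d) = z N * difprod C l (s + d) (N.+1 * d)) ->
  X = (-1) ^+ n' * (if s == 0%N then - vK C else 1) *
      (gamma_val (s + d) / gamma_val (s + d - 1) ^+ q).
Proof.
move=> sl s0l e z1 hX; have d0 := d_gt0 v.
(* For q = 2 and l = 1 the fractional parts are 0 instead of 1, so that the digits below
   are not those of gamma_ari_cvg; both gamma values are 1 and X is the limit of the
   product of theta - theta^(q^k) over N d <= k < (N + 1) d, which is v. *)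
have [/andP[/eqP q2 /eqP l1]|ql] := boolP ((q == 2) && (l == 1%N)).
  have N1 : -1 = 1 :> C.
    by have := frobN (C := C) 1 1; rewrite !expr1n expn1 q2 sqrrN expr1n => <-.
  have cE n M : difprod C l n M = \prod_(1 <= k < M) dif C k.
    by apply: eq_bigl => k; rewrite l1 !modn1 eqxx.
  have XE N : X = z N.+1 * \prod_(i < d) dif C (i + N.+1 * d).
    have := hX N.+1 isT; have := difprod_neq0 C l s (N.+1 * d).
    rewrite !cE (@big_cat_nat _ _ _ (N.+1 * d) 1 (N.+2 * d)) /=; last 2 first.
    - by rewrite muln_gt0 d0.
    - by rewrite leq_mul2r leqnSn orbT.
    have -> : \prod_(N.+1 * d <= k < N.+2 * d) dif C k = \prod_(i < d) dif C (i + N.+1 * d).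
      by rewrite -{1}[(N.+1 * d)%N]add0n big_addn -mulnBl subSnn mul1n big_mkord.
    by move=> a0; rewrite mulrCA [RHS]mulrC => /(mulIf a0).
  have -> : X = vK C.
    rewrite vK_prod -[RHS]mul1r.
    have lim : vcvg (fun N => z N.+1 * \prod_(i < d) dif C (i + N.+1 * d))
        (1 * \prod_(i < d) (theta C - teich C ^+ (q ^ i))).
      apply: vcvgM; first by apply: vcvg_ext (vcvg_shift 1 z1) => n; rewrite addn1.
      apply: vcvg_prod => i _; apply: vcvgB (vcvg_cst _) _.
      apply: vcvg_ext (vcvgX (q ^ i) (vcvg_shift 1 (teich_cvg C))) => n.
      by rewrite addn1 qd_expn -exprM -expnD addnC mulnC.
    by apply: vcvg_unique lim; apply: vcvg_ext (vcvg_cst X).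
  rewrite !gamma_ari_trivial // expr1n divr1 mulr1 N1 expr1n mul1r.
  have -> : s = 0%N by lia.
  by rewrite /= -mulN1r N1 mul1r.
have [g1 cg1] := gamma_ari_cvg (s + d) ql; have [g2 cg2] := gamma_ari_cvg (s + d - 1) ql.
(* Y carries the sign of [gprod_ratio]; its part depending on s = 0 is what turns v into - v at the
   end. *)
set Y := (-1) ^+ (n' + (s == 0%N)) * X.
(* With M + 1 = (N + 2) d in [gprod_ratio], the cutoff M + 1 - d is (N + 1) d, that of [hX] at N +
   1. *)
have sub N : (N <= N.+2 * d)%N by rewrite (leq_trans _ (leq_pmulr _ d0)) // ltnW.
have sub' N : (N <= (N.+2 * d).-1)%N.
  by rewrite -ltnS prednK ?muln_gt0 // (leq_trans _ (leq_pmulr _ d0)).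
have lim1 := vcvgM (vcvgM (vcvg_shift 1 z1) (vcvg_sub sub cg1)) (vcvg_cst (vK C ^+ (s == 0%N))).
have lim2 := vcvgM (vcvg_cst Y) (vcvgX q (vcvg_sub sub' cg2)).
rewrite mul1r in lim1.
have E : gamma_val (s + d) * vK C ^+ (s == 0%N) = Y * gamma_val (s + d - 1) ^+ q.
  apply: vcvg_unique lim1 _; apply: vcvg_ext lim2 => N /=; rewrite /Y addn1.
  have dM : (d <= (N.+2 * d).-1)%N.
    by rewrite -ltnS (@prednK (N.+2 * d)) ?muln_gt0 // ltn_Pmull.
  have := gprod_ratio C l_gt0 sl s0l e dM.
  have -> : ((N.+2 * d).-1.+1 = N.+2 * d)%N by rewrite prednK // muln_gt0.
  have -> : (N.+2 * d - d = N.+1 * d)%N by rewrite mulSn addKn.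
  have := hX N.+1 isT; have := difprod_neq0 C l s (N.+1 * d).
  set a := difprod _ _ _ _; set b := difprod _ _ _ _.
  move: (gprod _ _ _ _) (gprod _ _ _ _ ^+ q) (vK C ^+ _) ((-1) ^+ _) (z _) => g h w sg y a0 e1 e2.
  apply: (mulIf a0); transitivity (sg * (X * a) * h); first by ring.
  rewrite e1; transitivity (y * (sg * b * h)); first by ring.
  by rewrite -e2; ring.
apply: (mulIf (expf_neq0 q g2)); rewrite -[RHS]mulrA divfK ?expf_neq0 //.
apply: (@mulfI _ ((-1) ^+ (n' + (s == 0%N)))); first by rewrite signr_eq0.
rewrite mulrA -/Y -E exprD; move: (gamma_val (s + d)) => g.
have := sqrr_sign C n'; move: ((-1) ^+ n') => a /= aa.
by case: (s == 0%N) => /=; rewrite ?expr1 ?expr0 -[g in LHS]mul1r -{1}aa; ring.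
Qed.

End GammaValues.

(** * Series in T_v and their evaluation at v *)

Section BilateralSums.
Variables (F : finFieldType) (v : place F) (C : completion v).
Local Notation ord := (@cord F v C).
Local Notation vge := (vge ord).
Implicit Types a b : int -> C.

Lemma eq_zsum a b : a =1 b -> zsum a = zsum b.
Proof. by move=> ab; congr zsum; apply/funext. Qed.

Lemma zsum0 a : (forall i, a i = 0) -> zsum a = 0.
Proof.
move=> a0; apply: vlimP; apply: vcvg_ext (vcvg_cst 0) => n.
by rewrite /psum big1.
Qed.

Lemma zsumD a b : summable a -> summable b ->
  zsum (fun i => a i + b i) = zsum a + zsum b.
Proof.
move=> sa sb; apply: vlimP; apply: vcvg_ext (vcvgD (zsum_cvg sa) (zsum_cvg sb)) => n.
by rewrite /psum big_split.
Qed.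

Lemma zsumZ c a : summable a -> zsum (fun i => c * a i) = c * zsum a.
Proof.
move=> sa; apply: vlimP; apply: vcvg_ext (vcvgM (vcvg_cst c) (zsum_cvg sa)) => n.
by rewrite /psum mulr_sumr.
Qed.

Lemma zsum_single a k : (forall i, i != k -> a i = 0) -> zsum a = a k.
Proof.
move=> h; have sa : summable a.
  move=> N; exists (absz k).+1 => i hi; rewrite h ?vge0 //; lia.
apply: vge_eq => N; have := zsum_window (N := N) (lo := k) (len := 1) sa.
rewrite big_ord_recl big_ord0 /= !addr0; apply=> i hi.
by rewrite h ?vge0 //; lia.
Qed.

Lemma summable_bounded a : summable a -> exists K : nat, forall i, vge (- K%:Z) (a i).
Proof.
move=> sa; have [M hM] := sa 0%N.
exists (\sum_(i < M.*2) absz (ord (a (i%:Z - M%:Z)%R)))%N => i.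
have [hi|hi] := leqP M (absz i); first by apply: vge_le (hM i hi); lia.
have jM : (absz (i + M%:Z)%R < M.*2)%N by lia.
rewrite (bigD1 (Ordinal jM)) //=.
have -> : (absz (i + M%:Z))%:Z - M%:Z = i by lia.
apply: vge_le (vge_nord (a i)); lia.
Qed.

Section Convolution.
Variables (a b : int -> C).
Hypotheses (sa : summable a) (sb : summable b).

Lemma summable_conv n : summable (fun i => a i * b (n - i)).
Proof.
have [K bK] := summable_bounded sb => N; have [M hM] := sa (N + K)%N; exists M => i hi.
by apply: vge_le (vgeM (hM i hi) (bK _)); lia.
Qed.

Lemma conv_small (N : nat) : exists M, forall i n : int,
  (M <= `|i|)%N || (M <= `|(n - i)%R|)%N -> vge N%:Z (a i * b (n - i)).
Proof.
have [K aK] := summable_bounded sa; have [L bL] := summable_bounded sb.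
have [M hM] := sa (N + L)%N; have [M' hM'] := sb (N + K)%N.
exists (M + M')%N => i n /orP[h|h].
  by apply: vge_le (vgeM (hM i _) (bL _)); lia.
by apply: vge_le (vgeM (aK _) (hM' (n - i) _)); lia.
Qed.

Lemma conv_summable : summable (fun n => zsum (fun i => a i * b (n - i))).
Proof.
move=> N; have [M hM] := conv_small N; exists M.*2 => n hn.
apply: zsum_ge => [|i]; first exact: summable_conv.
by apply: hM; lia.
Qed.

(** The Cauchy product. To any given precision both sides are finite sums, compared after exchanging
    the order of summation. *)
Lemma zsum_conv : zsum (fun n => zsum (fun i => a i * b (n - i))) = zsum a * zsum b.
Proof.
apply: vge_eq => N; have [K aK] := summable_bounded sa; have [L bL] := summable_bounded sb.
have [M0 hM0] := conv_small N.
have [M1 hM1] := sa (N + L)%N; have [M2 hM2] := sb (N + K)%N.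
pose M := (M0 + M1 + M2)%N.
pose H n := zsum (fun i => a i * b (n - i)).
have H1 : vge N%:Z (zsum H - psum H M.*2).
  apply: zsum_approx; first exact: conv_summable.
  move=> n hn; apply: zsum_ge => [|i]; first exact: summable_conv.
  by apply: hM0; lia.
apply: vge_subT H1 _.
(* The window of n is twice that of i, so for every i in its window the values n - i still cover the
   range outside which b is negligible. *)
have H2 : vge N%:Z (psum H M.*2 - \sum_(n < M.*2.*2) \sum_(i < M.*2)
   a (i%:Z - M%:Z) * b (n%:Z - M.*2%:Z - (i%:Z - M%:Z))).
  rewrite /psum -sumrB; apply: vge_sum => n _.
  apply: zsum_approx => [|i hi]; first exact: summable_conv.
  by apply: hM0; lia.
apply: vge_subT H2 _; rewrite exchange_big /=.
have H3 : vge N%:Z (\sum_(i < M.*2) \sum_(n < M.*2.*2)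
   a (i%:Z - M%:Z) * b (n%:Z - M.*2%:Z - (i%:Z - M%:Z)) - psum a M * zsum b).
  rewrite /psum mulr_suml -sumrB; apply: vge_sum => i _.
  rewrite -mulr_sumr -mulrBr; set k := i%:Z - M%:Z.
  have kM : (k < M%:Z) && (- M%:Z <= k) by have := ltn_ord i; lia.
  have h : vge (N + K)%N (zsum b - \sum_(n < M.*2.*2) b (- M.*2%:Z - k + n%:Z)).
    by apply: zsum_window => // j hj; apply: hM2; lia.
  have -> : \sum_(n < M.*2.*2) b (n%:Z - M.*2%:Z - k) = \sum_(n < M.*2.*2) b (- M.*2%:Z - k + n%:Z).
    by apply: eq_bigr => n _; congr b; lia.
  by apply: vge_le (vgeM (aK _) (vge_subC h)); lia.
apply: vge_subT H3 _; rewrite -mulrBl.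
have h : vge (N + L)%N (psum a M - zsum a).
  by apply: vge_subC; apply: zsum_approx => // i hi; apply: hM1; lia.
apply: vge_le (vgeM h (_ : vge (- L%:Z) (zsum b))); first by lia.
exact: zsum_ge.
Qed.

End Convolution.
End BilateralSums.

(** * Evaluation at T_v = v as a ring morphism *)

Section Evaluation.
Variables (F : finFieldType) (v : place F) (C : completion v).
Local Notation ord := (@cord F v C).
Local Notation vge := (vge ord).
Local Notation S := (annser C).
Local Notation vK := (vK C).
Implicit Types f g : S.

Definition evS f : C := zsum (fun i => f i * vK ^ i).

Lemma taylor0 f : taylor f 0%N = evS f.
Proof.
apply: eq_zsum => i; rewrite subr0; congr (_ * _).
have -> : binz i 0 = 1 by case: i => m; rewrite /= ?bin0 ?expr0.
by rewrite mul1r.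
Qed.

Lemma ord_vKz (i : int) : ord (vK ^ i) = i.
Proof.
case: i => n; first by rewrite -exprnP ord_vKX.
by rewrite NegzE -exprnN cordV ?ord_vKX ?expf_neq0 ?vK_neq0.
Qed.

Lemma vge_vKz (i : int) : vge i (vK ^ i).
Proof. by rewrite /Defs.vge ord_vKz lexx orbT. Qed.

(** For i < 0 a decay of slope 2 outweighs the pole of order |i| of v^i. *)
Lemma summable_evS f : summable (fun i => f i * vK ^ i).
Proof.
move=> N; have [m0 h0] := a_super f 2; exists (m0 + N)%N => i hi.
case: (leP 0 i) => i0.
  by apply: vge_le (vgeM (acoef_int f i) (vge_vKz i)); lia.
have e : i = - (absz i)%:Z by lia.
have h := h0 (absz i) ltac:(lia); rewrite -e in h.
by apply: vge_le (vgeM h (vge_vKz i)); lia.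
Qed.

Fact evS_zmod : zmod_morphism evS.
Proof.
have D f g : evS (f + g) = evS f + evS g.
  rewrite /evS -zsumD; try exact: summable_evS.
  by apply: eq_zsum => i; rewrite acoefD mulrDl.
by move=> f g; apply: (addIr (evS g)); rewrite -D !subrK.
Qed.
Fact evS_monoid : monoid_morphism evS.
Proof.
split=> [|f g].
  rewrite /evS (@zsum_single _ _ _ _ 0) /= /amon_fun ?eqxx ?expr0z ?mulr1 // => i i0.
  by rewrite (negPf i0) mul0r.
rewrite /evS -zsum_conv; try exact: summable_evS.
apply: eq_zsum => n; rewrite acoefM mulrC -zsumZ; last exact: aconv_summable.
apply: eq_zsum => i; rewrite mulrACA -expfzDr ?vK_neq0 //.
by rewrite mulrC subrKC.
Qed.
HB.instance Definition _ := GRing.isZmodMorphism.Build _ _ evS evS_zmod.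
HB.instance Definition _ := GRing.isMonoidMorphism.Build _ _ evS evS_monoid.

Lemma evS_cst c : vge 0 c -> evS (acst c) = c.
Proof.
move=> c0; rewrite /evS (@zsum_single _ _ _ _ 0) /= /acst_fun; last first.
  by move=> i /negPf->; rewrite mul0r.
by rewrite eqxx c0 expr0z mulr1.
Qed.

Lemma evS_mon k : evS (amon C k) = vK ^ k.
Proof.
rewrite /evS (@zsum_single _ _ _ _ k) /= /amon_fun ?eqxx ?mul1r // => i /negPf->.
by rewrite mul0r.
Qed.

End Evaluation.

(** * The T_v-adic order and the series t(T_v) *)

Section Series.
Variables (F : finFieldType) (v : place F) (C : completion v).
Local Notation q := #|F|.
Local Notation d := (size (v : {poly F})).-1.
Local Notation ord := (@cord F v C).
Local Notation vge := (vge ord).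
Local Notation S := (annser C).
Local Notation vK := (vK C).
Local Notation theta := (theta C).
Local Notation eps := (teich C).
Implicit Types f g h : S.

Lemma acst_coef (c : C) i : vge 0 c -> (acst c : S) i = if i == 0 then c else 0.
Proof. by move=> c0; rewrite /= /acst_fun c0 andbT. Qed.

Lemma acstB (c e : C) : vge 0 c -> vge 0 e -> acst (c - e) = acst c - acst e :> S.
Proof.
move=> c0 e0; apply: annserP => i; rewrite acoefD acoefN !acst_coef ?vgeB //.
by case: eqP => _ //; rewrite subrr.
Qed.

Lemma acstD (c e : C) : vge 0 c -> vge 0 e -> acst (c + e) = acst c + acst e :> S.
Proof.
move=> c0 e0; apply: annserP => i; rewrite acoefD !acst_coef ?vgeD //.
by case: eqP => _ //; rewrite addr0.
Qed.

Lemma acst1 : acst (1 : C) = 1 :> S.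
Proof.
apply: annserP => i; rewrite acst_coef ?vge1 //= /amon_fun.
by case: eqP.
Qed.

Lemma acst0 : acst (0 : C) = 0 :> S.
Proof. by apply: annserP => i; rewrite acst_coef ?vge0 // if_same. Qed.

Lemma acstM (c e : C) : vge 0 c -> vge 0 e -> acst (c * e) = acst c * acst e :> S.
Proof.
move=> c0 e0; apply: annserP => i; rewrite acoef_cstM // !acst_coef ?vgeM0 //.
by case: eqP => _ //; rewrite mulr0.
Qed.

Lemma acstX (c : C) n : vge 0 c -> acst (c ^+ n) = acst c ^+ n :> S.
Proof.
move=> c0; elim: n => [|n IH]; first by rewrite !expr0 acst1.
by rewrite !exprS acstM ?IH // vgeX0.
Qed.

Definition cstS (a : F) : S := acst (cstC C a).
Fact cstS_zmod : zmod_morphism cstS.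
Proof. by move=> a b; rewrite /cstS rmorphB acstB ?vge0_cst. Qed.
Fact cstS_monoid : monoid_morphism cstS.
Proof.
by split=> [|a b]; rewrite /cstS ?rmorph1 ?acst1 // rmorphM /= acstM ?vge0_cst.
Qed.
HB.instance Definition _ := GRing.isZmodMorphism.Build _ _ cstS cstS_zmod.
HB.instance Definition _ := GRing.isMonoidMorphism.Build _ _ cstS cstS_monoid.

Lemma evS_horner (p : {poly F}) f :
  evS (map_poly cstS p).[f] = (map_poly (@cstC F v C) p).[evS f].
Proof.
rewrite -horner_map -map_poly_comp; congr (_.[_]); apply: eq_map_poly => a /=.
by rewrite evS_cst ?vge0_cst.
Qed.

Definition Tge (k : int) f := forall i : int, i < k -> f i = 0.

Lemma Tge_le k m f : m <= k -> Tge k f -> Tge m f.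
Proof. by move=> mk h i im; apply: h; apply: lt_le_trans mk. Qed.

Lemma TgeD k f g : Tge k f -> Tge k g -> Tge k (f + g).
Proof. by move=> hf hg i ik; rewrite acoefD hf ?hg ?addr0. Qed.

Lemma TgeN k f : Tge k f -> Tge k (- f).
Proof. by move=> hf i ik; rewrite acoefN hf ?oppr0. Qed.

Lemma TgeB k f g : Tge k f -> Tge k g -> Tge k (f - g).
Proof. by move=> hf hg; apply: TgeD => //; apply: TgeN. Qed.

Lemma TgeM k m f g : Tge k f -> Tge m g -> Tge (k + m) (f * g).
Proof.
move=> hf hg i ik; rewrite acoefM zsum0 // => j.
have [jk|jk] := ltP j k; first by rewrite hf ?mul0r.
by rewrite hg ?mulr0 //; lia.
Qed.

Lemma Tge0M k f g : Tge 0 f -> Tge k g -> Tge k (f * g).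
Proof. by move=> hf hg; rewrite -[k]add0r; apply: TgeM. Qed.

Lemma TgeX n f : Tge 0 f -> Tge 0 (f ^+ n).
Proof.
move=> hf; elim: n => [|n IH]; last by rewrite exprS; apply: Tge0M.
by rewrite expr0 => i i0; rewrite /= /amon_fun lt_eqF.
Qed.

Lemma Tge_cst c : Tge 0 (acst c).
Proof. by move=> i i0; rewrite /= /acst_fun lt_eqF. Qed.

Lemma Tge_mon k : Tge k (amon C k).
Proof. by move=> i ik; rewrite /= /amon_fun lt_eqF. Qed.

Lemma Tge_hornerB (p : {poly F}) k f g : Tge 0 f -> Tge 0 g -> Tge k (f - g) ->
  Tge k ((map_poly cstS p).[f] - (map_poly cstS p).[g]).
Proof.
move=> f0 g0 fg; elim/poly_ind: p => [|p c IH].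
  by rewrite rmorph0 !horner0 subrr => i _.
rewrite rmorphD rmorphM /= map_polyX map_polyC !hornerMXaddC.
have g1 : Tge 0 (map_poly cstS p).[g].
  elim/poly_ind: p {IH} => [|p e IH]; first by rewrite rmorph0 horner0 => i _.
  rewrite rmorphD rmorphM /= map_polyX map_polyC !hornerMXaddC.
  by apply: TgeD (Tge_cst _); apply: Tge0M.
set a := _.[f] in IH *; set b := _.[g] in IH g1 *.
have -> : a * f + cstS c - (b * g + cstS c) = f * (a - b) + b * (f - g) by ring.
by apply: TgeD; apply: Tge0M.
Qed.

Lemma Tge_inf f : (forall n : nat, Tge n%:Z f) -> f = 0.
Proof. by move=> h; apply: annserP => i; rewrite (h (absz i).+1) //; lia. Qed.

Lemma exprSB (f g : S) : (f - g) ^+ qd v = f ^+ qd v - g ^+ qd v.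
Proof. exact: exprBq cstS d f g. Qed.

Lemma frob_cst a : frob (cstC C a) = cstC C a.
Proof. by rewrite /frob /qd -rmorphXn expf_cardX. Qed.

Lemma atwist_cstS a : atwist (cstS a) = cstS a.
Proof. by rewrite /cstS acst_tw ?vge0_cst // frob_cst. Qed.

Lemma atwist_mon k : atwist (amon C k) = amon C k.
Proof.
by apply: annserP => i; rewrite /= /amon_fun; case: eqP => _; rewrite ?rmorph0 ?rmorph1.
Qed.

Lemma atwist_Fqd f : (forall i, f i \in Fqd C) <-> atwist f = f.
Proof.
split=> [h|h i]; first by apply: annserP => i; apply/eqP; have := h i; rewrite inE.
by have /(congr1 (fun g : S => g i)) e := h; rewrite inE; apply/eqP.
Qed.

Lemma evS_tail f (n : nat) : Tge n%:Z f -> vge n%:Z (evS f).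
Proof.
move=> h; apply: zsum_ge; first exact: summable_evS.
move=> i; have [ik|ik] := ltP i n%:Z; first by rewrite h ?mul0r ?vge0.
by apply: vge_le (vgeM (acoef_int f i) (vge_vKz C i)); rewrite add0r.
Qed.

(* Iterating t |-> t^(q^d) - T_v w(t), where X^(q^d) - X = v w, converges T_v-adically
   to a root of v w - T_v w, hence of v - T_v. *)
Definition tstep f : S := f ^+ qd v - amon C 1 * (map_poly cstS (cofv v)).[f].
Definition tseq n : S := iter n tstep (acst eps).

(** The Frobenius part has order at least 2 k >= k + 1, and the factor T_v raises the order of the
    other part by 1. *)
Lemma tstep_contract (k : int) f g : 1 <= k -> Tge 0 f -> Tge 0 g -> Tge k (f - g) ->
  Tge (k + 1) (tstep f - tstep g).
Proof.
move=> k1 f0 g0 fg; rewrite /tstep.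
set a := _.[f]; set b := _.[g].
have -> : f ^+ qd v - amon C 1 * a - (g ^+ qd v - amon C 1 * b) =
  (f - g) ^+ qd v - amon C 1 * (a - b) by rewrite exprSB; ring.
apply: TgeB; last by rewrite addrC; apply: TgeM (@Tge_mon 1) _; apply: Tge_hornerB.
have -> : qd v = (qd v - 2).+2 by have := qd_gt1 v; lia.
rewrite !exprS mulrA mulrC; apply: Tge0M.
  by apply: TgeX; apply: Tge_le fg; lia.
by apply: Tge_le (TgeM fg fg); lia.
Qed.

Lemma Tge0_horner (p : {poly F}) f : Tge 0 f -> Tge 0 (map_poly cstS p).[f].
Proof.
move=> f0; elim/poly_ind: p => [|p e IH]; first by rewrite rmorph0 horner0 => i _.
rewrite rmorphD rmorphM /= map_polyX map_polyC !hornerMXaddC.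
by apply: TgeD (@Tge_cst _); apply: Tge0M.
Qed.

Lemma Tge0_tseq n : Tge 0 (tseq n).
Proof.
elim: n => [|n IH]; first exact: Tge_cst.
apply: TgeB; first exact: TgeX.
by apply: Tge0M; [apply: Tge_le (@Tge_mon 1)|exact: Tge0_horner].
Qed.

(** Since epsilon^(q^d) = epsilon, the first step changes only the part divisible by T_v;
    contraction does the rest. *)
Lemma tseqS n : Tge n.+1%:Z (tseq n.+1 - tseq n).
Proof.
elim: n => [|n IH].
  rewrite /tseq /= /tstep -acstX ?vge0_teich // teich_qd addrAC subrr add0r.
  by apply: TgeN; rewrite -[1%:Z]addr0; apply: TgeM (@Tge_mon 1) _; apply: Tge0_horner (@Tge_cst _).
have -> : n.+2%:Z = n.+1%:Z + 1 by lia.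
by apply: (@tstep_contract _ (tseq n.+1) (tseq n));
  [lia|exact: Tge0_tseq|exact: Tge0_tseq|exact: IH].
Qed.

Lemma tseq_stable n m : (n <= m)%N -> Tge n.+1%:Z (tseq m - tseq n).
Proof.
move=> nm; rewrite -(subnKC nm); elim: (m - n)%N => [|k IH].
  by rewrite addn0 subrr => i _.
rewrite addnS -[tseq _](subrK (tseq (n + k))) -addrA; apply: TgeD => //.
by apply: Tge_le (@tseqS _); lia.
Qed.

(** By [tseq_stable] the coefficient of T_v^i no longer changes after the i-th iterate. *)
Definition tlim_fun (i : int) : C := tseq (absz i) i.
Fact tlim_int i : vge 0 (tlim_fun i). Proof. exact: acoef_int. Qed.
Fact tlim_super : superlin tlim_fun.
Proof. by apply: (@super_cst0 _ _ _ _ 0%N) => i i0; apply: Tge0_tseq. Qed.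
Definition tlim : S := Annser tlim_int ((decayP _).1 tlim_super).

Lemma tlim_tseq n : Tge n.+1%:Z (tlim - tseq n).
Proof.
move=> i hi; rewrite acoefD acoefN /= /tlim_fun.
have [i0|i0] := ltP i 0; first by rewrite !Tge0_tseq // subrr.
have := @tseq_stable (absz i) n ltac:(lia) i ltac:(lia).
by rewrite acoefD acoefN => /subr0_eq->; rewrite subrr.
Qed.

Lemma tlim_Tge0 : Tge 0 tlim.
Proof. by move=> i i0; apply: Tge0_tseq. Qed.

Lemma tlim_fixed : tstep tlim = tlim.
Proof.
apply/eqP; rewrite -subr_eq0; apply/eqP/Tge_inf => n.
have -> : tstep tlim - tlim = tstep tlim - tstep (tseq n) - (tlim - tseq n.+1).
  by rewrite /tseq /=; ring.
apply: TgeB; last by apply: Tge_le (@tlim_tseq _); lia.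
apply: Tge_le (tstep_contract (k := n.+1%:Z) _ tlim_Tge0 (@Tge0_tseq _) (@tlim_tseq _)); lia.
Qed.

Lemma horner_acst (p : {poly F}) (x : C) : vge 0 x ->
  (map_poly cstS p).[acst x] = acst (map_poly (@cstC F v C) p).[x].
Proof.
move=> x0; elim/poly_ind: p => [|p e IH]; first by rewrite !rmorph0 !horner0 acst0.
rewrite !rmorphD !rmorphM /= !map_polyX !map_polyC !hornerMXaddC IH.
by rewrite acstD ?acstM ?vge0_cst ?vgeM0 ?vge_horner_cst.
Qed.

(** The fixed point satisfies v(t) w(t) = T_v w(t) in a domain, and w(t) is nonzero because its
    constant term w(epsilon) is, by [cofv_teich]. *)
Lemma place_tlim : (map_poly cstS v).[tlim] = amon C 1.
Proof.
have w0 : (map_poly cstS (cofv v)).[tlim] != 0.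
  apply/eqP => w0; have := Tge_hornerB (cofv v) (k := 1) tlim_Tge0 (@Tge_cst eps).
  have te : Tge 1 (tlim - acst eps) by exact: (@tlim_tseq 0%N).
  move=> /(_ te) /(_ 0 isT); rewrite w0 sub0r acoefN horner_acst ?vge0_teich //.
  rewrite acst_coef ?vge_horner_cst ?vge0_teich //= => /eqP; rewrite oppr_eq0 => /eqP e.
  by have /eqP := cofv_teich C; rewrite e mulr0 eq_sym oppr_eq0 oner_eq0.
apply: (mulIf w0); rewrite -[LHS]hornerM -rmorphM -cofvE rmorphB /= map_polyXn map_polyX.
rewrite hornerD hornerN hornerXn hornerX.
apply/eqP; rewrite subr_eq addrC -subr_eq; apply/eqP; exact: tlim_fixed.
Qed.

Lemma atwist_horner (p : {poly F}) f :
  atwist (map_poly cstS p).[f] = (map_poly cstS p).[atwist f].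
Proof.
rewrite -horner_map -map_poly_comp; congr (_.[_]); apply: eq_map_poly => a /=.
exact: atwist_cstS.
Qed.

Lemma atwist_tlim : atwist tlim = tlim.
Proof.
have h n : atwist (tseq n) = tseq n.
  elim: n => [|n IH]; first by rewrite /tseq /= acst_tw ?vge0_teich // /frob teich_qd.
  by rewrite /tseq /= /tstep rmorphB rmorphXn rmorphM /= atwist_mon atwist_horner IH.
by apply: annserP => i; have /(congr1 (fun g : S => g i)) := h (absz i).
Qed.

(** The series [tlim] shows that the choice defining [tT] does not fall back on its default. *)
Lemma tT_spec : [/\ Tge 0 (tT C), atwist (tT C) = tT C, tT C 0 = eps &
  (map_poly cstS v).[tT C] = amon C 1].
Proof.
have := @xgetPex _ 0 [set f : S | [/\ forall i : int, i < 0 -> f i = 0,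
     forall i : int, f i \in Fqd C, f 0 = teich C &
     (map_poly (fun a : F => acst (ofA C a%:P)) v).[f] = amon C 1]]%classic.
rewrite -/(tT C) /= => -[].
  exists tlim; split; [exact: tlim_Tge0|exact/atwist_Fqd/atwist_tlim| |exact: place_tlim].
  by rewrite /= /tlim_fun /tseq /= /acst_fun eqxx vge0_teich.
by move=> h1 /atwist_Fqd h2 h3 h4; split.
Qed.

Lemma atwist_tT : atwist (tT C) = tT C. Proof. by case: tT_spec. Qed.

(** A uniqueness of Hensel type: x and theta are both congruent to epsilon and both solve v(y) = v.
    Their difference D satisfies D = D^(q^d) - v (w(x) - w(theta)), where the right side has larger
    valuation than D unless D = 0. *)
Lemma evS_tT : evS (tT C) = theta.
Proof.
have [t0 _ t1 tv] := tT_spec; set x := evS _.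
have hx : (map_poly (@cstC F v C) v).[x] = vK by rewrite -evS_horner tv evS_mon expr1z.
have xe : vge 1 (x - eps).
  have -> : x - eps = evS (tT C - acst eps) by rewrite rmorphB /= evS_cst ?vge0_teich.
  apply: (@evS_tail _ 1%N) => i i1; rewrite acoefD acoefN acst_coef ?vge0_teich //.
  case: eqP => [->|/eqP i0]; first by rewrite t1 subrr.
  by rewrite t0 ?subrr //; lia.
have xt : vge 1 (x - theta) by apply: vge_subT xe _; apply: vge_subC; apply: vge1_theta_teich.
have x0 : vge 0 x.
  by rewrite -[x](subrK eps); apply: vgeD (vge0_teich _); apply: vge_le xe.
(* both x and theta satisfy y^(q^d) - y = v w(y) *)
have E (y : C) : (map_poly (@cstC F v C) v).[y] = vK ->
    y ^+ qd v - y = vK * (map_poly (@cstC F v C) (cofv v)).[y].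
  by move=> <-; rewrite -hornerM -rmorphM -cofvE rmorphB /= map_polyXn map_polyX !hornerE.
have tv' : (map_poly (@cstC F v C) v).[theta] = vK by rewrite -ofA_horner.
have e : (x - theta) ^+ qd v - (x - theta) =
   vK * ((map_poly (@cstC F v C) (cofv v)).[x] - (map_poly (@cstC F v C) (cofv v)).[theta]).
  by rewrite mulrBr -!E // /qd frobB; ring.
apply/eqP; rewrite -subr_eq0; apply/negPn/negP => n0.
have h := vge_ord (x - theta); move: h; move oE : (ord (x - theta)) => o h.
have : vge (o + 1) (x - theta).
  have -> : x - theta = (x - theta) ^+ qd v - ((x - theta) ^+ qd v - (x - theta)) by ring.
  apply: vgeB.
    have -> : qd v = (qd v - 2).+2 by have := qd_gt1 v; lia.
    rewrite !exprS mulrA; apply: vgeM0; last by apply: vgeX0; apply: vge_le xt.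
    exact: vgeM.
  rewrite e addrC; apply: vgeM (vge_vK C) _.
  by apply: vge_hornerB => //; exact: vge0_theta.
by rewrite /Defs.vge (negPf n0) oE /=; lia.
Qed.

(** The coefficient lies in F_{q^d}, so if v divided it, it would be 0. Then t would be epsilon
    modulo T_v^2, and v(t) would be v(epsilon) = 0 modulo T_v^2 instead of T_v. Hence t - c is
    primitive for every constant c. *)
Lemma tT1_unit : ~~ vge 1 (tT C 1).
Proof.
have [t0 tw t1 tv] := tT_spec.
apply/negP => h1; have h : tT C 1 = 0.
  have /atwist_Fqd/(_ 1) := tw; rewrite inE => /eqP tq.
  apply: vge_eq0 => N; rewrite -tq; have Nq : (N <= qd v ^ N)%N by apply/ltnW/ltn_expl/qd_gt1.
  have -> : tT C 1 ^+ qd v = tT C 1 ^+ (qd v ^ N).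
    rewrite tq; elim: N {Nq} => [|N IH]; first by rewrite expn0 expr1.
    by rewrite expnS exprM tq.
  exact: (vgeX1 Nq h1).
have t2 : Tge 2 (tT C - acst eps).
  move=> i i2; rewrite acoefD acoefN acst_coef ?vge0_teich //.
  case: eqP => [->|/eqP i0]; first by rewrite t1 subrr.
  have [i1|i1] := ltP i 1; first by rewrite t0 ?subrr //; lia.
  have -> : i = 1 by lia.
  by rewrite h subrr.
have := Tge_hornerB v t0 (@Tge_cst eps) t2; move=> /(_ 1 isT).
rewrite tv horner_acst ?vge0_teich // root_teich acst0 subr0 /= /amon_fun eqxx.
by move/eqP; rewrite oner_eq0.
Qed.

End Series.

(** * Formal power series over a field *)

Section PowerSeriesField.
Variable K : fieldType.
Implicit Types f g h : powser K.

Lemma pcoefM f g n : (f * g) n = \sum_(i < n.+1) f i * g (n - i)%N. Proof. by []. Qed.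
Lemma pcoefD f g n : (f + g) n = f n + g n. Proof. by []. Qed.
Lemma pcoefN f n : (- f) n = - f n. Proof. by []. Qed.
Lemma pcoef0 n : (0 : powser K) n = 0. Proof. by rewrite /= if_same. Qed.
Lemma pcoef1 n : (1 : powser K) n = (n == 0%N)%:R. Proof. by rewrite /=; case: eqP. Qed.

Definition pcoef_const f : K := f 0%N.
Fact pcoef_const_zmod : zmod_morphism pcoef_const. Proof. by []. Qed.
Fact pcoef_const_monoid : monoid_morphism pcoef_const.
Proof. by split=> [|f g]; rewrite /pcoef_const // pcoefM big_ord1. Qed.
HB.instance Definition _ := GRing.isZmodMorphism.Build _ _ pcoef_const pcoef_const_zmod.
HB.instance Definition _ := GRing.isMonoidMorphism.Build _ _ pcoef_const pcoef_const_monoid.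

Lemma pcoefMX f g n : (f * g ^+ n) 0%N = f 0%N * g 0%N ^+ n.
Proof. by rewrite -[LHS]/(pcoef_const _) rmorphM rmorphXn. Qed.

Fact psC_zmod : zmod_morphism (@psC K).
Proof.
by move=> x y; apply: powserP => i; rewrite pcoefD pcoefN /=; case: eqP => _ //; rewrite subrr.
Qed.
Fact psC_monoid : monoid_morphism (@psC K).
Proof.
split=> // x y; apply: powserP => i; rewrite pcoefM big_ord_recl big1 /= => [|j _].
  by rewrite subn0 addr0; case: eqP; rewrite ?mulr0.
by rewrite mul0r.
Qed.
HB.instance Definition _ := GRing.isZmodMorphism.Build _ _ (@psC K) psC_zmod.
HB.instance Definition _ := GRing.isMonoidMorphism.Build _ _ (@psC K) psC_monoid.

Lemma psXM g n : (psX K * g) n = if n is m.+1 then g m else 0.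
Proof.
rewrite pcoefM; case: n => [|m]; first by rewrite big_ord1 mul0r.
rewrite big_ord_recl mul0r add0r big_ord_recl mul1r subSS subn0 big1 ?addr0 // => i _.
by rewrite mul0r.
Qed.

Lemma psX_div f : f 0%N = 0 -> exists g, f = psX K * g.
Proof.
move=> f0; exists (Powser (fun n => f n.+1)); apply: powserP => n.
by rewrite psXM; case: n.
Qed.

Lemma powser_eq0M f g : f * g = 0 -> f != 0 -> g = 0.
Proof.
move=> fg f0; have exf : exists n, f n != 0.
  apply: contrapT => h; move/eqP: f0; apply; apply: powserP => n; rewrite pcoef0.
  by apply: contrapT => /eqP fn; apply: h; exists n.
case: (ex_minnP exf) => a fa amin.
apply: powserP => n; rewrite pcoef0; elim/ltn_ind: n => n IH.
have := congr1 (fun h : powser K => h (a + n)%N) fg; rewrite pcoefM pcoef0.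
have an : (a < (a + n).+1)%N by rewrite ltnS leq_addr.
rewrite (bigD1 (Ordinal an)) //= addKn big1 ?addr0 => [/eqP|i].
  by rewrite mulf_eq0 (negPf fa) => /eqP.
rewrite -val_eqE /= => ia; have [ilt|ige] := ltnP i a.
  suff -> : f i = 0 by rewrite mul0r.
  by apply: contraTeq ilt => /amin; rewrite -leqNgt.
by rewrite IH ?mulr0 //; have := ltn_ord i; lia.
Qed.

Lemma powser_expr_small h k i : h 0%N = 0 -> (i < k)%N -> (h ^+ k) i = 0.
Proof.
move=> h0; elim: k i => // k IH i ik; rewrite exprS pcoefM big_ord_recl h0 mul0r add0r.
by rewrite big1 // => j _; rewrite IH ?mulr0 //= /bump /=; have := ltn_ord j; lia.
Qed.

(** Geometric series in h = 1 - f / f(0): as h has no constant term, the coefficient of index n is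
    already that of the sum of h^k over k <= n. *)
Lemma powser_inv f : f 0%N != 0 -> exists g, g * f = 1.
Proof.
move=> f0; pose h : powser K := 1 - psC (f 0%N)^-1 * f.
have h0 : h 0%N = 0.
  by rewrite /h pcoefD pcoefN pcoef1 pcoefM big_ord1 /= mulVf // subrr.
have hE : psC (f 0%N)^-1 * f = 1 - h by rewrite /h opprB addrC subrK.
clearbody h.
pose G n : powser K := \sum_(k < n) h ^+ k.
have sumE n i : G n i = \sum_(k < n) (h ^+ k) i.
  by rewrite /G; elim/big_rec2: _ => [|k x y _ <-]; rewrite ?pcoef0 // pcoefD.
have Gst n i : (i < n)%N -> G n i = G i.+1 i.
  move=> lt_in; rewrite !sumE -!(big_mkord xpredT (fun k => (h ^+ k) i)) (big_cat_nat (n := i.+1)) //=.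
  rewrite -[RHS]addr0; congr (_ + _); rewrite big_nat big1 // => k /andP[ik _].
  by rewrite powser_expr_small.
pose g : powser K := Powser (fun n => G n.+1 n).
have gE : g * (1 - h) = 1.
  apply: powserP => n; transitivity ((G n.+1 * (1 - h)) n).
    rewrite !pcoefM; apply: eq_bigr => i _; congr (_ * _).
    by rewrite (Gst n.+1).
  have -> : G n.+1 * (1 - h) = 1 - h ^+ n.+1.
    by rewrite -[RHS]opprB subrX1 -mulNr opprB mulrC.
  by rewrite pcoefD pcoefN powser_expr_small // subr0.
by exists (g * psC (f 0%N)^-1); rewrite -mulrA hE.
Qed.

End PowerSeriesField.

(** * The Gauss valuation on series in T_v *)

Section Gauss.
Variables (F : finFieldType) (v : place F) (C : completion v).
Local Notation vge := (vge (@cord F v C)).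
Local Notation S := (annser C).
Implicit Types f g h : S.

(** As i0 and j0 are the lowest indices of minimal valuation, every other term of the coefficient
    has larger valuation than f i0 * g j0. *)
Lemma gauss_mul f g (a b : nat) (i0 j0 : int) :
  (forall i, vge a%:Z (f i)) -> ~~ vge a.+1%:Z (f i0) ->
  (forall i, i < i0 -> vge a.+1%:Z (f i)) ->
  (forall j, vge b%:Z (g j)) -> ~~ vge b.+1%:Z (g j0) ->
  (forall j, j < j0 -> vge b.+1%:Z (g j)) ->
  ~~ vge (a + b).+1%:Z ((f * g) (i0 + j0)).
Proof.
move=> a1 a2 a3 b1 b2 b3; rewrite acoefM.
have := vge_mulN a2 b2; apply: contra => h.
have /= := @zsum_window _ _ C _ (a + b).+1%:Z i0 1 (aconv_summable f g (i0 + j0)).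
rewrite big_ord_recl big_ord0 /= !addr0.
have -> : i0 + j0 - i0 = j0 by ring.
move=> H; have {}H := vge_subC (H _); set x := f i0 * g j0 in H *.
rewrite -[x](subrK (zsum (fun i => f i * g (i0 + j0 - i)))).
apply: vgeD h; apply: H => i hi.
have [hh|hh] := ltP i i0.
  have -> : (a + b).+1%:Z = a.+1%:Z + b%:Z by lia.
  by apply: vgeM => //; apply: a3.
have -> : (a + b).+1%:Z = a%:Z + b.+1%:Z by lia.
by apply: vgeM => //; apply: b3; lia.
Qed.

(** Gauss valuation 0. A primitive factor can be cancelled without losing divisibility
    ([gauss_div]); [varpi] and all t - c are of this kind. *)
Definition primitive f := exists i, ~~ vge 1 (f i).

Lemma primitive_min f : primitive f ->
  exists i0, ~~ vge 1 (f i0) /\ forall i, i < i0 -> vge 1 (f i).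
Proof.
move=> [i fi]; have f0 : f != 0 by apply: contraNneq fi => ->; rewrite acoef0 vge0.
have [a [i0 [h1 h2 h3]]] := gauss f0.
have a0 : a = 0%N by case: a h1 {h2 h3} => // a h1; case/negP: fi; apply: vge_le (h1 i); lia.
by rewrite a0 in h2 h3; exists i0.
Qed.

Lemma primitiveM f g : primitive f -> primitive g -> primitive (f * g).
Proof.
move=> /primitive_min[i [hi hi']] /primitive_min[j [hj hj']].
by exists (i + j); apply: (@gauss_mul _ _ 0 0) => // k; apply: acoef_int.
Qed.

Lemma primitive1 : primitive 1.
Proof. by exists 0; rewrite /= /amon_fun eqxx vge1N1. Qed.

Lemma primitive_prod (I : Type) (r : seq I) (P : pred I) (E : I -> S) :
  (forall i, P i -> primitive (E i)) -> primitive (\prod_(i <- r | P i) E i).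
Proof.
move=> h; elim/big_rec: _ => [|i x Pi hx]; first exact: primitive1.
by apply: primitiveM => //; apply: h.
Qed.

Lemma gauss_div f h (M : nat) : primitive h ->
  (forall i, vge M%:Z ((f * h) i)) -> forall i, vge M%:Z (f i).
Proof.
move=> /primitive_min[j [hj hj']] hM i.
have [->|f0] := eqVneq f 0; first by rewrite acoef0 vge0.
have [a [i0 [h1 h2 h3]]] := gauss f0.
have [Ma|aM] := leqP M a; first by apply: vge_le (h1 i); lia.
have := @gauss_mul f h a 0 i0 j h1 h2 h3 (acoef_int h) hj hj'.
by case/negP; apply: vge_le (hM _); lia.
Qed.

Lemma primitive_tT (c : C) : primitive (tT C - acst c).
Proof.
exists 1; rewrite acoefD acoefN /= /acst_fun /= subr0.
exact: tT1_unit.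
Qed.

Lemma varpi_coef : [/\ forall m : nat, varpi C m.+1%:Z = 0, varpi C 0 = 1 &
  forall m : nat, vge m%:Z (varpi C (- m%:Z))].
Proof.
split=> [m||m].
- apply: vcvg_unique (varpi_cvg C _) _; apply: vcvg_ext (vcvg_cst 0) => n.
  by have [-> _ _] := varpi_partE C n.
- apply: vcvg_unique (varpi_cvg C _) _; apply: vcvg_ext (vcvg_cst 1) => n.
  by have [_ -> _] := varpi_partE C n.
apply: vcvg_ge (varpi_cvg C _) _; exists 0%N => n _.
have [_ _ h] := varpi_partE C n; apply: vge_le (h m); rewrite lez_nat.
elim: m => // m IH; rewrite hsumS; have := qd_gt1 v; nia.
Qed.

Lemma primitive_varpi : primitive (varpi C).
Proof. by exists 0; have [_ -> _] := varpi_coef; rewrite vge1N1. Qed.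

Lemma iter_atwist N f i : iter N (@atwist _ _ C) f i = f i ^+ (qd v ^ N).
Proof.
elim: N => [|N IH]; first by rewrite expr1.
by rewrite iterS /= IH /frob -exprM -expnSr.
Qed.

Lemma iter_atwist_neq0 N f : f != 0 -> iter N (@atwist _ _ C) f != 0.
Proof. by move=> f0; elim: N => //= N IH; rewrite atwist_eq0. Qed.

(** In the twist the coefficient of T_v^(-m) has valuation at least m q^(d(N+1)), which exceeds the
    pole of order m of v^(-m), so only the constant term 1 survives modulo v. *)
Lemma evS_varpi N : vge 1 (evS (iter N.+1 (@atwist _ _ C) (varpi C)) - 1).
Proof.
set W := iter _ _ _; have -> : evS W - 1 = evS (W - 1) by rewrite rmorphB rmorph1.
have [w1 w2 w3] := varpi_coef; have q2 := qd_gt1 v.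
have qN : (1 < qd v ^ N.+1)%N by apply: leq_ltn_trans (ltn_expl _ q2).
apply: zsum_ge => [|i]; first exact: summable_evS.
rewrite acoefD acoefN {}/W iter_atwist /= /amon_fun.
case: i => [[|m]|m].
- by rewrite w2 expr1n subrr mul0r vge0.
- by rewrite w1 expr0n -(prednK (ltnW qN)) /= subr0 mul0r vge0.
rewrite subr0 NegzE; apply: vge_le (vgeM (vgeX _ (w3 m.+1)) (vge_vKz C _)).
by have h := leq_mul (leqnn m.+1) qN; lia.
Qed.

(** Twisting never lowers the valuation of a coefficient, so the index m0 beyond which the
    coefficients of f offset the poles of v^i serves all twists. *)
Lemma evS_iter_bound f : exists K : nat, forall N, vge (- K%:Z) (evS (iter N (@atwist _ _ C) f)).
Proof.
have [m0 h] := a_super f 1; exists m0 => N.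
apply: zsum_ge => [|i]; first exact: summable_evS.
rewrite iter_atwist.
have f0 : vge 0 (f i ^+ (qd v ^ N)) by apply/vgeX0/acoef_int.
have [i0|i0] := leP (- m0%:Z) i; first by apply: vge_le (vgeM f0 (vge_vKz C _)); lia.
have e : i = - (absz i)%:Z by lia.
have := h (absz i) ltac:(lia); rewrite -e mul1n => hi.
have qN : (0 < qd v ^ N)%N by rewrite expn_gt0 ltnW ?qd_gt1.
apply: vge_le (vgeM (vgeX (qd v ^ N) hi) (vge_vKz C _)).
by have := leq_mul (leqnn (absz i)) qN; lia.
Qed.

End Gauss.

(** * The ring B and the Hartl-Kim isomorphism *)

Section RingB.
Variables (F : finFieldType) (v : place F) (C : completion v).
Local Notation vge := (vge (@cord F v C)).
Local Notation vcvg := (vcvg (@cord F v C)).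
Local Notation S := (annser C).
Local Notation B := (ringB C).
Local Notation tw := (@atwist F v C).
Local Notation Btw := (@Btwist F v C).
Implicit Types (f g h : S) (x y : B).

Lemma BvalM x y : Bval (x * y) = Bval x * Bval y. Proof. exact: (rmorphM val). Qed.
Lemma BvalD x y : Bval (x + y) = Bval x + Bval y. Proof. exact: (rmorphD val). Qed.
Lemma BvalB x y : Bval (x - y) = Bval x - Bval y. Proof. exact: (rmorphB val). Qed.
Lemma Bval1 : Bval (1 : B) = 1. Proof. exact: (rmorph1 val). Qed.
Lemma Bval0 : Bval (0 : B) = 0. Proof. exact: (rmorph0 val). Qed.

Lemma BvalS g : Bval (StoB g) = tofrac g. Proof. by []. Qed.
Lemma Bval_tw x : Bval (Btw x) = ftwist (Bval x). Proof. by []. Qed.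
Lemma Bval_inj x y : Bval x = Bval y -> x = y. Proof. exact: val_inj. Qed.

Fact StoB_zmod : zmod_morphism (@StoB F v C).
Proof. by move=> f g; apply: Bval_inj; rewrite BvalB !BvalS rmorphB. Qed.
Fact StoB_monoid : monoid_morphism (@StoB F v C).
Proof. by split=> [|f g]; apply: Bval_inj; rewrite ?BvalM ?[Bval (StoB _)]BvalS ?rmorph1 ?rmorphM ?Bval1 //. Qed.
HB.instance Definition _ := GRing.isZmodMorphism.Build _ _ (@StoB F v C) StoB_zmod.
HB.instance Definition _ := GRing.isMonoidMorphism.Build _ _ (@StoB F v C) StoB_monoid.

Lemma B_rep x : exists n g, Bval x * tofrac (varpi C ^+ n) = tofrac g.
Proof. by case: x => x /= /asboolP[n [g hg]]; exists n, g; rewrite rmorphXn. Qed.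

Lemma varpiX_neq0 n : varpi C ^+ n != 0.
Proof. by rewrite expf_neq0 ?varpi_neq0. Qed.

Lemma ftwistP (x : {fraction S}) g h : h != 0 -> x * tofrac h = tofrac g ->
  ftwist x * tofrac (tw h) = tofrac (tw g).
Proof.
move=> h0 e; have -> : x = tofrac g / tofrac h by rewrite -e mulfK ?tofrac_eq0.
by rewrite ftwistE // divfK // tofrac_eq0 atwist_eq0.
Qed.

Lemma ftwist_uniq (x y : {fraction S}) g h : h != 0 -> x * tofrac h = tofrac g ->
  y * tofrac (tw h) = tofrac (tw g) -> ftwist x = y.
Proof.
move=> h0 e e'; apply: (mulIf (_ : tofrac (tw h) != 0)).
  by rewrite tofrac_eq0 atwist_eq0.
by rewrite e' (ftwistP h0 e).
Qed.

Fact Btwist_zmod : zmod_morphism Btw.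
Proof.
move=> x y; apply: Bval_inj; rewrite BvalB !Bval_tw.
have [n [f ef]] := B_rep x; have [m [g eg]] := B_rep y.
set w := varpi C ^+ n in ef; set u := varpi C ^+ m in eg.
have w0 : w != 0 by exact: varpiX_neq0.
have u0 : u != 0 by exact: varpiX_neq0.
have hx := ftwistP w0 ef; have hy := ftwistP u0 eg.
apply: (ftwist_uniq (g := f * u - g * w) (h := w * u)); first by rewrite mulf_neq0.
  by rewrite BvalB !rmorphB !rmorphM /= -ef -eg; ring.
by rewrite /= !rmorphB !rmorphM /= -hx -hy; ring.
Qed.
Fact Btwist_monoid : monoid_morphism Btw.
Proof.
split=> [|x y]; apply: Bval_inj; rewrite ?BvalM !Bval_tw.
  by rewrite !Bval1; apply: (@ftwist_uniq _ _ 1 1); rewrite ?oner_neq0 ?rmorph1 ?mulr1.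
have [n [f ef]] := B_rep x; have [m [g eg]] := B_rep y.
set w := varpi C ^+ n in ef; set u := varpi C ^+ m in eg.
have w0 : w != 0 by exact: varpiX_neq0.
have u0 : u != 0 by exact: varpiX_neq0.
have hx := ftwistP w0 ef; have hy := ftwistP u0 eg.
apply: (ftwist_uniq (g := f * g) (h := w * u)); first by rewrite mulf_neq0.
  by rewrite BvalM !rmorphM /= -ef -eg; ring.
by rewrite /= !rmorphM /= -hx -hy; ring.
Qed.
HB.instance Definition _ := GRing.isZmodMorphism.Build _ _ Btw Btwist_zmod.
HB.instance Definition _ := GRing.isMonoidMorphism.Build _ _ Btw Btwist_monoid.

Lemma Btwist_S g : Btw (StoB g) = StoB (tw g).
Proof.
apply: Bval_inj; rewrite Bval_tw !BvalS; apply: (@ftwist_uniq _ _ g 1); rewrite ?oner_neq0 //.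
  by rewrite rmorph1 mulr1.
by rewrite !rmorph1 mulr1.
Qed.

Lemma iter_Btwist_S N g : iter N Btw (StoB g) = StoB (iter N tw g).
Proof. by elim: N => //= N ->; rewrite Btwist_S. Qed.

Lemma iter_BtwistM N x y : iter N Btw (x * y) = iter N Btw x * iter N Btw y.
Proof. by elim: N => //= N ->; rewrite rmorphM. Qed.

Lemma iter_ftwistP N x g h : h != 0 -> Bval x * tofrac h = tofrac g ->
  Bval (iter N Btw x) * tofrac (iter N tw h) = tofrac (iter N tw g).
Proof.
move=> h0 e; elim: N => //= N IH; apply: ftwistP IH.
exact: iter_atwist_neq0.
Qed.

Lemma iter_atwistX N n f : iter N tw (f ^+ n) = iter N tw f ^+ n.
Proof. by elim: N => //= N ->; rewrite rmorphXn. Qed.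

Lemma iter_atwistM N f g : iter N tw (f * g) = iter N tw f * iter N tw g.
Proof. by elim: N => //= N ->; rewrite rmorphM. Qed.

(* [evfrac x c]: x is regular at T_v = v, with value c. *)
Definition evfrac (x : {fraction S}) (c : C) := exists f h,
  [/\ evS h != 0, x * tofrac h = tofrac f & c * evS h = evS f].

Lemma evfrac_uniq (x : {fraction S}) c e : evfrac x c -> evfrac x e -> c = e.
Proof.
move=> [f [h [h0 xh ch]]] [g [k [k0 xk ek]]].
have E : f * k = g * h.
  by apply/eqP; rewrite -tofrac_eq !rmorphM /= -xh -xk; apply/eqP; ring.
have := congr1 (@evS F v C) E; rewrite !rmorphM /= -ch -ek => e1.
apply: (mulIf (mulf_neq0 h0 k0)); rewrite mulrA e1; ring.
Qed.

Lemma evfracM (x y : {fraction S}) c e : evfrac x c -> evfrac y e -> evfrac (x * y) (c * e).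
Proof.
move=> [f [h [h0 xh ch]]] [g [k [k0 yk ek]]]; exists (f * g), (h * k); split.
- by rewrite rmorphM /= mulf_neq0.
- by rewrite !rmorphM /= -xh -yk; ring.
- by rewrite !rmorphM /= -ch -ek; ring.
Qed.

Lemma evfrac_S g : evfrac (tofrac g) (evS g).
Proof. by exists g, 1; rewrite !rmorph1 !mulr1 oner_neq0. Qed.

Definition evB x : C := xget 0 [set c | evfrac (Bval x) c]%classic.

Lemma evBE x c : evfrac (Bval x) c -> evB x = c.
Proof. by move=> h; apply: xget_unique => // y hy; apply: evfrac_uniq hy h. Qed.

Lemma evS_varpi_neq0 N : evS (iter N.+1 tw (varpi C)) != 0.
Proof. exact/vge1_neq0/evS_varpi. Qed.

(** After a twist the denominator is a power of a twist of [varpi], which no longer vanishes at T_v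
    = v. *)
Lemma evB_iter N x : evfrac (Bval (iter N.+1 Btw x)) (evB (iter N.+1 Btw x)).
Proof.
suff [c hc] : exists c, evfrac (Bval (iter N.+1 Btw x)) c by rewrite (evBE hc).
have [n [g e]] := B_rep x.
have := iter_ftwistP N.+1 (varpiX_neq0 n) e; rewrite iter_atwistX => h.
have w0 := evS_varpi_neq0 N.
exists (evS (iter N.+1 tw g) / evS (iter N.+1 tw (varpi C)) ^+ n).
exists (iter N.+1 tw g), (iter N.+1 tw (varpi C) ^+ n); split=> //.
  by rewrite rmorphXn expf_neq0.
by rewrite rmorphXn divfK // expf_neq0.
Qed.

(** The expansion at T_v = v of the twisted [varpi] is a unit, so the series demanded by the choice
    in [BtoO] exists. *)
Lemma BtoO_spec x : exists n f,
  Bval (Btw x) * tofrac (tw (varpi C)) ^+ n = tofrac f /\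
  BtoO (Btw x) * taylor (tw (varpi C)) ^+ n = taylor f.
Proof.
have [n [g e]] := B_rep x; have h := ftwistP (varpiX_neq0 n) e.
have w0 : taylor (tw (varpi C)) 0%N != 0 by rewrite taylor0; exact: (evS_varpi_neq0 0).
have [k hk] := powser_inv w0.
have := @xgetPex _ 0 [set y : powser C | exists n (f : S),
     Bval (Btw x) * tofrac (tw (varpi C)) ^+ n = tofrac f /\
     y * taylor (tw (varpi C)) ^+ n = taylor f]%classic.
apply; exists (taylor (tw g) * k ^+ n), n, (tw g); split.
  by rewrite -h rmorphXn rmorphXn.
by rewrite -mulrA -exprMn hk expr1n mulr1.
Qed.

Lemma BtoO_const x : BtoO (Btw x) 0%N = evB (Btw x).
Proof.
have [n [f [e1 e2]]] := BtoO_spec x; symmetry; apply: evBE.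
have w0 := evS_varpi_neq0 0.
exists f, (tw (varpi C) ^+ n); split; first by rewrite rmorphXn expf_neq0.
  by rewrite rmorphXn.
have := congr1 (fun h : powser C => h 0%N) e2; rewrite pcoefMX !taylor0 => <-.
by rewrite rmorphXn.
Qed.

Lemma taylor_0 : taylor (0 : S) = 0.
Proof. by apply: powserP => n; rewrite pcoef0 /= zsum0 // => i; rewrite mulr0 mul0r. Qed.

Lemma BtoO_0 : BtoO (0 : B) = 0.
Proof.
have [n [f []]] := BtoO_spec 0; rewrite rmorph0 Bval0 mul0r => /esym/eqP.
rewrite tofrac_eq0 => /eqP->; rewrite taylor_0 mulrC => h.
apply: powser_eq0M h _.
have w0 : taylor (tw (varpi C)) 0%N != 0 by rewrite taylor0; exact: (evS_varpi_neq0 0).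
apply/eqP => /(congr1 (fun h : powser C => (1 * h) 0%N)) /eqP.
by rewrite pcoefMX mulr0 pcoef0 mul1r expf_eq0 (negPf w0) andbF.
Qed.

(* Divisibility by the N-th power of the maximal ideal in the Gauss valuation. *)
Definition Bdiv (N : nat) x := forall n g, Bval x * tofrac (varpi C ^+ n) = tofrac g ->
  forall i, vge N%:Z (g i).

Lemma vge_acoefM N f g : (forall i, vge N (f i)) -> forall i, vge N ((f * g) i).
Proof.
move=> hf i; apply: zsum_ge => [|j]; first exact: aconv_summable.
by apply: vgeM0 => //; apply: acoef_int.
Qed.

Lemma primitiveX f n : primitive f -> primitive (f ^+ n).
Proof.
by move=> pf; elim: n => [|n IH]; rewrite ?expr0 ?exprS; [exact: primitive1|exact: primitiveM].
Qed.

(** Any two numerators agree up to powers of [varpi], which are primitive. *)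
Lemma BdivP N x n g : Bval x * tofrac (varpi C ^+ n) = tofrac g ->
  (forall i, vge N%:Z (g i)) -> Bdiv N x.
Proof.
move=> e hg m f e'; apply: (gauss_div (h := varpi C ^+ n)).
  by apply: primitiveX; exact: primitive_varpi.
have -> : f * varpi C ^+ n = g * varpi C ^+ m; last exact: vge_acoefM.
by apply/eqP; rewrite -tofrac_eq !rmorphM /= -e -e'; apply/eqP; ring.
Qed.

Lemma Bdiv_mvB x : mvB x -> Bdiv 1 x.
Proof.
move=> [a [c [a1 ->]]]; have [n [g e]] := B_rep c.
have a0 : vge 0 a by apply: vge_le a1.
apply: (@BdivP _ _ n (acst a * g)); first by rewrite BvalM BvalS rmorphM -mulrA e.
by move=> i; rewrite acoef_cstM //; apply: vgeM0 => //; apply: acoef_int.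
Qed.

(** Coefficients are raised to the power q^d >= 2, and 2 N >= N + 1 for N > 0. The missing factor 1
    - v/T_v brings the twisted denominator back to [varpi]. *)
Lemma Bdiv_tw N x : (0 < N)%N -> Bdiv N x -> Bdiv N.+1 (Btw x).
Proof.
move=> N0 hx; have [n [g e]] := B_rep x; have h := ftwistP (varpiX_neq0 n) e.
have [u hu] : exists u, varpi C = tw (varpi C) * u.
  by exists (1 - acst (vK C) * amon C (-1)); rewrite mulrC -varpi_twist.
apply: (@BdivP _ _ n (tw g * u ^+ n)).
  by rewrite [in LHS]hu exprMn !rmorphM mulrA /= -h !rmorphXn.
apply: vge_acoefM => i; have := hx n g e i => gi.
apply: vge_le (vgeX (qd v) gi).
by have := qd_gt1 v; nia.
Qed.

Lemma Bdiv_M N x h : Bdiv N x -> Bdiv N (x * StoB h).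
Proof.
move=> hx; have [n [g e]] := B_rep x.
apply: (@BdivP _ _ n (g * h)); first by rewrite BvalM BvalS rmorphM /= -e; ring.
by apply: vge_acoefM; apply: hx e.
Qed.

Lemma Bdiv_cancel N x h : primitive h -> Bdiv N (StoB h * x) -> Bdiv N x.
Proof.
move=> ph hx; have [n [g e]] := B_rep x; apply: (BdivP e); apply: (gauss_div ph).
by apply: (hx n); rewrite BvalM BvalS rmorphM /= -e; ring.
Qed.

Lemma Bdiv_inf x : (forall N, (0 < N)%N -> Bdiv N x) -> x = 0.
Proof.
move=> h; have [n [g e]] := B_rep x.
have g0 : g = 0.
  apply: annserP => i; apply: vge_eq0 => N; apply: vge_le (h N.+1 isT _ _ e i); lia.
apply: Bval_inj; rewrite Bval0; apply: (mulIf (_ : tofrac (varpi C ^+ n) != 0)).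
  by rewrite tofrac_eq0 varpiX_neq0.
by rewrite mul0r e g0 rmorph0.
Qed.

(** Write x = 1 + a c with a in the maximal ideal: the N-th twist is 1 plus a^(q^(d N)) times the
    N-th twist of c, whose values are bounded uniformly in N. *)
Lemma evB_iter_cvg x : mvB (x - 1) -> vcvg (fun N => evB (iter N Btw x)) 1.
Proof.
move=> [a [c [a1 e]]]; have [n [g eg]] := B_rep c.
have a0 : vge 0 a by apply: vge_le a1.
have [K hK] := evS_iter_bound g => M.
exists (M + K).+1 => -[//|N] hN.
have [f [h [h0 xh ch]]] := evB_iter N x.
set w := iter N.+1 tw (varpi C); set G := iter N.+1 tw g.
have w0 : evS w != 0 := evS_varpi_neq0 N.
have E : evfrac (Bval (iter N.+1 Btw x)) (1 + a ^+ (qd v ^ N.+1) * evS G / evS w ^+ n).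
  have ex : Bval x * tofrac (varpi C ^+ n) = tofrac (varpi C ^+ n + acst a * g).
    have -> : x = 1 + StoB (acst a) * c by rewrite -e addrC subrK.
    rewrite BvalD BvalM BvalS Bval1 rmorphD rmorphM /= -eg.
    by rewrite mulrDl mul1r mulrA.
  have := iter_ftwistP N.+1 (varpiX_neq0 n) ex.
  have -> : iter N.+1 tw (varpi C ^+ n + acst a * g) =
      w ^+ n + acst (a ^+ (qd v ^ N.+1)) * G.
    have D m f1 f2 : iter m tw (f1 + f2) = iter m tw f1 + iter m tw f2.
      by elim: m => //= m ->; rewrite rmorphD.
    rewrite D iter_atwistX iter_atwistM; congr (_ + _ * _).
    apply: annserP => i; rewrite iter_atwist !acst_coef ?vgeX0 //.
    case: eqP => // _; rewrite expr0n -(prednK (_ : 0 < qd v ^ N.+1)%N) //.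
    by rewrite expn_gt0 ltnW ?qd_gt1.
  rewrite iter_atwistX -/w => ew.
  exists (w ^+ n + acst (a ^+ (qd v ^ N.+1)) * G), (w ^+ n); split=> //.
    by rewrite rmorphXn expf_neq0.
  rewrite rmorphD rmorphM /= rmorphXn /= evS_cst ?vgeX0 //.
  by rewrite mulrDl mul1r divfK // expf_neq0.
rewrite (evBE E) addrAC subrr add0r.
have w1 : vge 0 (evS w ^+ n)^-1.
  by rewrite -exprVn; apply/vgeX0/vge_unitV/evS_varpi.
apply: vgeM0 w1; apply: vge_le (vgeM (vgeX1 (N := N.+1) _ a1) (hK N.+1)); first by lia.
by apply/ltnW/ltn_expl/qd_gt1.
Qed.

End RingB.

(** * Iterates of tau *)

Section IterTau.
Variables (F : finFieldType) (R : comNzRingType) (f : {rmorphism F -> R}) (l : nat).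
Hypothesis l_gt0 : (0 < l)%N.
Local Notation q := #|F|.

(* tau^n e_{s-n} = taufac n c s *: e_s, indices modulo l; see iter_tau_delta. *)
Definition taufac (n : nat) (c : R) (s : nat) : {poly R} :=
  \prod_(0 <= k < n | (k == s %[mod l])%N) ('X - (c ^+ (q ^ k))%:P).

Lemma coef_map_expr n (p : {poly R}) i :
  (map_poly (fun a : R => a ^+ (q ^ n)) p)`_i = p`_i ^+ (q ^ n).
Proof. by rewrite coef_map_id0 // expr0n -(prednK (expq_gt0 F n)). Qed.

Lemma map_exprM n (p r : {poly R}) :
  map_poly (fun a : R => a ^+ (q ^ n)) (p * r) =
  map_poly (fun a : R => a ^+ (q ^ n)) p * map_poly (fun a : R => a ^+ (q ^ n)) r.
Proof.
apply/polyP => i; rewrite coef_map_expr !coefM (exprq_sum f).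
by apply: eq_bigr => j _; rewrite !coef_map_expr exprMn.
Qed.

Lemma map_expr_prod n (I : Type) (r : seq I) (P : pred I) (E : I -> {poly R}) :
  map_poly (fun a : R => a ^+ (q ^ n)) (\prod_(i <- r | P i) E i) =
  \prod_(i <- r | P i) map_poly (fun a : R => a ^+ (q ^ n)) (E i).
Proof.
elim/big_rec2: _ => [|i x y _ <-]; last exact: map_exprM.
by apply/polyP => i; rewrite coef_map_expr coef1; case: eqP; rewrite ?expr1n // expr0n -(prednK (expq_gt0 F n)).
Qed.

Lemma map_expr_XsubC n (c : R) :
  map_poly (fun a : R => a ^+ (q ^ n)) ('X - c%:P) = 'X - (c ^+ (q ^ n))%:P.
Proof.
apply/polyP => i; rewrite coef_map_expr !coefB (exprBq f) coefX !coefC.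
have z : (0 : R) ^+ (q ^ n) = 0 by rewrite expr0n -(prednK (expq_gt0 F n)).
by case: (i == 1%N); case: (i == 0%N); rewrite ?expr1n ?z.
Qed.

Lemma ord_pred_mod (i : 'I_l) : (ord_pred i + 1 = i %[mod l])%N.
Proof.
rewrite /= modnDml addn1 prednK; last by rewrite addn_gt0 l_gt0 orbT.
by rewrite modnDr.
Qed.

(** The last application of tau contributes the factor k = 0 and twists the earlier ones, which
    moves their k to k + 1. *)
Lemma iter_tauE n (c : R) (m : 'rV[{poly R}]_l) (i : 'I_l) :
  iter n (tau q c) m 0 i = taufac n c i *
    map_poly (fun a : R => a ^+ (q ^ n)) (m 0 (iter n (@ord_pred l) i)).
Proof.
elim: n i => [|n IH] i.
  rewrite /taufac big_geq // mul1r; apply/polyP => j.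
  by rewrite coef_map_expr expn0 expr1.
rewrite iterS mxE IH iterSr.
have E p : map_poly (fun a : R => a ^+ q) p = map_poly (fun a : R => a ^+ (q ^ 1)) p :> {poly R}.
  by rewrite expn1.
rewrite E map_exprM mulrA; congr (_ * _); last first.
  by apply/polyP => j; rewrite !coef_map_expr -exprM expn1 -expnSr.
rewrite /taufac map_expr_prod [RHS]big_mkcond big_nat_recl //= -[in RHS]big_mkcond /=.
congr (_ * _).
  rewrite mod0n modn_small // eq_sym.
  by case: eqP => // _; rewrite expn0 expr1.
rewrite [LHS]big_mkcond [RHS]big_mkcond; apply: eq_bigr => k _.
have -> : (k == (i + l).-1 %% l %[mod l])%N = (k.+1 == i %[mod l])%N.
  by rewrite -(ord_pred_mod i) -[k.+1]addn1 eqn_modDr.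
by case: ifP => // _; rewrite map_expr_XsubC -exprM -expnSr.
Qed.

Lemma iter_ord_predK n : cancel (iter n (@ord_pred l)) (iter n (@ordS l)).
Proof. by elim: n => // n IH i; rewrite iterSr iterS ord_predK IH. Qed.

Lemma iter_ord_pred_mod n (i : 'I_l) : (iter n (@ord_pred l) i + n = i %[mod l])%N.
Proof.
elim: n => [|n IH]; first by rewrite addn0.
by rewrite iterS -[X in (_ + X)%N]add1n addnA -modnDml ord_pred_mod modnDml.
Qed.

Lemma iter_tau_delta n (c : R) (i s : 'I_l) :
  iter n (tau q c) (delta_mx 0 i) 0 s = taufac n c s * (iter n (@ord_pred l) s == i)%:R.
Proof.
rewrite iter_tauE mxE eqxx /=; congr (_ * _); apply/polyP => j; rewrite coef_map_expr.
by case: (_ == i); rewrite ?coef1 ?coef0; case: (j == 0%N); rewrite /= ?expr1n // expr0n -(prednK (expq_gt0 F n)).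
Qed.

End IterTau.

(** * The matrix of the Hartl-Kim isomorphism *)

Section HartlKim.
Variables (F : finFieldType) (v : place F) (C : completion v) (l : nat).
Hypothesis l_gt0 : (0 < l)%N.
Local Notation q := #|F|.
Local Notation d := (size (v : {poly F})).-1.
Local Notation vge := (vge (@cord F v C)).
Local Notation vcvg := (vcvg (@cord F v C)).
Local Notation S := (annser C).
Local Notation B := (ringB C).
Local Notation O := (powser C).
Local Notation theta := (theta C).
Local Notation eps := (teich C).
Local Notation tw := (@atwist F v C).
Local Notation Btw := (@Btwist F v C).
Local Notation pd := (iter d (@ord_pred l)).
Local Notation bfac := (taufac F l d theta).
Local Notation bbar := (taufac F l d eps).

Lemma RtoV_iter n (m : 'rV[{poly {poly F}}]_l) (s : 'I_l) :
  RtoV C (iter n (@tauA F l) m) 0 s = taufac F l n theta s *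
    map_poly (fun a => a ^+ (q ^ n)) (RtoV C m 0 (iter n (@ord_pred l) s)).
Proof.
rewrite !mxE (iter_tauE (polyC : {rmorphism F -> {poly F}}) l_gt0) rmorphM /=; congr (_ * _).
  rewrite /taufac rmorph_prod; apply: eq_bigr => k _.
  by rewrite rmorphB /= map_polyX map_polyC /= rmorphXn.
apply/polyP => i; rewrite (coef_map_expr F) !coef_map /= -rmorphXn.
by rewrite (coef_map_expr F).
Qed.

Lemma taud_eE (i s : 'I_l) : taud_e C i 0 s = bfac s * (pd s == i)%:R.
Proof.
rewrite /taud_e RtoV_iter; congr (_ * _).
rewrite !mxE eqxx /= rmorph_nat; apply/polyP => j; rewrite (coef_map_expr F).
have z : (0 : C) ^+ (q ^ d) = 0 by rewrite expr0n -(prednK (expq_gt0 F d)).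
by case: (_ == i); rewrite ?coef1 ?coef0 ?z //; case: (j == 0%N); rewrite /= ?expr1n ?z.
Qed.

Lemma taud_ebarE (i s : 'I_l) : taud_ebar C i 0 s = bbar s * (pd s == i)%:R.
Proof. exact: (iter_tau_delta (@cstC F v C) l_gt0). Qed.

(** [acst] respects sums and products of elements of A_v only, so passing a product of polynomials
    to B requires integral coefficients. *)
Definition intpoly (p : {poly C}) := forall i, vge 0 p`_i.

Lemma intpoly_mulXsubC p (c : C) : vge 0 c -> intpoly p -> intpoly (p * ('X - c%:P)).
Proof.
move=> c0 ip i; rewrite mulrBr coefB coefMX coefMC; apply: vgeB.
  by case: eqP => _ //; exact: vge0.
exact: vgeM0.
Qed.

Lemma map_acstM p (c : C) : vge 0 c -> intpoly p ->
  map_poly (@acst F v C) (p * ('X - c%:P)) = map_poly (@acst F v C) p * ('X - (acst c)%:P).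
Proof.
move=> c0 ip; have z := acst0 C; apply/polyP => i.
rewrite coef_map_id0 // !mulrBr !coefB !coefMX !coefMC !(@coef_map_id0 _ _ _ _ _ z).
case: eqP => _; last by rewrite acstB ?acstM ?vgeM0.
by rewrite acstB ?acstM ?vgeM0 ?vge0 // z.
Qed.

Definition taufacS (n : nat) (c : C) (s : nat) : S :=
  \prod_(0 <= k < n | (k == s %[mod l])%N) (tT C - acst (c ^+ (q ^ k))).

Lemma polyB_taufac n (c : C) s : vge 0 c -> polyB (taufac F l n c s) = StoB (taufacS n c s).
Proof.
move=> c0; rewrite /polyB /taufacS /taufac; congr StoB.
suff H (P : pred nat) : intpoly (\prod_(0 <= k < n | P k) ('X - (c ^+ (q ^ k))%:P)) /\
  (map_poly (@acst F v C) (\prod_(0 <= k < n | P k) ('X - (c ^+ (q ^ k))%:P))).[tT C] =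
  \prod_(0 <= k < n | P k) (tT C - acst (c ^+ (q ^ k))).
  by have [_ ->] := H (fun k => (k == s %[mod l])%N).
elim: n => [|n [IH1 IH2]].
  rewrite !big_geq //; split=> [i|].
    by rewrite coef1; case: eqP => _; rewrite ?vge0 ?vge1.
  have -> : map_poly (@acst F v C) 1 = 1.
    apply/polyP => i; rewrite coef_map_id0 ?acst0 // !coef1.
    by case: eqP => _; rewrite ?acst1 ?acst0.
  by rewrite hornerC.
rewrite !big_nat_recr_cond //=; case: (P n); last by rewrite !mulr1.
split; first by apply: intpoly_mulXsubC => //; exact: vgeX0.
by rewrite map_acstM ?vgeX0 // hornerM IH2 hornerD hornerX hornerN hornerC.
Qed.

Lemma polyB_0 : polyB (0 : {poly C}) = 0.
Proof.
rewrite /polyB; have -> : map_poly (@acst F v C) 0 = 0.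
  by apply/polyP => i; rewrite coef_map_id0 ?acst0 // !coef0 acst0.
by rewrite horner0 rmorph0.
Qed.

Lemma primitive_taufacS n c s : primitive (taufacS n c s).
Proof. by apply: primitive_prod => k _; apply: primitive_tT. Qed.

Lemma iter_tw_taufacS N c s : vge 0 c ->
  iter N tw (taufacS d c s) =
  \prod_(0 <= k < d | (k == s %[mod l])%N) (tT C - acst (c ^+ (q ^ (k + N * d)))).
Proof.
move=> c0; elim: N => [|N IH].
  by apply: eq_bigr => k _; rewrite mul0n addn0.
rewrite iterS IH rmorph_prod; apply: eq_bigr => k _.
rewrite rmorphB /= atwist_tT acst_tw ?vgeX0 // /frob -exprM /qd -expnD.
by rewrite mulSn addnCA addnC.
Qed.

Lemma evS_taufac (P : pred nat) (c : nat -> C) n : (forall k, vge 0 (c k)) ->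
  evS (\prod_(0 <= k < n | P k) (tT C - acst (c k))) = \prod_(0 <= k < n | P k) (theta - c k).
Proof.
move=> c0; rewrite rmorph_prod; apply: eq_bigr => k _.
by rewrite rmorphB /= evS_tT evS_cst.
Qed.

(** The value of bbar_s at t = theta, shared by all its twists since epsilon^(q^d) = epsilon. *)
Definition bbar_theta (s : nat) : C :=
  \prod_(0 <= k < d | (k == s %[mod l])%N) (theta - eps ^+ (q ^ k)).

(** The value at t = theta of the N-th twist of b_s. *)
Definition bdif (N s : nat) : C :=
  \prod_(0 <= k < d | (k == s %[mod l])%N) dif C (k + N * d).

Lemma evS_bbar N s : evS (iter N tw (taufacS d eps s)) = bbar_theta s.
Proof.
rewrite iter_tw_taufacS ?vge0_teich // evS_taufac => [|k]; last exact/vgeX0/vge0_teich.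
by apply: eq_bigr => k _; rewrite teich_qM.
Qed.

Lemma evS_bfac N s : evS (iter N tw (taufacS d theta s)) = bdif N s.
Proof.
by rewrite iter_tw_taufacS ?vge0_theta // evS_taufac => // k; exact/vgeX0/vge0_theta.
Qed.

Section Comparison.
Variable Phi : {linear 'rV[B]_l -> 'rV[B]_l}.
Hypothesis hPhi : hartl_kim Phi.

Definition Pmat (i j : 'I_l) : B := Phi (delta_mx 0 i) 0 j.

(** The commutation with tau^d applied to ebar_{r-d}, read in coordinate s. *)
Lemma Pmat_rel (r s : 'I_l) :
  StoB (taufacS d eps r) * Pmat r s = Btw (Pmat (pd r) (pd s)) * StoB (taufacS d theta s).
Proof.
have [_ comm _] := hPhi.
have polyBE (c : C) (w : 'I_l -> 'rV[{poly C}]_l) : vge 0 c ->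
    (forall i j, w i 0 j = taufac F l d c j * (pd j == i)%:R) ->
    forall i j, polyB (w i 0 j) = StoB (taufacS d c j) * (pd j == i)%:R.
  move=> c0 hw i j; rewrite hw; case: (_ == i); last by rewrite !mulr0 polyB_0.
  by rewrite !mulr1 polyB_taufac.
have ebE := polyBE _ _ (vge0_teich C) taud_ebarE.
have eE := polyBE _ _ (vge0_theta C) taud_eE.
have := comm (delta_mx 0 (pd r)).
have -> : taudB (@taud_ebar F v C l) (delta_mx 0 (pd r)) =
    StoB (taufacS d eps r) *: delta_mx 0 r.
  apply/rowP => j; rewrite /taudB summxE (bigD1 (pd r)) //= big1 ?addr0 => [|i ir].
    rewrite !mxE ebE !eqxx rmorph1 mul1r (can_eq (@iter_ord_predK l d)).
    by case: (eqVneq j r) => [->|_]; rewrite ?mulr1 ?mulr0.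
  by rewrite !mxE (negPf ir) andbF rmorph0 mul0r.
rewrite linearZ /= => /rowP/(_ s); rewrite mxE -/(Pmat _ _) => ->.
rewrite /taudB summxE (bigD1 (pd s)) //= big1 ?addr0 => [|i is_].
  by rewrite mxE mxE eE eqxx mulr1.
by rewrite mxE mxE eE eq_sym (negPf is_) !mulr0.
Qed.

Lemma Pmat_mvB r s : mvB (Pmat r s - (r == s)%:R).
Proof.
have [_ _ h] := hPhi; have := h (delta_mx 0 r) s.
by rewrite !mxE eqxx /= [s == r]eq_sym.
Qed.

(** By [Pmat_rel], an off-diagonal entry times the primitive bbar_r is a multiple of the twist of
    another off-diagonal entry. Since a twist raises the Gauss valuation, these entries are
    divisible to every order. *)
Lemma Pmat_off r s : r != s -> Pmat r s = 0.
Proof.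
move=> rs; apply: Bdiv_inf => -[//|N] _; elim: N r s rs => [|N IH] r s rs.
  apply: Bdiv_mvB; have := Pmat_mvB r s; by rewrite (negPf rs) subr0.
apply: (Bdiv_cancel (primitive_taufacS d eps r)).
rewrite Pmat_rel; apply/Bdiv_M/Bdiv_tw => //; apply: IH.
by rewrite (can_eq (@iter_ord_predK l d)).
Qed.

(* The value at T_v = v, i.e. t = theta, of the N-th twist of a diagonal entry of Phi. *)
Definition pval (N : nat) (s : 'I_l) : C := evB (iter N Btw (Pmat s s)).

(** [Pmat_rel] is twisted N times before evaluation, N > 0 being what removes a possible pole at T_v
    = v. *)
Lemma pval_rel N (s : 'I_l) : (0 < N)%N ->
  pval N s * bbar_theta s = pval N.+1 (pd s) * bdif N s.
Proof.
case: N => // N _; have := congr1 (iter N.+1 Btw) (Pmat_rel s s).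
rewrite !iter_BtwistM !iter_Btwist_S -iterSr mulrC => e.
have h1 := evfracM (evB_iter N (Pmat s s)) (evfrac_S (iter N.+1 tw (taufacS d eps s))).
have h2 := evfracM (evB_iter N.+1 (Pmat (pd s) (pd s))) (evfrac_S (iter N.+1 tw (taufacS d theta s))).
rewrite -!BvalS -!BvalM e in h1 h2; have := evfrac_uniq h1 h2.
by rewrite !evS_bbar !evS_bfac.
Qed.

Lemma pval_cvg s : vcvg (pval^~ s) 1.
Proof. by apply: evB_iter_cvg; have := Pmat_mvB s s; rewrite eqxx. Qed.

Lemma bdif_neq0 N s : (0 < N)%N -> bdif N s != 0.
Proof.
move=> N0; rewrite /bdif; elim/big_ind: _ => [|x y|k _]; [exact: oner_neq0|exact: mulf_neq0|].
by apply: dif_neq0; rewrite addn_gt0 muln_gt0 N0 d_gt0 orbT.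
Qed.

(** Uniformity in s is wanted because the entry met at stage N of the iteration has index s - N
    d. *)
Lemma pval_cvg_unif (M : nat) : exists N0, forall N s, (N0 <= N)%N -> vge M%:Z (pval N s - 1).
Proof.
have h (s : 'I_l) : exists N0, forall N, (N0 <= N)%N -> vge M%:Z (pval N s - 1) by exact: pval_cvg.
have [f hf] := choice h.
exists (\sum_s f s)%N => N s hN; apply: hf; apply: leq_trans hN.
by rewrite (bigD1 s) //= leq_addr.
Qed.

(** Convergence to 1 gives this for large N; [pval_rel], with [bdif] nonzero, carries it down to N =
    1. *)
Lemma pval_neq0 N s : (0 < N)%N -> pval N s != 0.
Proof.
have [N0 h] := pval_cvg_unif 1.
have H k : forall N s, (0 < N)%N -> (N0 <= N + k)%N -> pval N s != 0.
  elim: k => [|k IH] {}N {}s N_gt0 hN.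
    by rewrite addn0 in hN; exact/vge1_neq0/h.
  have := pval_rel s N_gt0; apply: contra_eq_neq => ->.
  rewrite mul0r eq_sym mulf_neq0 ?bdif_neq0 //; apply: IH => //; lia.
by move=> N_gt0; apply: (H N0) => //; lia.
Qed.

Lemma difprodS (s : 'I_l) N : (0 < N)%N ->
  difprod C l s (N.+1 * d) = difprod C l s (N * d) * bdif N (iter N pd s).
Proof.
move=> N0; rewrite /difprod (@big_cat_nat _ _ _ (N * d)) /=; last 2 first.
- by rewrite muln_gt0 N0 d_gt0.
- by rewrite leq_mul2r leqnSn orbT.
congr (_ * _); rewrite -{1}[(N * d)%N]add0n big_addn -mulnBl subSnn mul1n /bdif.
apply: eq_bigl => k.
by rewrite -iterM -(iter_ord_pred_mod l_gt0 (N * d) s) eqn_modDr.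
Qed.

(* The comparison map sends the class of tau^d ebar_{s-d} to kappa s *: omega_s. *)
Definition kappa (s : 'I_l) : C := difprod C l s d * pval 1 (pd s).

Lemma kappa_neq0 s : kappa s != 0.
Proof. by rewrite mulf_neq0 ?difprod_neq0 ?pval_neq0. Qed.

(** Each step uses [pval_rel] twice, introducing and removing the same value of bbar, and lengthens
    both products by a block of d indices. Two late twists remain, whose ratio z tends to 1. *)
Lemma frobenius_factor (s s0 : 'I_l) (X : C) : pd s0 = s ->
  X * kappa s = kappa s0 * bbar_theta s ->
  exists2 z, vcvg z 1 &
    forall N, (0 < N)%N -> X * difprod C l s (N * d) = z N * difprod C l s0 (N.+1 * d).
Proof.
move=> s0s eX; pose r N := iter N pd s.
have H N : (0 < N)%N -> X * difprod C l s (N * d) * pval N (r N) =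
    difprod C l s0 (N.+1 * d) * pval N.+1 (r N).
  case: N => // N _; elim: N => [|N IH].
    (* Base case N = 1: the hypothesis on X, with each [kappa] split into its product and its first
       twist. *)
    rewrite [difprod _ _ s0 _]difprodS // !mul1n /r /= s0s -mulrA -/(kappa s) eX /kappa s0s.
    by rewrite -mulrA pval_rel // mulrAC mulrA mulrAC -!mulrA.
  rewrite difprodS // [in RHS]difprodS //.
  have -> : iter N.+2 pd s0 = r N.+1 by rewrite iterSr s0s.
  have e1 := pval_rel (r N.+1) (ltn0Sn N); have e2 := pval_rel (r N.+1) (ltn0Sn N.+1).
  rewrite -/(r N.+1).
  have -> : r N.+2 = pd (r N.+1) by [].
  transitivity (X * difprod C l s (N.+1 * d) * (pval N.+2 (pd (r N.+1)) * bdif N.+1 (r N.+1))).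
    by ring.
  rewrite -e1 mulrA IH -[RHS]mulrA -mulrA e2; ring.
exists (fun N => pval N.+1 (r N) / pval N (r N)).
  move=> M; have [N0 h] := pval_cvg_unif M.+1; exists N0 => N hN.
  have u1 : vge 1 (pval N (r N) - 1) by apply: vge_le (h _ _ hN); lia.
  have u0 := vge1_neq0 u1.
  have -> : pval N.+1 (r N) / pval N (r N) - 1 = (pval N.+1 (r N) - pval N (r N)) / pval N (r N).
    by rewrite mulrBl mulfV.
  apply: vgeM0 (vge_unitV u1); apply: vge_le (_ : vge M.+1%:Z _); first by lia.
  apply: vge_subT (h _ _ _) _; first exact: leqW.
  exact/vge_subC/h.
move=> N N_gt0; have u0 := pval_neq0 (r N) N_gt0.
apply: (mulIf u0); rewrite H // [RHS]mulrAC divfK //.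
exact: mulrC.
Qed.

End Comparison.

End HartlKim.

(** * The Frobenius on de Rham cohomology *)

Local Open Scope quotient_scope.

Lemma fiber_eqP (K : fieldType) (M : lmodType {poly K}) (a : K) (x y : M) :
  (\pi_(fiber M a) x = \pi_(fiber M a) y) <-> exists z, x - y = ('X - a%:P) *: z.
Proof.
by split=> [/eqmodP/asboolP|h] //; apply/eqmodP/asboolP.
Qed.

Lemma fiber_scaleE (K : fieldType) (M : lmodType {poly K}) (a c : K) (x : M) :
  c *: (\pi_(fiber M a) x : fiber M a) = \pi_(fiber M a) (c%:P *: x).
Proof. by rewrite pi_fiber_scale. Qed.

(** * Polynomials in t inside k_v[[T_v - v]] *)

Section Image.
Variables (F : finFieldType) (v : place F) (C : completion v).
Local Notation vge := (vge (@cord F v C)).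
Local Notation O := (powser C).
Local Notation theta := (theta C).

Fact polyO_zmod : zmod_morphism (@polyO F v C).
Proof. by move=> p r; rewrite /polyO rmorphB hornerD hornerN. Qed.
Fact polyO_monoid : monoid_morphism (@polyO F v C).
Proof. by split=> [|p r]; rewrite /polyO ?rmorph1 ?hornerC // rmorphM hornerM. Qed.
HB.instance Definition _ := GRing.isZmodMorphism.Build _ _ (@polyO F v C) polyO_zmod.
HB.instance Definition _ := GRing.isMonoidMorphism.Build _ _ (@polyO F v C) polyO_monoid.

Lemma polyO_C (c : C) : polyO c%:P = psC c.
Proof. by rewrite /polyO map_polyC hornerC. Qed.

Lemma polyO_const (p : {poly C}) : polyO p 0%N = p.[theta].
Proof.
rewrite /polyO; elim/poly_ind: p => [|p c IH]; first by rewrite rmorph0 !horner0 pcoef0.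
rewrite rmorphD rmorphM /= map_polyX map_polyC !hornerMXaddC -IH pcoefD pcoefM big_ord1.
by rewrite subn0 taylor0 evS_tT.
Qed.

Lemma vge0_int (n : int) : vge 0 (n%:~R : C).
Proof.
have N (m : nat) : vge 0 (m%:R : C).
  by elim: m => [|m IH]; rewrite ?vge0 // -natr1; apply: vgeD (vge1 C).
by case: n => m; rewrite ?NegzE ?mulrNz ?vgeN; exact: N.
Qed.

(** The derivative of t(T_v) at T_v = v is congruent modulo v to the coefficient of T_v, a unit by
    [tT1_unit]. Hence no t - c vanishes in k_v[[T_v - v]], and the factors of tau^d can be cancelled
    there. *)
Lemma taylor_tT1 : taylor (tT C) 1%N != 0.
Proof.
have [t0 _ _ _] := tT_spec C; set a := fun i => (binz i 1)%:~R * tT C i * vK C ^ (i - 1).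
have z (i : int) : i <= 0 -> a i = 0.
  move=> i0; rewrite /a; have [i1|i1] := ltP i 0; first by rewrite t0 // mulr0 mul0r.
  have -> : i = 0 by lia.
  by rewrite (_ : binz 0 1 = 0) // !mul0r.
have big (i : int) : vge (i - 1) (a i).
  rewrite -[i - 1]add0r; apply: vgeM (vge_vKz C _).
  by apply: vgeM0 (vge0_int _) (acoef_int _ _).
have sa : summable a.
  move=> N; exists N.+1 => i hi; have [i0|i0] := leP i 0; first by rewrite z ?vge0.
  by apply: vge_le (big i); lia.
have := @zsum_window _ _ C a 1 1 1 sa.
rewrite big_ord_recl big_ord0 !addr0 -/(taylor (tT C) 1%N) => /(_ _)/wrap[].
  move=> i hi; have [i0|i0] := leP i 0; first by rewrite z ?vge0.
  by apply: vge_le (big i); lia.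
move=> h; apply: contraNneq (tT1_unit C) => e.
move: h; rewrite -[zsum a]/(taylor (tT C) 1%N) e sub0r vgeN /a subrr expr0z mulr1 /=.
by rewrite mul1r.
Qed.

Lemma polyO_XsubC (c : C) : polyO ('X - c%:P) != 0.
Proof.
have -> : polyO ('X - c%:P) = taylor (tT C) - psC c.
  by rewrite rmorphB /= polyO_C /polyO map_polyX hornerX.
apply/eqP => /(congr1 (fun f : O => f 1%N)); rewrite pcoef0 pcoefD pcoefN subr0 => /eqP.
by rewrite (negPf taylor_tT1).
Qed.

Lemma powser_mulf_neq0 (f g : O) : f != 0 -> g != 0 -> f * g != 0.
Proof. by move=> f0; apply: contra_neq => e; apply: powser_eq0M e f0. Qed.

Lemma polyO_taufac l n (c : C) s : polyO (taufac F l n c s) != 0.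
Proof.
rewrite /taufac; elim/big_ind: _ => [|p r|k _]; last exact: polyO_XsubC.
  by rewrite rmorph1 oner_neq0.
by rewrite rmorphM; exact: powser_mulf_neq0.
Qed.

End Image.

(** * Spans as divisibility conditions on coordinates *)

Section Spans.
Variables (F : finFieldType) (v : place F) (C : completion v) (l : nat).
Hypothesis l_gt0 : (0 < l)%N.
Local Notation d := (size (v : {poly F})).-1.
Local Notation V := 'rV[{poly C}]_l.
Local Notation theta := (theta C).
Local Notation eps := (teich C).
Local Notation pd := (iter d (@ord_pred l)).
Local Notation sd := (iter d (@ordS l)).
Local Notation bfac := (taufac F l d theta).
Local Notation bbar := (taufac F l d eps).
Local Notation dfac := (taufac F l 1 theta).

Lemma FqdXP (p : {poly C}) : FqdX p <-> map_poly (@frob F v C) p = p.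
Proof.
split=> [h|h i].
  by apply/polyP => i; rewrite coef_map; apply/eqP; have := h i; rewrite inE.
by have := congr1 (fun r : {poly C} => r`_i) h; rewrite coef_map inE => ?; apply/eqP.
Qed.

Lemma iter_taubarE (m : V) s : (forall i, FqdX (m 0 i)) ->
  iter d (@taubar F v C l) m 0 s = bbar s * m 0 (pd s).
Proof.
move=> hm; rewrite (iter_tauE (@cstC F v C) l_gt0); congr (_ * _).
by have /FqdXP := hm (pd s).
Qed.

Lemma bbar_Fqd s : FqdX (bbar s).
Proof.
apply/FqdXP; rewrite rmorph_prod; apply: eq_bigr => k _.
by rewrite rmorphB /= map_polyX map_polyC /= /frob -exprM mulnC exprM teich_qd.
Qed.

Lemma tauRbar_Fqd (m : V) : tauRbar m -> forall s, FqdX (m 0 s).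
Proof.
move=> [n [a [y [h ->]]]] s; apply/FqdXP; rewrite summxE rmorph_sum.
apply: eq_bigr => i _; have [ha [m' hm' <-]] := h i.
rewrite mxE iter_taubarE // !rmorphM /= ((FqdXP _).1 ha).
by rewrite ((FqdXP _).1 (bbar_Fqd s)) ((FqdXP _).1 (hm' _)).
Qed.

Lemma tauRbar_dvd (m : V) (s : 'I_l) : tauRbar m -> bbar s %| m 0 s.
Proof.
move=> [n [a [y [h ->]]]]; rewrite summxE; elim/big_ind: _ => [|p r|i _].
- exact: dvdp0.
- exact: dvdp_add.
have [ha [m' hm' <-]] := h i.
by rewrite mxE iter_taubarE // dvdp_mull // dvdp_mulr.
Qed.

Lemma taud_ebar_in i : tauRbar (@taud_ebar F v C l i).
Proof.
exists 1%N, (fun _ => 1), (fun _ => @taud_ebar F v C l i); split; last by rewrite big_ord1 scale1r.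
move=> _; split; first by apply/FqdXP; rewrite rmorph1.
exists (delta_mx 0 i) => // j; apply/FqdXP; rewrite mxE eqxx /=.
by rewrite rmorph_nat.
Qed.

Lemma row_sum_pd (T : comNzRingType) (w : 'I_l -> 'rV[T]_l) (b : 'I_l -> T) (h : 'I_l -> T) s :
  (forall i j, w i 0 j = b j * (pd j == i)%:R) ->
  (\sum_i h i *: w i) 0 s = h (pd s) * b s.
Proof.
move=> hw; rewrite summxE (bigD1 (pd s)) //= big1 ?addr0 => [|i is_].
  by rewrite mxE hw eqxx mulr1.
by rewrite mxE hw eq_sym (negPf is_) !mulr0.
Qed.

Lemma sum_in_kspan (N : tset C l) (n : nat) (w : 'I_n -> V) (p : 'I_n -> {poly C}) :
  (forall i, kspan N (w i)) -> kspan N (\sum_i p i *: w i).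
Proof.
move=> h; elim/big_ind: _ => [|x y|i _]; first exact: kspan0.
  exact: kspanD.
exact/kspanZ/h.
Qed.

Lemma kspan_in (N : tset C l) (x : V) : tset_set N x -> kspan N x.
Proof.
move=> Nx; exists 1%N, (fun=> 1%:P), (fun=> x); split; last by rewrite big_ord1 scale1r.
by move=> _; split=> //; exists 1.
Qed.

Lemma kspan_dvd (N : tset C l) (b : 'I_l -> {poly C}) (x : V) :
  (forall m s, tset_set N m -> b s %| m 0 s) -> kspan N x -> forall s, b s %| x 0 s.
Proof.
move=> h [n [a [y [hy ->]]]] s; rewrite summxE; elim/big_ind: _ => [|p r|i _].
- exact: dvdp0.
- exact: dvdp_add.
by rewrite mxE dvdp_mull //; apply: h; have [] := hy i.
Qed.

(** Each tau^d ebar_i lives in the single coordinate i + d, given by [sd], so membership splits into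
    one condition per coordinate. *)
Lemma kspan_crisP (x : V) : kspan (tauRbar_t C l) x <-> forall s : 'I_l, bbar s %| x 0 s.
Proof.
split; first by apply: kspan_dvd => m s; exact: tauRbar_dvd.
move=> h; have -> : x = \sum_i (x 0 (sd i) %/ bbar (sd i)) *: taud_ebar C i.
  apply/rowP => s; rewrite (row_sum_pd _ _ (taud_ebarE C l_gt0)).
  by rewrite iter_ord_predK divpK.
by apply: sum_in_kspan => i; apply: kspan_in; exact: taud_ebar_in.
Qed.

Lemma tauR_dvd n (m : V) (s : 'I_l) : tauR n m -> taufac F l n theta s %| m 0 s.
Proof. by move=> [m' ->]; rewrite RtoV_iter // dvdp_mulr. Qed.

Lemma taufac1 s : taufac F l 1 theta s = if (l %| s)%N then 'X - theta%:P else 1.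
Proof.
rewrite /taufac big_mkcond big_nat1 mod0n eq_sym expn0 expr1.
by rewrite -/(dvdn l s).
Qed.

Lemma kspan_dRd (x : V) : kspan (tauR_t C l d) x <-> forall s : 'I_l, bfac s %| x 0 s.
Proof.
split; first by apply: kspan_dvd => m s; exact: tauR_dvd.
move=> h; have -> : x = \sum_i (x 0 (sd i) %/ bfac (sd i)) *: taud_e C i.
  apply/rowP => s; rewrite (row_sum_pd _ _ (taud_eE C l_gt0)).
  by rewrite iter_ord_predK divpK.
by apply: sum_in_kspan => i; apply: kspan_in; exists (delta_mx 0 i).
Qed.

Lemma kspan_dR1 (x : V) : kspan (tauR_t C l 1) x <-> forall s : 'I_l, dfac s %| x 0 s.
Proof.
split; first by apply: kspan_dvd => m s; exact: tauR_dvd.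
move=> h; have -> : x = \sum_i (x 0 i %/ dfac i) *: omega_vec C i.
  apply/rowP => s; rewrite summxE (bigD1 s) //= big1 ?addr0 => [|i is_].
    rewrite !mxE !eqxx /= mulr1 -[LHS](divpK (h s)); congr (_ * _).
    by rewrite taufac1 /dvdn modn_small.
  by rewrite !mxE [s == i]eq_sym (negPf is_) andbF !mulr0.
apply: sum_in_kspan => i; have /asboolP := omega_in C i; exact.
Qed.

End Spans.

(** * Coordinates on crystalline and de Rham cohomology *)

Section Realizations.
Variables (F : finFieldType) (v : place F) (C : completion v) (l : nat).
Hypothesis l_gt0 : (0 < l)%N.
Local Notation q := #|F|.
Local Notation d := (size (v : {poly F})).-1.
Local Notation B := (ringB C).
Local Notation O := (powser C).
Local Notation V := 'rV[{poly C}]_l.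
Local Notation theta := (theta C).
Local Notation eps := (teich C).
Local Notation Btw := (@Btwist F v C).
Local Notation pd := (iter d (@ord_pred l)).
Local Notation sd := (iter d (@ordS l)).
Local Notation bfac := (taufac F l d theta).
Local Notation bbar := (taufac F l d eps).
Local Notation dfac := (taufac F l 1 theta).
Local Notation cris := (kspan_mod (tauRbar_t C l)).
Local Notation dR := (kspan_mod (tauR_t C l 1)).
Local Notation HdR := (HdR C l).
Local Notation Hcris := (Hcris C l).

Lemma kvalB (N : tset C l) (x y : kspan_mod N) : kval (x - y) = kval x - kval y.
Proof. by []. Qed.

Lemma kvalZ (N : tset C l) p (x : kspan_mod N) : kval (p *: x) = p *: kval x.
Proof. by []. Qed.

Lemma kspan_mod_eqP (N : tset C l) (x y : kspan_mod N) :
  (\pi_(fiber (kspan_mod N) theta) x = \pi_(fiber (kspan_mod N) theta) y) <->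
  exists z : kspan_mod N, kval x - kval y = ('X - theta%:P) *: kval z.
Proof.
split=> [/fiber_eqP[z e]|[z e]].
  by exists z; rewrite -kvalB -kvalZ e.
by apply/fiber_eqP; exists z; apply: val_inj; rewrite [LHS]kvalB e -kvalZ.
Qed.

Lemma kval_in (N : tset C l) (x : kspan_mod N) : kspan N (kval x).
Proof. by have /asboolP := valP x. Qed.

Fact cris_in (p : 'I_l -> {poly C}) : \row_s (p s * bbar s) \in in_kspan (tauRbar_t C l).
Proof. by apply/asboolP/kspan_crisP => // s; rewrite mxE dvdp_mull. Qed.

(* The class with coordinates p in the basis of classes of tau^d ebar_{s-d}. *)
Definition cris_class (p : 'I_l -> C) : Hcris :=
  \pi_Hcris (KspanMod (cris_in (fun s => (p s)%:P))).

Lemma dvd_XsubC_theta (p : {poly C}) : p.[theta] = 0 -> exists r, p = r * ('X - theta%:P).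
Proof. by move=> /eqP /factor_theorem. Qed.

Lemma cris_classP (x : cris) (P : 'I_l -> {poly C}) :
  (forall s, kval x 0 s = P s * bbar s) ->
  \pi_Hcris x = cris_class (fun s => (P s).[theta]).
Proof.
move=> hx; apply/kspan_mod_eqP.
have /choice[r hr] (s : 'I_l) : exists r, P s - (P s).[theta]%:P = r * ('X - theta%:P).
  by apply: dvd_XsubC_theta; rewrite hornerD hornerN hornerC subrr.
exists (KspanMod (cris_in r)); apply/rowP => s; rewrite !mxE hx -mulrBl hr.
by rewrite mulrCA mulrA.
Qed.

Lemma cris_coord (x : cris) : exists P : 'I_l -> {poly C}, forall s, kval x 0 s = P s * bbar s.
Proof.
exists (fun s => kval x 0 s %/ bbar s) => s; rewrite divpK //.
by move: s; apply/kspan_crisP => //; exact: kval_in.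
Qed.

Lemma taufac_neq0 n (c : C) s : taufac F l n c s != 0.
Proof.
by rewrite /taufac; elim/big_ind: _ => [|p r|k _]; [exact: oner_neq0|exact: mulf_neq0|rewrite polyXsubC_eq0].
Qed.

Lemma cris_class_inj p r : cris_class p = cris_class r -> p =1 r.
Proof.
move=> /kspan_mod_eqP[z e] s; have [Z hZ] := cris_coord z.
have := congr1 (fun x : V => x 0 s) e; rewrite !mxE hZ -mulrBl mulrA => /(mulIf (taufac_neq0 _ _ _)).
move/(congr1 (fun p : {poly C} => p.[theta])).
rewrite hornerD hornerN !hornerC hornerM hornerXsubC subrr mul0r.
exact: subr0_eq.
Qed.

Fact dR_in (p : 'I_l -> {poly C}) : \row_s (p s * dfac s) \in in_kspan (tauR_t C l 1).
Proof. by apply/asboolP/kspan_dR1 => // s; rewrite mxE dvdp_mull. Qed.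

Definition dR_class (p : 'I_l -> C) : HdR := \pi_HdR (KspanMod (dR_in (fun s => (p s)%:P))).

Lemma dR_classP (y : dR) (P : 'I_l -> {poly C}) :
  (forall s, kval y 0 s = P s * dfac s) ->
  \pi_HdR y = dR_class (fun s => (P s).[theta]).
Proof.
move=> hx; apply/kspan_mod_eqP.
have /choice[r hr] (s : 'I_l) : exists r, P s - (P s).[theta]%:P = r * ('X - theta%:P).
  by apply: dvd_XsubC_theta; rewrite hornerD hornerN hornerC subrr.
exists (KspanMod (dR_in r)); apply/rowP => s; rewrite !mxE hx -mulrBl hr.
by rewrite mulrCA mulrA.
Qed.

Lemma dR_class_inj p r : dR_class p = dR_class r -> p =1 r.
Proof.
move=> /kspan_mod_eqP[z e] s.
have /kspan_dR1 /(_ s) := kval_in z; move=> /(_ l_gt0)/divpK hz.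
have := congr1 (fun x : V => x 0 s) e; rewrite !mxE -hz -mulrBl mulrA => /(mulIf (taufac_neq0 _ _ _)).
move/(congr1 (fun p : {poly C} => p.[theta])).
rewrite hornerD hornerN !hornerC hornerM hornerXsubC subrr mul0r.
exact: subr0_eq.
Qed.

Lemma omega_class (X : C) (s : 'I_l) :
  X *: omega C s = dR_class (fun r => X * (r == s)%:R).
Proof.
rewrite /omega [LHS]fiber_scaleE; congr (\pi _); apply: val_inj; apply/rowP => r.
rewrite [LHS]/= [RHS]/= linearZ /= !mxE taufac1 eqxx /=.
case: (eqVneq r s) => [->|_]; last by rewrite !mulr0 mul0r.
by rewrite !mulr1 /dvdn modn_small // mulrC.
Qed.

(** * The comparison map and Frobenius in coordinates *)

Section CrystallineFrobenius.
Variable Phi : {linear 'rV[B]_l -> 'rV[B]_l}.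
Hypothesis hPhi : hartl_kim Phi.

Local Notation Y i := (BtoO (Btw (Pmat Phi i i))).

Lemma Y_const i : Y i 0%N = pval Phi 1 i.
Proof. by rewrite BtoO_const. Qed.

Lemma vecO_taud (w : 'I_l -> V) (b : 'I_l -> {poly C}) :
  (forall i j, w i 0 j = b j * (pd j == i)%:R) ->
  forall i j, vecO (w i) 0 j = polyO (b j) * (pd j == i)%:R.
Proof. by move=> hw i j; rewrite mxE hw rmorphM rmorph_nat. Qed.

Lemma taud_PhiE i s : taud_Phi Phi i 0 s = Y i * polyO (bfac s) * (pd s == i)%:R.
Proof.
rewrite summxE (bigD1 i) //= big1 ?addr0 => [|j ji].
  by rewrite mxE (vecO_taud (taud_eE C l_gt0)) mulrA.
rewrite mxE -/(Pmat Phi i j) (Pmat_off l_gt0 hPhi) 1?eq_sym // rmorph0.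
by rewrite [BtoO _]BtoO_0 mul0r.
Qed.

Lemma polyO_bbar_neq0 s : polyO (bbar s) != 0. Proof. exact: polyO_taufac. Qed.

Lemma powser_mulIf (f g h : O) : h != 0 -> f * h = g * h -> f = g.
Proof.
move=> h0 /eqP; rewrite -subr_eq0 -mulrBl mulrC => /eqP /powser_eq0M /(_ h0) /eqP.
by rewrite subr_eq0 => /eqP.
Qed.

(** Since bbar_s is nonzero in k_v[[T_v - v]], coordinates in the tau^d ebar_i are unique and the
    choice in [Phi_v] is forced. *)
Lemma Phi_vE (P : 'I_l -> {poly C}) (x : V) : (forall s, x 0 s = P s * bbar s) ->
  forall s, Phi_v Phi (vecO x) 0 s = polyO (P s) * Y (pd s) * polyO (bfac s).
Proof.
move=> hx; pose y : 'rV[O]_l := \row_s (polyO (P s) * Y (pd s) * polyO (bfac s)).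
have sumE (h : 'I_l -> O) s : (\sum_i h i *: vecO (taud_ebar C i)) 0 s = h (pd s) * polyO (bbar s).
  exact: (row_sum_pd h s (vecO_taud (taud_ebarE C l_gt0))).
have sumE' (h : 'I_l -> O) s : (\sum_i h i *: taud_Phi Phi i) 0 s = h (pd s) * (Y (pd s) * polyO (bfac s)).
  rewrite summxE (bigD1 (pd s)) //= big1 ?addr0 => [|i is_].
    by rewrite mxE taud_PhiE eqxx mulr1.
  by rewrite mxE taud_PhiE eq_sym (negPf is_) !mulr0.
suff -> : Phi_v Phi (vecO x) = y by move=> s; rewrite mxE.
apply: xget_unique => /=.
  exists (fun i => polyO (P (sd i))); split; apply/rowP => s.
    by rewrite sumE iter_ord_predK mxE hx rmorphM.
  by rewrite sumE' iter_ord_predK mxE mulrA.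
move=> z [h [ex ->]]; apply/rowP => s; rewrite sumE' mxE -mulrA; congr (_ * _).
have := congr1 (fun x : 'rV[O]_l => x 0 s) ex; rewrite sumE mxE hx rmorphM.
by move=> /(powser_mulIf (polyO_bbar_neq0 s)).
Qed.

Lemma OtaudRP (u : 'rV[O]_l) : OtaudR u <-> exists w : 'I_l -> O, forall s, u 0 s = w s * polyO (bfac s).
Proof.
split=> [[n [a [y [hy ->]]]]|[w hw]].
  suff H s : exists w, (\sum_i a i *: y i) 0 s = w * polyO (bfac s).
    by have [w hw] := choice H; exists w.
  rewrite summxE; elim/big_ind: _ => [|x z [wx ->] [wz ->]|i _].
  - by exists 0; rewrite mul0r.
  - by exists (wx + wz); rewrite mulrDl.
  have [_ [x hx <-]] := hy i; have /divpK e := tauR_dvd l_gt0 s hx.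
  by exists (a i * polyO (x 0 s %/ bfac s)); rewrite !mxE -mulrA -rmorphM e.
exists l, (fun i => w (sd i)), (fun i => vecO (taud_e C i)); split.
  by move=> i; split=> //; exists (taud_e C i) => //; exists (delta_mx 0 i).
apply/rowP => s; rewrite (row_sum_pd _ _ (vecO_taud (taud_eE C l_gt0))).
by rewrite iter_ord_predK hw.
Qed.

Lemma psXc (w : O) : (psX C * w) 0%N = 0. Proof. by rewrite psXM. Qed.

(** The factor k = 0, which is t - theta when l divides s, belongs to the generator omega_0; the
    other factors survive at t = theta. *)
Lemma bfac_split s : exists r : {poly C}, bfac s = r * dfac s /\ r.[theta] = difprod C l s d.
Proof.
exists (\prod_(1 <= k < d | (k == s %[mod l])%N) ('X - (theta ^+ (q ^ k))%:P)); split.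
  rewrite mulrC /taufac -(prednK (d_gt0 v)) [in RHS]big_mkcond big_nat1.
  by rewrite big_ltn_cond //; case: ifP => // _; rewrite mul1r.
by rewrite horner_prod; apply: eq_bigr => k _; rewrite hornerXsubC.
Qed.

(** Modulo T_v - v the twisted diagonal entries of [Phi] become the constants [pval Phi 1]. *)
Lemma phi_vE p : phi_v Phi (cris_class p) = dR_class (fun s => p s * kappa Phi s).
Proof.
have /choice[r hr] := bfac_split.
have bf (s : 'I_l) : bfac s = r s * dfac s by have [] := hr s.
have rt (s : 'I_l) : (r s).[theta] = difprod C l s d by have [] := hr s.
(* The class of an element y of <tau^d R> is read off from its coordinates Q. *)
have dclass (y : dR) (Q : 'I_l -> {poly C}) : (forall s, kval y 0 s = Q s * bfac s) ->
    (forall s, (Q s).[theta] = p s * pval Phi 1 (pd s)) ->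
    \pi_HdR y = dR_class (fun s => p s * kappa Phi s).
  move=> hy hQ; rewrite (dR_classP (P := fun s => Q s * r s)) => [|s]; last first.
    by rewrite hy bf mulrA.
  congr dR_class; apply/funext => s; rewrite hornerM hQ rt /kappa; ring.
have yin : \row_s ((p s * pval Phi 1 (pd s))%:P * bfac s) \in in_kspan (tauR_t C l 1).
  by apply/asboolP/kspan_dR1 => // s; rewrite mxE bf mulrA dvdp_mull.
apply: xget_unique => /=.
  exists (KspanMod (cris_in (fun s => (p s)%:P))), (KspanMod yin); split=> //.
  - symmetry; apply: (dclass _ (fun s => (p s * pval Phi 1 (pd s))%:P)) => s; first by rewrite mxE.
    by rewrite hornerC.
  - by apply/kspan_dRd => // s; rewrite mxE dvdp_mull.
  have /choice[g hg] (s : 'I_l) : exists g, Y (pd s) - psC (pval Phi 1 (pd s)) = psX C * g.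
    by apply: psX_div; rewrite pcoefD pcoefN Y_const /= subrr.
  exists (\row_s (psC (p s) * g s * polyO (bfac s))); split.
    by apply/OtaudRP; exists (fun s => psC (p s) * g s) => s; rewrite mxE.
  apply/rowP => s; rewrite 2!mxE (Phi_vE (P := fun s => (p s)%:P)) => [|s']; last by rewrite mxE.
  rewrite !mxE rmorphM /= !polyO_C rmorphM /=.
  transitivity (psC (p s) * (Y (pd s) - psC (pval Phi 1 (pd s))) * polyO (bfac s)); first by ring.
  by rewrite hg; ring.
(* For any other admissible pair, comparing constant terms fixes the coordinates of y modulo t -
   theta, hence its class. *)
move=> z [x [y [/esym ex -> yd [u [/OtaudRP[w hw] e]]]]].
have [P hP] := cris_coord x.
rewrite (cris_classP hP) in ex; have {}ex := cris_class_inj ex.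
have /kspan_dRd hy := yd; have {}hy := hy l_gt0.
apply: (dclass _ (fun s => kval y 0 s %/ bfac s)) => s; first by rewrite divpK.
have := congr1 (fun x : 'rV[O]_l => x 0 s) e.
rewrite /= !mxE (Phi_vE hP) hw -[kval y 0 s](divpK (hy s)) rmorphM /=.
rewrite -mulrBl mulrA => /(powser_mulIf (polyO_taufac _ _ _ _)).
move/(congr1 (fun f : O => f 0%N)); rewrite psXc pcoefD pcoefN pcoefM big_ord1 !polyO_const.
by rewrite Y_const ex mulpK ?taufac_neq0 // => /subr0_eq <-.
Qed.

(** With f_s = tau^d ebar_{s-d} = bbar_s ebar_s and bbar over F_{q^d}, semilinearity gives tau^d
    f_{s-d} = bbar_{s-d} f_s; at t = theta the coefficient becomes a scalar. *)
Lemma tau_vE p : tau_v (cris_class p) = cris_class (fun s => p (pd s) * bbar_theta C l (pd s)).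
Proof.
have bt s : (bbar s).[theta] = bbar_theta C l s.
  by rewrite horner_prod; apply: eq_bigr => k _; rewrite hornerXsubC.
have tE n (a : 'I_n -> C) (m : 'I_n -> V) s : (forall i, tauRbar (m i)) ->
    (\sum_i (a i)%:P *: iter d (@taubar F v C l) (m i)) 0 s =
    bbar s * (\sum_i (a i)%:P *: m i) 0 (pd s).
  move=> hm; rewrite !summxE mulr_sumr; apply: eq_bigr => i _.
  rewrite !mxE iter_taubarE // 1?mulrCA // => j.
  exact: tauRbar_Fqd.
have coordE (x x' : cris) (P : 'I_l -> {poly C}) : (forall s, kval x 0 s = P s * bbar s) ->
    (forall s, kval x' 0 s = bbar s * kval x 0 (pd s)) -> (forall s, p s = (P s).[theta]) ->
    \pi_Hcris x' = cris_class (fun s => p (pd s) * bbar_theta C l (pd s)).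
  move=> hx hx' hp; rewrite (cris_classP (P := fun s => P (pd s) * bbar (pd s))) => [|s].
    by congr cris_class; apply/funext => s; rewrite hornerM bt hp.
  by rewrite hx' hx mulrC.
have [n [a [m [hm hx]]]] := kval_in (KspanMod (cris_in (fun s => (p s)%:P))).
have /choice[c hc] (i : 'I_n) : exists c : C, a i = c%:P by have [[c ->] _] := hm i; exists c.
have hm' i : tauRbar (m i) by have [] := hm i.
have xin : \sum_i (c i)%:P *: iter d (@taubar F v C l) (m i) \in in_kspan (tauRbar_t C l).
  by apply/asboolP/kspan_crisP => // s; rewrite tE // dvdp_mulr.
have hx' : kval (KspanMod (cris_in (fun s => (p s)%:P))) = \sum_i (c i)%:P *: m i.
  by rewrite hx; apply: eq_bigr => i _; rewrite hc.
apply: xget_unique => /=.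
  exists (KspanMod (cris_in (fun s => (p s)%:P))), (KspanMod xin); split=> //; last first.
    by exists n, c, m.
  symmetry; apply: (coordE (KspanMod (cris_in (fun s => (p s)%:P))) _ (fun s => (p s)%:P)) => s.
  - by rewrite mxE.
  - by rewrite hx' /= tE.
  - by rewrite hornerC.
move=> z [x [x' [/esym ex -> [k [b [w [hw ewx ewx']]]]]]].
have [P hP] := cris_coord x.
rewrite (cris_classP hP) in ex; have {}ex := cris_class_inj ex.
apply: (coordE x x' P) => // s; first by rewrite ewx' ewx tE.
Qed.

Lemma phi_v_inj c c' : phi_v Phi c = phi_v Phi c' -> c = c'.
Proof.
have H (e : Hcris) : exists p, e = cris_class p.
  elim/quotW: e => x; have [P hP] := cris_coord x.
  by exists (fun s => (P s).[theta]); rewrite (cris_classP hP).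
have [p ->] := H c; have [p' ->] := H c'; rewrite !phi_vE => /(dR_class_inj) e.
congr cris_class; apply/funext => s; apply: (mulIf (kappa_neq0 l_gt0 hPhi s)).
exact: e.
Qed.

Lemma rho_v_omega (s s0 : 'I_l) : pd s0 = s ->
  rho_v Phi (omega C s) =
    (kappa Phi s0 * bbar_theta C l s / kappa Phi s) *: omega C s0.
Proof.
move=> s0s; have k0 := kappa_neq0 l_gt0 hPhi s.
(* The preimage of omega_s under the comparison map: the inverse of [kappa] in coordinate s. *)
pose p (r : 'I_l) := (kappa Phi s)^-1 * (r == s)%:R.
have -> : omega C s = phi_v Phi (cris_class p).
  rewrite phi_vE -[LHS]scale1r omega_class; congr dR_class; apply/funext => r.
  rewrite /p; case: (eqVneq r s) => [->|_]; last by rewrite !mulr0 mul0r.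
  by rewrite !mulr1 mulVf.
have inv c : phi_v_inv Phi (phi_v Phi c) = c.
  by apply: xget_unique => // c' /=; exact: phi_v_inj.
rewrite /rho_v inv tau_vE phi_vE omega_class; congr dR_class; apply/funext => r.
rewrite /p -s0s (can_eq (@iter_ord_predK l d)) s0s.
case: (eqVneq r s0) => [->|_]; last by rewrite !mulr0 !mul0r.
rewrite s0s !mulr1 mulrC mulrA [RHS]mulrAC; congr (_ * _).
Qed.

End CrystallineFrobenius.
End Realizations.

Theorem theorem3p15 (F : finFieldType) (v : place F) (C : completion v)
    (l : nat) (hl : (0 < l)%N)
    (Phi : {linear 'rV[ringB C]_l -> 'rV[ringB C]_l}) (hPhi : hartl_kim Phi)
    (s s0 : 'I_l) (n' : nat) :
  let q := #|F| in
  let d := (size (v : {poly F})).-1 in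
  (s + d = s0 + n' * l)%N ->
  rho_v Phi (omega C s) =
    ((-1) ^+ n' *
     (if s == 0%N :> nat then - vK C else 1) *
     (gamma_ari C (1 - ratfrac ((q ^ (s + d))%:R / ((q ^ l)%:R - 1))) /
      gamma_ari C (1 - ratfrac ((q ^ (s + d - 1))%:R / ((q ^ l)%:R - 1))) ^+ q))
    *: omega C s0.
Proof.
move=> q d e; pose pd := iter d (@ord_pred l).
have e0 : (s0 = s + d %[mod l])%N by rewrite e addnC modnMDl.
have s0s : pd s0 = s.
  apply: val_inj; rewrite /= -[LHS](modn_small (ltn_ord _)) -[RHS](modn_small (ltn_ord _)).
  by apply/eqP; rewrite -(eqn_modDr d) (iter_ord_pred_mod hl) e0.
rewrite (rho_v_omega hl hPhi s0s); congr (_ *: _).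
set X := kappa Phi s0 * bbar_theta C l s / kappa Phi s.
have eX : X * kappa Phi s = kappa Phi s0 * bbar_theta C l s.
  by rewrite divfK // (kappa_neq0 hl hPhi).
have [z z1 hz] := frobenius_factor hl hPhi s0s eX.
apply: (gamma_quotient hl (ltn_ord s) (ltn_ord s0) e z1) => N N0.
(* [hz] has s0 where s + d is expected; the product depends only on the class modulo l. *)
by rewrite hz // (difprod_mod C _ e0).
Qed.
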